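(* Let $n\ge 1$, let $-1=x_0<x_1<\dots<x_n=1$, and let $m_1,\dots,m_n$ and $l_1,\dots,l_n$ be complex constants with every $m_i\neq 0$. Let $V:[-1,1]\to\mathbb{C}$ be the piecewise linear function with $V(x)=m_ix+l_i$ for $x_{i-1}<x<x_i$, $i=1,\dots,n$ (the first and last formulas holding also at $x_0=-1$ and $x_n=1$ respectively). Assume that for each $i\in\{1,\dots,n-1\}$, if $m_ix_i+l_i=m_{i+1}x_i+l_{i+1}$ then $m_i\neq m_{i+1}$. For $h>0$ let $H_h$ be the operator $$H_hf(x)=-h^2\frac{d^2f(x)}{dx^2}+V(x)f(x)$$ acting on $L^2(-1,1)$ with Dirichlet boundary conditions. Put $$T:=\bigcup_{i=1}^{n}Y\big(m_ix_{i-1}+l_i,\;m_ix_i+l_i\big)\subset\mathbb{C}.$$ Then for every $\varepsilon>0$ and every positive integer $N$ there exists $h_0>0$ such that for all $0<h<h_0$, $$\mathrm{Spec}(H_h)\cap\{z\in\mathbb{C}:|z|\le N\}\subset\mathrm{Nhd}(T;\varepsilon).$$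
   Context: The domain of $H_h$ is $\{f\in C[-1,1]: f(-1)=f(1)=0,\ f'\in C[-1,1],\ f''\in L^2(-1,1)\}$, with $f''$ initially understood as a distribution. $\mathrm{Arg}$ takes values in $(-\pi,\pi]$, and $w^{3/2}$ denotes the principal value. $\mathrm{Nhd}(T;\varepsilon):=\{t+z:t\in T,\ |z|<\varepsilon\}$. For $\alpha\neq\beta$ in $\mathbb{C}$ the set $Y(\alpha,\beta)\subset\mathbb{C}$ is defined as follows. Let $\theta:=\mathrm{Arg}(\beta-\alpha)$ and let $\sigma:=-1$ if $\theta\ge 0$, $\sigma:=+1$ if $\theta<0$. Let $\Gamma$ be the point of intersection of the two rays $\{\alpha+re^{2\theta i/3}:r\ge 0\}$ and $\{\beta+re^{2\theta i/3+2\sigma\pi i/3}:r\ge 0\}$. Then $Y(\alpha,\beta)$ is the union of the line segments $[\alpha,\Gamma]$ and $[\beta,\Gamma]$ and the infinite curve starting at $\Gamma$ which consists of those $\lambda$ in the closed sector with apex $\Gamma$ and opening angle $2\pi/3$ bounded by the rays $\{\Gamma+re^{2\theta i/3}:r\ge 0\}$ and $\{\Gamma+re^{2\theta i/3+2\sigma\pi i/3}:r\ge 0\}$ that satisfy $$\mathrm{Re}\{(e^{-2\theta i/3}(\alpha-\lambda))^{3/2}\}=\mathrm{Re}\{(e^{-2\theta i/3}(\beta-\lambda))^{3/2}\}.$$ (This curve is asymptotic to the horizontal line $\mathrm{Im}\,z=(\mathrm{Im}\,\alpha+\mathrm{Im}\,\beta)/2$.) *)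

(* Defs.v *)
(* The complex numbers are [R[i]] for [R : realType]. *)
From HB Require Import structures.
From mathcomp Require Export all_boot all_order all_algebra.
From mathcomp Require Export all_classical all_reals all_analysis.
From mathcomp Require Export complex.

Set Implicit Arguments.
Unset Strict Implicit.
Unset Printing Implicit Defensive.

Export Order.TTheory GRing.Theory Num.Theory.
Export numFieldNormedType.Exports.

Local Open Scope classical_set_scope.
Local Open Scope ring_scope.
Local Open Scope complex_scope.

Definition cmod {R : realType} (z : R[i]) : R := complex.Re `|z|.

Definition cis {R : realType} (t : R) : R[i] := cos t +i* sin t.

(* The argument in ]-pi, pi]; [carg 0] is a junk value. *)
Definition carg {R : realType} (w : R[i]) : R :=
  if 0 <= complex.Im w then acos (complex.Re w / cmod w)
  else - acos (complex.Re w / cmod w).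

Lemma cmod_sqrt {R : realType} (w : R[i]) :
  cmod w = Num.sqrt (complex.Re w ^+ 2 + complex.Im w ^+ 2).
Proof. by case: w. Qed.

Lemma cargP {R : realType} (w : R[i]) : w != 0 ->
  - pi < carg w <= pi /\ w = (cmod w)%:C * cis (carg w).
Proof.
case: w => a b w0; rewrite /carg cmod_sqrt /=.
set r := Num.sqrt _.
have s0 : 0 < a ^+ 2 + b ^+ 2.
  rewrite lt_neqAle addr_ge0 ?sqr_ge0// andbT eq_sym.
  by rewrite paddr_eq0 ?sqr_ge0// !sqrf_eq0; apply: contra w0 => /andP[/eqP-> /eqP->].
have r0 : 0 < r by rewrite sqrtr_gt0.
have r2 : r ^+ 2 = a ^+ 2 + b ^+ 2 by rewrite sqr_sqrtr// ltW.
have ar : `|a| <= r by rewrite -sqrtr_sqr ler_wsqrtr// lerDl sqr_ge0.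
have arB : -1 <= a / r <= 1.
  by rewrite ler_pdivlMr// ler_pdivrMr// mul1r mulN1r -ler_norml.
have sinA : r * sin (acos (a / r)) = `|b|.
  have rE : r = Num.sqrt (r ^+ 2) by rewrite sqrtr_sqr gtr0_norm.
  rewrite sin_acos// {1}rE -sqrtrM ?sqr_ge0// mulrBr mulr1 -exprMn.
  rewrite [r * _]mulrC divfK ?gt_eqF// r2 addrC addKr.
  by rewrite sqrtr_sqr.
have cosA : r * cos (acos (a / r)) = a.
  by rewrite acosK ?in_itv//= mulrC divfK ?gt_eqF.
have [b0|b0] := leP 0 b; split.
- rewrite acos_lepi// andbT (lt_le_trans _ (acos_ge0 arB))//.
  by rewrite oppr_lt0 pi_gt0.
- rewrite /cis; apply/eqP; rewrite eq_complex /= !mul0r subr0 addr0.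
  by rewrite cosA sinA ger0_norm// !eqxx.
- rewrite ltrN2 (le_trans _ (pi_ge0 _)) ?oppr_le0 ?acos_ge0// andbT.
  apply: acos_ltpi; case/andP: arB => arN ->; rewrite andbT.
  rewrite lt_neqAle arN andbT; apply/negP => /eqP E.
  move: r2; rewrite (_ : a = - r); last first.
    by rewrite -mulN1r E divfK// gt_eqF.
  rewrite sqrrN => /eqP; rewrite -[X in X == _]addr0 (inj_eq (addrI _)).
  by rewrite eq_sym sqrf_eq0 lt_eqF.
- rewrite /cis; apply/eqP; rewrite eq_complex /= !mul0r subr0 addr0.
  by rewrite cosN sinN mulrN cosA sinA ltr0_norm// opprK !eqxx.
Qed.

(* Principal value of [w] to the real power [a]; it is 0 at [w = 0] when
   [a != 0]. *)
Definition cpow {R : realType} (w : R[i]) (a : R) : R[i] :=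
  (powR (cmod w) a)%:C * cis (a * carg w).

Definition nhd {R : realType} (T : set R[i]) (eps : R) : set R[i] :=
  [set w | exists t z : R[i], [/\ T t, `|z| < eps%:C & w = t + z]].

Definition ray {R : realType} (a : R[i]) (t : R) : set R[i] :=
  [set a + r%:C * cis t | r in [set r : R | 0 <= r]].

Definition segment {R : realType} (a b : R[i]) : set R[i] :=
  [set (1 - t)%:C * a + t%:C * b | t in [set t : R | 0 <= t <= 1]].

(* Closed sector with apex [c] and bounding rays in the directions [t] and
   [t + s * w], for a sign [s = 1] or [s = -1]. *)
Definition sector {R : realType} (c : R[i]) (t s w : R) : set R[i] :=
  [set z | exists r p : R,
     [/\ 0 <= r, 0 <= p <= w & z = c + r%:C * cis (t + s * p)]].

(* For [a != b] the two rays meet in exactly one point [c], so the union has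
   exactly one term. *)
Definition Yset {R : realType} (a b : R[i]) : set R[i] :=
  let theta := carg (b - a) in
  let sigma : R := if 0 <= theta then -1 else 1 in
  let t : R := 2 * theta / 3 in
  \bigcup_(c in ray a t `&` ray b (t + 2 * sigma * pi / 3))
    (segment a c `|` segment b c `|`
     (sector c t sigma (2 * pi / 3) `&`
      [set z | complex.Re (cpow (cis (- t) * (a - z)) (3 / 2)) =
               complex.Re (cpow (cis (- t) * (b - z)) (3 / 2))])).

Definition I11 {R : realType} : set R := [set x | -1 < x < 1].

(* Elements of L^2(-1,1) are represented by functions on [R], of which only
   the restriction to ]-1, 1[ up to a.e. equality matters. *)
Definition eqae {R : realType} (f g : R -> R[i]) : Prop :=
  f = g %[ae (@lebesgue_measure R) in I11].

Definition L2 {R : realType} (f : R -> R[i]) : Prop :=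
  [/\ measurable_fun I11 (fun x => complex.Re (f x)),
      measurable_fun I11 (fun x => complex.Im (f x)) &
      (\int[@lebesgue_measure R]_(x in I11) (cmod (f x) ^+ 2)%:E < +oo)%E].

Definition L2norm {R : realType} (f : R -> R[i]) : R :=
  Num.sqrt (\int[@lebesgue_measure R]_(x in I11) (cmod (f x) ^+ 2)).

Definition cintegral {R : realType} (f : R -> R[i]) : R[i] :=
  (\int[@lebesgue_measure R]_(x in I11) complex.Re (f x)) +i*
  (\int[@lebesgue_measure R]_(x in I11) complex.Im (f x)).

(* Real-valued test functions suffice to characterise a complex-valued
   distribution. *)
Definition test_function {R : realType} (phi : R -> R) : Prop :=
  (forall (k : nat) (x : R), derivable (derive1n k phi) x 1) /\
  closure [set x | phi x != 0] `<=` I11.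

(* [g] is the second derivative of [f] in the sense of distributions. *)
Definition distr_deriv2 {R : realType} (f g : R -> R[i]) : Prop :=
  forall phi : R -> R, test_function phi ->
    cintegral (fun x => f x * (derive1n 2 phi x)%:C) =
    cintegral (fun x => g x * (phi x)%:C).

Definition ccontinuous {R : realType} (f : R -> R[i]) : Prop :=
  {within `[(-1 : R), 1], continuous (fun x : R => complex.Re (f x))} /\
  {within `[(-1 : R), 1], continuous (fun x : R => complex.Im (f x))}.

(* For [f] continuous on [-1, 1], this says that [f] is C^1 on [-1, 1] with
   one-sided derivatives at the end points. *)
Definition deriv_continuous {R : realType} (f : R -> R[i]) : Prop :=
  exists2 f1 : R -> R[i], ccontinuous f1 &
    forall x : R, I11 x ->
      is_derive x 1 (fun y : R => complex.Re (f y)) (complex.Re (f1 x)) /\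
      is_derive x 1 (fun y : R => complex.Im (f y)) (complex.Im (f1 x)).

Definition dirichlet_domain {R : realType} (f : R -> R[i]) : Prop :=
  [/\ ccontinuous f, f (-1) = 0 /\ f 1 = 0, deriv_continuous f &
      exists2 g, L2 g & distr_deriv2 f g].

(* Graph of H_h : [u] represents H_h f. *)
Definition schrodinger {R : realType} (h : R) (V : R -> R[i])
    (f u : R -> R[i]) : Prop :=
  [/\ dirichlet_domain f, L2 u &
      exists g, [/\ L2 g, distr_deriv2 f g &
        eqae u (fun x => - (h ^+ 2)%:C * g x + V x * f x)]].

(* [A] is the graph of an unbounded operator on L^2(-1,1): A - z is a
   bijection from the domain of [A] onto L^2(-1,1), with bounded inverse. *)
Definition resolvent_set {R : realType}
    (A : (R -> R[i]) -> (R -> R[i]) -> Prop) : set R[i] :=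
  [set z | [/\
    forall f u, A f u -> eqae (fun x => u x - z * f x) (fun=> 0) ->
      eqae f (fun=> 0),
    forall v, L2 v -> exists f u, A f u /\ eqae (fun x => u x - z * f x) v &
    exists M : R, forall f u, A f u ->
      L2norm f <= M * L2norm (fun x => u x - z * f x)]].

Definition spectrum {R : realType}
    (A : (R -> R[i]) -> (R -> R[i]) -> Prop) : set R[i] :=
  ~` resolvent_set A.

(* Main.v *)
(* Let [phi] solve [- h^2 phi'' + (V - z) phi = 0] with [phi(-1) = 0] and
   [phi'(-1) = 1]. By variation of constants, [z] is in the resolvent set of
   [H_h] as soon as [phi(1) != 0]. On the piece of index [i], [phi] extends to an
   entire solution of an Airy equation, which has the WKB approximations
   [r^(-1/2) exp(+- (2/3) r^3 / (m_i h))] in the variable [r] defined by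
   [r^2 = m_i x + l_i - z]. If [z] is off [Y(alpha, beta)], the values of [r] at
   the two end points can be chosen and joined, in the plane of [r^3], by one or
   two line segments that avoid 0 and along which [Re (r^3 / m_i)] increases.
   Along such a path a solution whose growing component has relative size at
   least a multiple of [h] becomes purely growing up to [O(h^2)]; and at a break
   point, where the value or the slope of [V] jumps, a purely growing solution
   keeps a growing component of relative size at least a multiple of [h], so that
   the argument can be repeated on the next piece. Hence [phi(1) != 0] for [h]
   small and [z] near a given point off [T], and compactness gives a uniform
   bound on [h]. *)

Require Import Defs.
From mathcomp Require Import ring lra zify measurable_realfun.

Set Implicit Arguments.
Unset Strict Implicit.
Unset Printing Implicit Defensive.

Local Open Scope classical_set_scope.
Local Open Scope ring_scope.
Local Open Scope complex_scope.

(** * Complex-valued derivatives *)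

(** Each Airy solution is entire, so its values at the two ends of a piece may be compared along any
    complex path. The paths are preimages of straight segments in the plane of the action
    [2 r ^ 3 / (3 m)]; along them the equation is an exact system for [ugrow] and [vdecay] whose
    coupling is of order [h]. The estimates are shaped by break points where [V] is continuous: if
    the two roots there are opposite, the growing component survives only through the slope jump,
    with a factor of order [h]. A first order WKB error would hide it. Hence second order WKB
    quantities, a relative error [O(h ^ 2)] on leaving a piece, and only [O(1 / h)] on entering the
    next; a segment improves [C / h] to [C' h ^ 2], so the loop closes. For the geometry, the plane
    is cut into three sectors by the rays on which the real part of [w ^ (3/2)] vanishes. Looking
    for [alpha - z] and [beta - z] among them shows that a good path can be missing only in case of
    a tie inside one sector or when one of the points lies on a wall; these are the curve and the
    two segments of [Y]. *)

Section ComplexModulus.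
Context {R : realType}.
Implicit Types (z w : R[i]) (x y : R).

Lemma cmodM z w : cmod (z * w) = cmod z * cmod w.
Proof. exact: Normc.normcM. Qed.

Lemma cmod_ge0 z : 0 <= cmod z.
Proof. by rewrite cmod_sqrt sqrtr_ge0. Qed.

Lemma cmod0 : cmod (0 : R[i]) = 0.
Proof. exact: Normc.normc0. Qed.

Lemma cmod1 : cmod (1 : R[i]) = 1.
Proof. exact: Normc.normc1. Qed.

Lemma cmodV z : cmod z^-1 = (cmod z)^-1.
Proof. exact: Normc.normcV. Qed.

Lemma cmodN z : cmod (- z) = cmod z.
Proof. by rewrite /cmod normrN. Qed.

Lemma cmodB z w : cmod (z - w) = cmod (w - z).
Proof. by rewrite -cmodN opprB. Qed.

Lemma cmod_eq0 z : (cmod z == 0) = (z == 0).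
Proof.
by apply/eqP/eqP => [/Normc.eq0_normc//|->]; exact: cmod0.
Qed.

Lemma cmod_gt0 z : (0 < cmod z) = (z != 0).
Proof. by rewrite lt_neqAle cmod_ge0 andbT eq_sym cmod_eq0. Qed.

Lemma le_cmodD z w : cmod (z + w) <= cmod z + cmod w.
Proof. exact: le_normcD. Qed.

Lemma le_cmodB z w : cmod (z - w) <= cmod z + cmod w.
Proof. by rewrite -(cmodN w) le_cmodD. Qed.

Lemma cmod_le_sub z w : cmod z - cmod w <= cmod (z - w).
Proof. by rewrite lerBlDr -{1}(subrK w z) le_cmodD. Qed.

Lemma cmodX z n : cmod (z ^+ n) = cmod z ^+ n.
Proof. by elim: n => [|n IH]; rewrite ?expr0 ?cmod1// !exprS cmodM IH. Qed.

Lemma cmod_real x : cmod x%:C = `|x|.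
Proof. by rewrite cmod_sqrt /= expr0n addr0 sqrtr_sqr. Qed.

Lemma cmod_nat n : cmod (n%:R : R[i]) = n%:R.
Proof.
by rewrite (_ : n%:R = (n%:R : R)%:C) ?cmod_real ?normr_nat// rmorph_nat.
Qed.

Lemma sqr_cmod z : cmod z ^+ 2 = complex.Re z ^+ 2 + complex.Im z ^+ 2.
Proof. by rewrite cmod_sqrt sqr_sqrtr// addr_ge0 ?sqr_ge0. Qed.

Lemma normr_Re_le z : `|complex.Re z| <= cmod z.
Proof. by rewrite cmod_sqrt -sqrtr_sqr ler_wsqrtr// lerDl sqr_ge0. Qed.

Lemma normr_Im_le z : `|complex.Im z| <= cmod z.
Proof. by rewrite cmod_sqrt -sqrtr_sqr ler_wsqrtr// lerDr sqr_ge0. Qed.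

Lemma cmod_le_ReIm z : cmod z <= `|complex.Re z| + `|complex.Im z|.
Proof.
case: z => a b; rewrite cmod_sqrt /= -(@ger0_norm _ (`|a| + `|b|)) ?addr_ge0//.
rewrite -sqrtr_sqr ler_wsqrtr// sqrrD !real_normK ?num_real//.
by rewrite lerD2r lerDl mulrn_wge0 ?mulr_ge0.
Qed.

Lemma normC_cmod z : `|z| = (cmod z)%:C.
Proof. by []. Qed.

Lemma ReD z w : complex.Re (z + w) = complex.Re z + complex.Re w.
Proof. by case: z; case: w. Qed.

Lemma ImD z w : complex.Im (z + w) = complex.Im z + complex.Im w.
Proof. by case: z; case: w. Qed.

Lemma ReN z : complex.Re (- z) = - complex.Re z.
Proof. by case: z. Qed.

Lemma ImN z : complex.Im (- z) = - complex.Im z.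
Proof. by case: z. Qed.

Lemma ReM z w : complex.Re (z * w) =
  complex.Re z * complex.Re w - complex.Im z * complex.Im w.
Proof. by case: z; case: w. Qed.

Lemma ImM z w : complex.Im (z * w) =
  complex.Re z * complex.Im w + complex.Im z * complex.Re w.
Proof. by case: z; case: w. Qed.

Lemma ReMl x z : complex.Re (x%:C * z) = x * complex.Re z.
Proof. by rewrite ReM /= mul0r subr0. Qed.

Lemma ImMl x z : complex.Im (x%:C * z) = x * complex.Im z.
Proof. by rewrite ImM /= mul0r addr0. Qed.

Lemma eqC z w : complex.Re z = complex.Re w -> complex.Im z = complex.Im w ->
  z = w.
Proof. by case: z => a b; case: w => c d /= -> ->. Qed.

End ComplexModulus.

Section RealVariable.
Context {R : realType}.
Implicit Types (f g : R -> R[i]) (s t : R) (A B : R[i] -> R[i]).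

Lemma is_derive_epsP (f : R -> R) s d :
  is_derive s 1 f d <-> forall e, 0 < e -> exists2 del, 0 < del &
    forall t, `|t - s| < del -> `|f t - f s - (t - s) * d| <= e * `|t - s|.
Proof.
split.
- move=> [df dfE] e e0.
  have : h^-1 *: ((f \o shift s) (h *: (1 : R)) - f s) @[h --> (0 : R)^'] --> d.
    by rewrite -dfE; exact: df.
  move=> /cvgrPdist_le /(_ e e0) /nbhs_ballP[del /= del0 H].
  exists del => // t ts.
  have [->|tns] := eqVneq t s.
    by rewrite !subrr mul0r !subrr normr0 mulr0.
  have tn0 : t - s != 0 by rewrite subr_eq0.
  have := H (t - s).
  rewrite /ball /= sub0r normrN => /(_ ts tn0).
  rewrite /shift /= /GRing.scale /= mulr1 subrK => Hd.
  rewrite -normrN opprB.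
  rewrite (_ : _ - _ = (d - (t - s)^-1 * (f t - f s)) * (t - s)); last first.
    by field.
  by rewrite normrM ler_wpM2r.
- move=> H.
  have cf : h^-1 *: ((f \o shift s) (h *: (1 : R)) - f s)
      @[h --> (0 : R)^'] --> d.
    apply/cvgrPdist_le => e e0; have [del del0 Hd] := H e e0.
    apply/nbhs_ballP; exists del => //= h.
    rewrite /ball /= sub0r normrN => hd hn0.
    rewrite /shift /= /GRing.scale /= mulr1.
    have := Hd (h + s); rewrite addrK => /(_ hd).
    rewrite -(ler_pM2r (_ : 0 < `|h|^-1)) ?invr_gt0 ?normr_gt0// mulfK ?normr_eq0//.
    rewrite -normfV -normrM -normrN; congr (_ <= _); congr `|_|.
    by field.
  split; first by apply/cvg_ex; exists d.
  exact/cvg_lim.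
Qed.

(** Componentwise, as in the definition of the operator domain. [cder_epsP] gives the equivalent
    estimate in modulus, on which the chain rule with a complex derivative [cdiff] rests. *)
Definition cder f s (d : R[i]) : Prop :=
  is_derive s 1 (fun y => complex.Re (f y)) (complex.Re d) /\
  is_derive s 1 (fun y => complex.Im (f y)) (complex.Im d).

Lemma cder_epsP f s d :
  cder f s d <-> forall e, 0 < e -> exists2 del, 0 < del &
    forall t, `|t - s| < del ->
      cmod (f t - f s - (t - s)%:C * d) <= e * `|t - s|.
Proof.
split.
- move=> [/is_derive_epsP dR /is_derive_epsP dI] e e0.
  have e2 : 0 < e / 2 by rewrite divr_gt0.
  have [d1 d10 H1] := dR _ e2; have [d2 d20 H2] := dI _ e2.
  exists (Num.min d1 d2); first by rewrite lt_min d10.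
  move=> t; rewrite lt_min => /andP[/H1 h1 /H2 h2].
  rewrite (le_trans (cmod_le_ReIm _))// !ReD !ImD !ReN !ImN ReMl ImMl.
  by rewrite (splitr e) [leRHS]mulrDl lerD.
- move=> H; split; apply/is_derive_epsP => e e0; have [del del0 Hd] := H e e0;
    exists del => // t /Hd; apply: le_trans.
  + by apply: le_trans (normr_Re_le _); rewrite !ReD !ReN ReMl.
  + by apply: le_trans (normr_Im_le _); rewrite !ImD !ImN ImMl.
Qed.

Definition cdiff A (w d : R[i]) : Prop :=
  forall e : R, 0 < e -> exists2 del : R, 0 < del &
    forall w' : R[i], cmod (w' - w) < del ->
      cmod (A w' - A w - (w' - w) * d) <= e * cmod (w' - w).

Lemma cder_lip f s d : cder f s d -> exists2 del, 0 < del &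
  forall t, `|t - s| < del -> cmod (f t - f s) <= (cmod d + 1) * `|t - s|.
Proof.
move=> /cder_epsP /(_ 1 ltr01)[del del0 H]; exists del => // t /H Ht.
rewrite -(subrK ((t - s)%:C * d) (f t - f s)) (le_trans (le_cmodD _ _))//.
by rewrite cmodM cmod_real; lra.
Qed.

Lemma cder_comp A f s d d' : cdiff A (f s) d' -> cder f s d ->
  cder (A \o f) s (d' * d).
Proof.
move=> dA df; apply/cder_epsP => e e0.
have k0 : 0 < cmod d + 1 by rewrite ltr_pwDr ?cmod_ge0.
have k0' : 0 < cmod d' + 1 by rewrite ltr_pwDr ?cmod_ge0.
have [d1 d10 H1] := cder_lip df.
have e1 : 0 < e / 2 / (cmod d + 1) by rewrite !divr_gt0.
have [d2 d20 H2] := dA _ e1.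
have e2 : 0 < e / 2 / (cmod d' + 1) by rewrite !divr_gt0.
move/cder_epsP: df => /(_ _ e2)[d3 d30 H3].
exists (Num.min d1 (Num.min (d2 / (cmod d + 1)) d3)).
  by rewrite !lt_min d10 d30 divr_gt0.
move=> t; rewrite !lt_min => /and3P[t1 t2 t3].
have h1 := H1 _ t1; have h3 := H3 _ t3.
have /H2 h2 : cmod (f t - f s) < d2.
  by rewrite (le_lt_trans h1)// mulrC -ltr_pdivlMr.
rewrite /= (_ : _ - _ = (A (f t) - A (f s) - (f t - f s) * d') +
  d' * (f t - f s - (t - s)%:C * d)); last by ring.
rewrite (le_trans (le_cmodD _ _))// cmodM (splitr e) [leRHS]mulrDl lerD//.
- rewrite (le_trans h2)//.
  rewrite -[leRHS](@divfK _ (cmod d + 1)) ?gt_eqF//.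
  rewrite -[leRHS]mulrA [leRHS](_ : _ = e / 2 / (cmod d + 1) *
    ((cmod d + 1) * `|t - s|)); last by field; rewrite gt_eqF.
  by rewrite ler_wpM2l// ltW.
- have : cmod d' * cmod (f t - f s - (t - s)%:C * d) <=
    (cmod d' + 1) * (e / 2 / (cmod d' + 1) * `|t - s|).
    by rewrite ler_pM ?cmod_ge0// lerDl.
  by move/le_trans; apply; rewrite le_eqVlt; apply/orP; left; apply/eqP;
    field; rewrite gt_eqF.
Qed.

Lemma cder_eq f s d d' : cder f s d -> d = d' -> cder f s d'.
Proof. by move=> ? <-. Qed.

Lemma cder_cst (c : R[i]) s : cder (fun=> c) s 0.
Proof. by split; apply: is_derive_cst. Qed.

Lemma cder_id s : cder (fun t => t%:C) s 1.
Proof. by split; [apply: is_derive_id|apply: is_derive_cst]. Qed.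

Lemma cderD f g s d d' : cder f s d -> cder g s d' ->
  cder (fun t => f t + g t) s (d + d').
Proof.
move=> [f1 f2] [g1 g2]; split.
  rewrite ReD (_ : (fun _ => _) =
    (fun y => complex.Re (f y)) + (fun y => complex.Re (g y))).
    exact: is_deriveD.
  by apply/funext => y; rewrite ReD.
rewrite ImD (_ : (fun _ => _) =
  (fun y => complex.Im (f y)) + (fun y => complex.Im (g y))).
  exact: is_deriveD.
by apply/funext => y; rewrite ImD.
Qed.

Lemma cderM f g s d d' : cder f s d -> cder g s d' ->
  cder (fun t => f t * g t) s (d * g s + f s * d').
Proof.
move=> [f1 f2] [g1 g2]; split.
  rewrite (_ : (fun _ => _) =
    (fun y => complex.Re (f y)) * (fun y => complex.Re (g y)) -
    (fun y => complex.Im (f y)) * (fun y => complex.Im (g y))).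
    apply: is_derive_eq (is_deriveB (is_deriveM f1 g1) (is_deriveM f2 g2)) _.
    by rewrite !ReD !ReM /GRing.scale /=; ring.
  by apply/funext => y; rewrite ReM.
rewrite (_ : (fun _ => _) =
  (fun y => complex.Re (f y)) * (fun y => complex.Im (g y)) +
  (fun y => complex.Im (f y)) * (fun y => complex.Re (g y))).
  apply: is_derive_eq (is_deriveD (is_deriveM f1 g2) (is_deriveM f2 g1)) _.
  by rewrite !ImD !ImM /GRing.scale /=; ring.
by apply/funext => y; rewrite ImM.
Qed.

Lemma cderZ c f s d : cder f s d -> cder (fun t => c * f t) s (c * d).
Proof. by move=> df; apply: cder_eq (cderM (cder_cst c s) df) _; rewrite mul0r add0r. Qed.

Lemma cderN f s d : cder f s d -> cder (fun t => - f t) s (- d).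
Proof.
move=> df; apply: cder_eq (_ : cder _ s (-1 * d)) _; last by rewrite mulN1r.
rewrite (_ : (fun t => - f t) = fun t => -1 * f t); first exact: cderZ.
by apply/funext => t; rewrite mulN1r.
Qed.

Lemma cderB f g s d d' : cder f s d -> cder g s d' ->
  cder (fun t => f t - g t) s (d - d').
Proof. by move=> df dg; apply: cderD => //; apply: cderN. Qed.

Lemma cdiffV (w : R[i]) : w != 0 -> cdiff (fun w => w^-1) w (- w ^- 2).
Proof.
move=> w0 e e0; have W0 : 0 < cmod w by rewrite cmod_gt0.
(* The first bound keeps [|w'| >= |w| / 2]; the second beats the remainder
   [(w' - w) ^ 2 / (w' w ^ 2)]. *)
exists (Num.min (cmod w / 2) (e / 2 * cmod w ^+ 3)).
  by rewrite lt_min !mulr_gt0 ?exprn_gt0// ?invr_gt0.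
move=> w'; rewrite lt_min => /andP[h1 h2].
have W2 : cmod w / 2 <= cmod w'.
  have := cmod_le_sub w (w - w'); rewrite (_ : w - (w - w') = w'); last by ring.
  by rewrite (cmodB w); lra.
have W'0 : 0 < cmod w' by rewrite (lt_le_trans _ W2)// divr_gt0.
have w'0 : w' != 0 by rewrite -cmod_gt0.
rewrite (_ : _ - _ = (w' - w) ^+ 2 * (w' * w ^+ 2)^-1); last first.
  by field; rewrite w0 w'0.
rewrite cmodM cmodV [cmod (w' * _)]cmodM !cmodX expr2 -mulrA mulrC.
rewrite ler_wpM2r ?cmod_ge0// ler_pdivrMr ?mulr_gt0 ?exprn_gt0//.
rewrite (le_trans (ltW h2))// -mulrA ler_wpM2l ?(ltW e0)//.
have := ler_wpM2r (ltW (exprn_gt0 2 W0)) W2.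
rewrite [cmod w ^+ 3]exprS; lra.
Qed.

Lemma cderV f s d : f s != 0 -> cder f s d ->
  cder (fun t => (f t)^-1) s (- d / f s ^+ 2).
Proof.
move=> fs0 df; apply: cder_eq (cder_comp (cdiffV fs0) df) _.
by rewrite mulNr mulrC mulNr.
Qed.

Lemma cderX f s d n : cder f s d ->
  cder (fun t => f t ^+ n.+1) s (n.+1%:R * f s ^+ n * d).
Proof.
move=> df; elim: n => [|n IH].
  rewrite (_ : (fun t => f t ^+ 1) = f); last by apply/funext => t; rewrite expr1.
  by rewrite expr0 !mul1r.
rewrite (_ : (fun t => f t ^+ n.+2) = fun t => f t * f t ^+ n.+1).
  apply: cder_eq (cderM df IH) _.
  rewrite exprS [in RHS]mulrSr; ring.
by apply/funext => t; rewrite exprS.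
Qed.

Lemma is_derive_sqr_cmod f s d : cder f s d ->
  is_derive s 1 (fun t => cmod (f t) ^+ 2) (2 * complex.Re ((f s)^* * d)).
Proof.
move=> [f1 f2].
rewrite (_ : (fun _ => _) =
    (fun y => complex.Re (f y)) ^+ 2 + (fun y => complex.Im (f y)) ^+ 2).
  apply: is_derive_eq (is_deriveD (is_deriveX 2 f1) (is_deriveX 2 f2)) _.
  rewrite ReM /= !expr1 /GRing.scale /=.
  case: (f s) => a b /=; ring.
by apply/funext => t; rewrite sqr_cmod.
Qed.

Lemma cder_continuous f s d : cder f s d ->
  {for s, continuous (fun y => complex.Re (f y))} /\
  {for s, continuous (fun y => complex.Im (f y))}.
Proof.
by move=> [[d1 _] [d2 _]]; split; apply/differentiable_continuous/derivable1_diffP.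
Qed.

Lemma is_derive_real_continuous (f : R -> R) s d : is_derive s 1 f d ->
  {for s, continuous f}.
Proof. by move=> [df _]; apply/differentiable_continuous/derivable1_diffP. Qed.

Lemma derive_le0_le (f df : R -> R) (a b : R) : a <= b ->
  (forall x, a <= x <= b -> is_derive x 1 f (df x)) ->
  (forall x, a <= x <= b -> df x <= 0) -> f b <= f a.
Proof.
move=> ab fd fd0.
have [||c] := @MVT_segment R f df a b ab.
- by move=> x; rewrite in_itv /= => /andP[ax xb]; apply: fd; rewrite !ltW.
- apply: continuous_in_subspaceT => x; rewrite inE /= in_itv /= => xab.
  exact: is_derive_real_continuous (fd _ xab).
- rewrite in_itv /= => cab fE.
  by rewrite -subr_le0 fE mulr_le0_ge0 ?fd0// subr_ge0.
Qed.

Lemma derive_ge0_le (f df : R -> R) (a b : R) : a <= b ->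
  (forall x, a <= x <= b -> is_derive x 1 f (df x)) ->
  (forall x, a <= x <= b -> 0 <= df x) -> f a <= f b.
Proof.
move=> ab fd fd0; rewrite -lerN2.
apply: (@derive_le0_le (fun x => - f x) (fun x => - df x) _ _ ab) => x xab.
- by have := fd x xab => ?; exact: is_deriveN.
- by rewrite oppr_le0 fd0.
Qed.

End RealVariable.

(** * WKB solutions along a segment *)

Section WKBSegment.
Context {R : realType}.

Lemma Re_conjM_ge (c z : R[i]) : complex.Re (z^* * (c * z)) =
  complex.Re c * cmod z ^+ 2.
Proof. by rewrite sqr_cmod; case: c => a b; case: z => x y /=; ring. Qed.

Lemma Re_conjM_le (w z : R[i]) : `|complex.Re (z^* * w)| <= cmod z * cmod w.
Proof.
rewrite (le_trans (normr_Re_le _))// cmodM (_ : cmod z^* = cmod z)//.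
by rewrite !cmod_sqrt; case: z => x y /=; rewrite sqrrN.
Qed.

(** Controls the derivative of [|u| ^ 2 - L |v| ^ 2] in [wkb_segment], with [a = |u|] and [b = |v|].
    The damping terms absorb the coupling: each of the four coupling terms costs at most one eighth
    of the damping, the mixed ones by the arithmetic-geometric inequality, which is what the last
    two hypotheses provide. Only half of [q L b ^ 2] is available because the other half pays for
    the derivative of [L]. *)
Lemma energy_decay_ineq (q g L a b : R) : 0 < q -> 0 <= g -> 0 < L ->
  0 <= a -> 0 <= b -> 8 * g <= q -> 16 * g ^+ 2 <= q ^+ 2 * L ->
  16 * g ^+ 2 * L <= q ^+ 2 ->
  - q * a ^+ 2 + g * (a * b + a ^+ 2) - q / 2 * L * b ^+ 2
   + g * L * (b ^+ 2 + a * b) <= 0.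
Proof.
move=> q0 g0 L0 a0 b0 gq H1 H2.
have E1 : g * (a * b) <= q / 8 * L * b ^+ 2 + q / 8 * a ^+ 2.
  have : 0 <= (q * L * b - 4 * g * a) ^+ 2 by exact: sqr_ge0.
  have : 0 <= (q ^+ 2 * L - 16 * g ^+ 2) * a ^+ 2.
    by rewrite mulr_ge0 ?sqr_ge0// subr_ge0.
  move=> h1 h2; have : 0 <= q * L * (q / 8 * L * b ^+ 2 + q / 8 * a ^+ 2 - g * (a * b)).
    nra.
  by rewrite pmulr_rge0 ?mulr_gt0// subr_ge0.
have E2 : g * L * (a * b) <= q / 8 * L * b ^+ 2 + q / 8 * a ^+ 2.
  have : 0 <= L * (q * b - 4 * g * a) ^+ 2 by rewrite mulr_ge0 ?sqr_ge0// ltW.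
  have : 0 <= (q ^+ 2 - 16 * g ^+ 2 * L) * a ^+ 2.
    by rewrite mulr_ge0 ?sqr_ge0// subr_ge0.
  move=> h1 h2; have : 0 <= q * (q / 8 * L * b ^+ 2 + q / 8 * a ^+ 2 - g * L * (a * b)).
    nra.
  by rewrite pmulr_rge0// subr_ge0.
have E3 : g * a ^+ 2 <= q / 8 * a ^+ 2 by rewrite ler_wpM2r ?sqr_ge0//; lra.
have E4 : g * (L * b ^+ 2) <= q / 8 * (L * b ^+ 2).
  by rewrite ler_wpM2r ?mulr_ge0 ?sqr_ge0 ?(ltW L0)//; lra.
have : 0 <= q * a ^+ 2 by rewrite mulr_ge0 ?sqr_ge0// ltW.
have : 0 <= q * (L * b ^+ 2) by rewrite !mulr_ge0 ?sqr_ge0// ltW.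
lra.
Qed.

(** The exponent 6 is the one that turns [(C / h) ^ 2 * exp (- kap / (2 h))] into a multiple of
    [h ^ 4], the square of the target precision. *)
Lemma expRN_le_pow6 (y : R) : 0 < y -> expR (- y) <= (6 / y) ^+ 6.
Proof.
move=> y0; rewrite expRN.
have h : (y / 6) ^+ 6 <= expR y.
  rewrite -{2}(@divfK _ 6 _ y)// [X in _ <= expR X]mulrC (expRM_natl 6) lerXn2r ?nnegrE ?expR_ge0//.
    by rewrite divr_ge0// ltW.
  by have := expR_ge1Dx (y / 6); lra.
rewrite -[leRHS]invrK lef_pV2 ?posrE ?expR_gt0 ?invr_gt0 ?exprn_gt0 ?divr_gt0//.
by rewrite -exprVn invf_div.
Qed.

(** [S0 + s D] is the action along the path. The ratio [|u| / |v|] is trapped under a moving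
    barrier: [|u| ^ 2 - L |v| ^ 2] stays nonpositive for [L = L0 exp (- q s / 2) + L1], where [L0]
    is the square of the initial ratio and [L1], of order [h ^ 4], is the level at which coupling
    and damping balance. At [s = 1] the exponential has made the first term as small as the
    second. *)
Lemma wkb_segment (kap M del C : R) : 0 < kap -> 0 < M -> 0 < del -> 0 < C ->
  exists h1 C' : R, [/\ 0 < h1, 0 < C' &
  forall (h : R) (u v : R -> R[i]) (S0 D : R[i]), 0 < h < h1 ->
    kap <= complex.Re D -> cmod D <= M ->
    (forall s : R, 0 <= s <= 1 -> del <= cmod (S0 + s%:C * D)) ->
    (forall s : R, 0 <= s <= 1 -> cder u s
      (- (D * (h%:C^-1 - (6 * (S0 + s%:C * D))^-1)) * u s
       - 5 / 72 * h%:C * D / (S0 + s%:C * D) ^+ 2 * (v s - u s))) ->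
    (forall s : R, 0 <= s <= 1 -> cder v s
      (D * (h%:C^-1 + (6 * (S0 + s%:C * D))^-1) * v s
       - 5 / 72 * h%:C * D / (S0 + s%:C * D) ^+ 2 * (v s - u s))) ->
    v 0 != 0 -> cmod (u 0) <= C / h * cmod (v 0) ->
    v 1 != 0 /\ cmod (u 1) <= C' * h ^+ 2 * cmod (v 1)].
Proof.
move=> kap0 M0 del0 C0.
(* [h K] bounds the coupling coefficient [5 / 72 h D / S ^ 2]. *)
pose K := M / del ^+ 2.
have K0 : 0 < K by rewrite divr_gt0// exprn_gt0.
have KE : K = M / del ^+ 2 by []; clearbody K.
(* Chosen so that [16 g ^ 2 = q ^ 2 L1] holds exactly for [L1 = be h ^ 4]. *)
pose be := 64 * (K / kap) ^+ 2.
have be0 : 0 < be by rewrite mulr_gt0// exprn_gt0// divr_gt0.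
have beE : be = 64 * (K / kap) ^+ 2 by []; clearbody be.
(* The number [12 / kap] is [6 / y] at [y = kap / (2 h)], up to the factor [h]. *)
pose ga := C ^+ 2 * (12 / kap) ^+ 6 + be.
have ga0 : 0 < ga by rewrite addr_gt0// mulr_gt0// exprn_gt0// divr_gt0.
have gaE : ga = C ^+ 2 * (12 / kap) ^+ 6 + be by []; clearbody ga.
(* The four bounds give, in turn, [h < 1], [|D / (6 S)| <= q / 2], [8 g <= q] and
   [16 g ^ 2 L <= q ^ 2]. *)
pose h1 := Num.min 1 (Num.min (3 * del * kap / M)
  (Num.min (kap / (16 * K)) (be * (C ^+ 2 + be + 1))^-1)).
exists h1, (Num.sqrt ga); split.
- by rewrite /h1 !lt_min ltr01 !(divr_gt0, mulr_gt0)//= invr_gt0 mulr_gt0 ?addr_gt0// exprn_gt0.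
- by rewrite sqrtr_gt0.
move=> h u v S0 D /andP[h0]; rewrite /h1 !lt_min => /and4P[hl1 hl2 hl3 hl4].
move=> DR DM SM du dv v0 uv0.
pose S (s : R) : R[i] := S0 + s%:C * D.
pose q := kap / h; pose g := 2 * h * K.
have q0 : 0 < q by rewrite divr_gt0.
have g0 : 0 <= g by rewrite !mulr_ge0 ?(ltW h0) ?(ltW K0).
have qE : q = kap / h by []; have gE : g = 2 * h * K by [].
clearbody q g.
have kE (s : R) : 0 <= s <= 1 ->
    cmod (5 / 72 * h%:C * D / S s ^+ 2) <= g / 2.
  move=> s01; have Ss := SM s s01.
  have Sp : 0 < cmod (S s) by rewrite (lt_le_trans del0).
  rewrite !cmodM !cmodV cmodX !cmod_nat cmod_real gtr0_norm//.
  rewrite (_ : g / 2 = 1 * h * M * (del ^+ 2)^-1); last first.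
    by rewrite gE KE; field; rewrite gt_eqF.
  apply: ler_pM; rewrite ?mulr_ge0 ?cmod_ge0 ?invr_ge0 ?sqr_ge0// ?(ltW h0)//.
    apply: ler_pM; rewrite ?mulr_ge0 ?cmod_ge0 ?(ltW h0)//.
    by rewrite ler_wpM2r ?(ltW h0)//; lra.
  by rewrite lef_pV2 ?posrE ?exprn_gt0// lerXn2r ?nnegrE ?cmod_ge0// ltW.
have kE' (s : R) (x : R[i]) : 0 <= s <= 1 ->
    `|complex.Re (x^* * (5 / 72 * h%:C * D / S s ^+ 2 * (v s - u s)))| <=
    g / 2 * (cmod x * (cmod (v s) + cmod (u s))).
  move=> s01; rewrite (le_trans (Re_conjM_le _ _))// cmodM mulrCA.
  rewrite ler_pM ?cmod_ge0 ?mulr_ge0 ?cmod_ge0 ?kE//.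
  by rewrite ler_wpM2l ?cmod_ge0// le_cmodB.
have DS (s : R) : 0 <= s <= 1 -> `|complex.Re (D / (6 * S s))| <= q / 2.
  move=> s01; have Ss := SM s s01.
  have Sp : 0 < cmod (S s) by rewrite (lt_le_trans del0).
  rewrite (le_trans (normr_Re_le _))// cmodM cmodV cmodM cmod_nat.
  rewrite ler_pdivrMr ?mulr_gt0// (le_trans DM)//.
  move: hl2; rewrite ltr_pdivlMr// => /ltW hl2.
  have : M <= 3 * q * del.
    rewrite (_ : 3 * q * del = 3 * del * kap / h); last first.
      by rewrite qE; field; rewrite gt_eqF.
    by rewrite ler_pdivlMr// mulrC.
  move/le_trans; apply.
  by have : q * del <= q * cmod (S s) by [rewrite ler_wpM2l// ltW]; lra.
have DhE : complex.Re (D / h%:C) >= q.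
  rewrite qE (_ : D / h%:C = (h^-1)%:C * D); last by rewrite mulrC fmorphV.
  by rewrite ReMl mulrC ler_wpM2l// invr_ge0 ltW.
have dU (s : R) : 0 <= s <= 1 -> complex.Re ((u s)^* *
    (- (D * (h%:C^-1 - (6 * S s)^-1)) * u s
       - 5 / 72 * h%:C * D / S s ^+ 2 * (v s - u s))) <=
    - (q / 2) * cmod (u s) ^+ 2 + g / 2 * (cmod (u s) * cmod (v s) + cmod (u s) ^+ 2).
  move=> s01; rewrite mulrBr ReD ReN Re_conjM_ge; apply: lerD.
    rewrite ler_wpM2r ?sqr_ge0// mulrBr !ReN ReD ReN.
    by have := DS s s01; rewrite ler_norml => /andP[_]; lra.
  have := kE' s (u s) s01; rewrite ler_norml => /andP[+ _]; lra.
have dV (s : R) : 0 <= s <= 1 -> complex.Re ((v s)^* *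
    (D * (h%:C^-1 + (6 * S s)^-1) * v s
       - 5 / 72 * h%:C * D / S s ^+ 2 * (v s - u s))) >=
    (q / 2) * cmod (v s) ^+ 2 - g / 2 * (cmod (v s) ^+ 2 + cmod (u s) * cmod (v s)).
  move=> s01; rewrite mulrBr ReD ReN Re_conjM_ge; apply: lerD.
    rewrite ler_wpM2r ?sqr_ge0// mulrDr !ReD.
    by have := DS s s01; rewrite ler_norml => /andP[+ _]; lra.
  have := kE' s (v s) s01; rewrite ler_norml => /andP[_ +]; lra.
pose L0 := (C / h) ^+ 2; pose L1 := be * h ^+ 4.
have L00 : 0 < L0 by rewrite exprn_gt0// divr_gt0.
have L10 : 0 < L1 by rewrite mulr_gt0// exprn_gt0.
pose E (s : R) : R := expR (- (q / 2) * s).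
pose L (s : R) : R := L0 * E s + L1.
have Lge s : L1 <= L s by rewrite lerDr mulr_ge0 ?expR_ge0// ltW.
have L_gt0 s : 0 < L s by rewrite (lt_le_trans L10).
have gq8 : 8 * g <= q.
  rewrite gE qE ler_pdivlMr//.
  move: hl3; rewrite ltr_pdivlMr ?mulr_gt0// => hl3.
  have : h * (h * (16 * K)) <= 1 * (h * (16 * K)).
    by rewrite ler_wpM2r ?mulr_ge0 ?(ltW h0) ?(ltW K0)// ltW.
  lra.
have gL (s : R) : 0 <= s -> 16 * g ^+ 2 * L s <= q ^+ 2.
  move=> s0; have : L s <= L0 + L1.
    rewrite lerD2r -[leRHS]mulr1 ler_wpM2l ?(ltW L00)// -expR0 ler_expR.
    by rewrite mulNr oppr_le0 mulr_ge0// divr_ge0// ltW.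
  have g2 : 0 <= 16 * g ^+ 2 by rewrite mulr_ge0// sqr_ge0.
  move/(ler_wpM2l g2)/le_trans; apply.
  move: hl4; rewrite -[ltRHS]mul1r ltr_pdivlMr ?mulr_gt0 ?addr_gt0 ?exprn_gt0//.
  move=> hl4.
  rewrite (_ : 16 * g ^+ 2 * _ = (kap / h) ^+ 2 * (be * h ^+ 4 * (L0 + L1))); last first.
    by rewrite gE beE; field; rewrite !gt_eqF.
  rewrite qE -[leRHS]mulr1 ler_wpM2l ?sqr_ge0//.
  rewrite (_ : _ * _ = h ^+ 2 * (be * (C ^+ 2 + be * h ^+ 6))); last first.
    by rewrite /L0 /L1; field; rewrite gt_eqF.
  apply: le_trans (ltW hl4).
  apply: ler_pM; rewrite ?sqr_ge0 ?mulr_ge0 ?addr_ge0 ?mulr_ge0 ?exprn_ge0 ?(ltW h0) ?(ltW be0) ?(ltW C0)//.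
    by rewrite expr2 -[leRHS]mul1r ler_wpM2r ?(ltW h0)// ltW.
  rewrite ler_wpM2l ?(ltW be0)//.
  have : h ^+ 6 <= 1 by rewrite exprn_ile1// ltW.
  by move/(ler_wpM2l (ltW be0)); lra.
have gL1 (s : R) : 16 * g ^+ 2 <= q ^+ 2 * L s.
  apply: le_trans (_ : q ^+ 2 * L1 <= _); last by rewrite ler_wpM2l ?sqr_ge0.
  rewrite le_eqVlt; apply/orP; left; apply/eqP.
  by rewrite /L1 gE qE beE; field; rewrite !gt_eqF.
have dE (s : R) : is_derive s (1 : R) E (- (q / 2) * E s).
  rewrite /E; apply: is_derive_eq (@is_derive1_comp _ _ _ _ _ _ (is_derive_expR _)
    (_ : is_derive s 1 (fun s => - (q / 2) * s) (- (q / 2)))) _; last first.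
    by rewrite mulrC.
  by apply: is_derive_eq; rewrite /GRing.scale /= mulr1 ?scale0r ?mulr0 ?addr0.
pose Phi (s : R) : R := cmod (u s) ^+ 2 - L s * cmod (v s) ^+ 2.
have Phi0 (s : R) : 0 <= s <= 1 -> Phi s <= 0.
  move=> /andP[s0 s1].
  have Phi00 : Phi 0 <= 0.
    rewrite /Phi subr_le0 (le_trans (_ : _ <= (C / h * cmod (v 0)) ^+ 2))//.
      by rewrite lerXn2r ?nnegrE ?mulr_ge0 ?invr_ge0 ?cmod_ge0 ?(ltW h0) ?(ltW C0).
    by rewrite exprMn ler_wpM2r ?sqr_ge0// /L /E mulr0 expR0 mulr1 lerDl ltW.
  apply: le_trans Phi00.
  apply: (derive_le0_le s0) => [t /andP[t0 ts]|t /andP[t0 ts]].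
    have t01 : 0 <= t <= 1 by rewrite t0 (le_trans ts).
    have d1 := is_derive_sqr_cmod (du t t01).
    have d2 := is_derive_sqr_cmod (dv t t01).
    have dL : is_derive t 1 L (L0 * (- (q / 2) * E t)).
      apply: is_derive_eq (is_deriveD (is_deriveM (is_derive_cst L0 t 1) (dE t))
         (is_derive_cst L1 t 1)) _.
      by rewrite /GRing.scale /= mulr0 !addr0.
    exact: is_deriveB d1 (is_deriveM dL d2).
  have t01 : 0 <= t <= 1 by rewrite t0 (le_trans ts).
  have h2 := dU t t01; have h3 := dV t t01.
  have h4 := energy_decay_ineq q0 g0 (L_gt0 t) (cmod_ge0 (u t)) (cmod_ge0 (v t))
    gq8 (gL1 t) (gL t t0).
  rewrite /GRing.scale /=.
  move/(ler_wpM2l (ltW (L_gt0 t))): h3 => h3.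
  have h5 : L0 * E t * (q / 2) * cmod (v t) ^+ 2 <= L t * (q / 2) * cmod (v t) ^+ 2.
    by rewrite ler_wpM2r ?sqr_ge0// ler_wpM2r ?divr_ge0 ?(ltW q0)// lerDl ltW.
  move: h2 h3 h4 h5; rewrite /S; set X1 := complex.Re _; set X2 := complex.Re _.
  clear; lra.
(* The barrier now bounds the coupling term in the derivative of [|v| ^ 2] by the growth term, so
   [|v|] cannot decrease and [v 1] cannot vanish. *)
have v01 : cmod (v 0) ^+ 2 <= cmod (v 1) ^+ 2.
  apply: (@derive_ge0_le _ (fun t => cmod (v t) ^+ 2) _ 0 1 ler01
    (fun t t01 => is_derive_sqr_cmod (dv t t01))) => t t01.
  rewrite mulr_ge0//; apply: le_trans (dV t t01).
  have P := Phi0 t t01; rewrite /Phi subr_le0 in P.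
  have /andP[t0 _] := t01.
  have h4 : 4 * g * cmod (u t) <= q * cmod (v t).
    rewrite -(@ler_pXn2r _ 2)// ?nnegrE ?mulr_ge0 ?cmod_ge0 ?(ltW q0)//.
    apply: le_trans (_ : 16 * g ^+ 2 * L t * cmod (v t) ^+ 2 <= _); last first.
      by rewrite exprMn ler_wpM2r ?sqr_ge0// gL.
    have := ler_wpM2l (_ : 0 <= 16 * g ^+ 2) P; rewrite mulr_ge0 ?sqr_ge0//.
    by move=> /(_ isT); rewrite !exprMn; lra.
  have := ler_wpM2r (cmod_ge0 (v t)) h4.
  have := ler_wpM2r (sqr_ge0 (cmod (v t))) gq8.
  have : 0 <= q * cmod (v t) ^+ 2 by rewrite mulr_ge0 ?sqr_ge0// ltW.
  lra.
have v1 : v 1 != 0.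
  rewrite -cmod_gt0 lt_neqAle cmod_ge0 andbT eq_sym; apply/eqP => v10.
  move: v01; rewrite v10 expr0n /= => /le_lt_trans => /(_ (cmod (v 0) ^+ 2)).
  by rewrite exprn_gt0 ?cmod_gt0// ltxx => /(_ isT).
split => //.
have P := Phi0 1; rewrite ler01 lexx subr_le0 in P; have {}P := P isT.
rewrite -(@ler_pXn2r _ 2)// ?nnegrE ?mulr_ge0 ?sqrtr_ge0 ?sqr_ge0 ?cmod_ge0 ?(ltW h0)//.
apply: (le_trans P); rewrite exprMn ler_wpM2r ?sqr_ge0//.
rewrite exprMn sqr_sqrtr ?(ltW ga0)// -exprM.
rewrite /L gaE mulrDl lerD2r /E mulr1.
have qq : 0 < q / 2 by rewrite divr_gt0.
have := expRN_le_pow6 qq => /(ler_wpM2l (ltW L00))/le_trans; apply.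
rewrite le_eqVlt; apply/orP; left; apply/eqP.
by rewrite /L0 qE; field; rewrite !gt_eqF.
Qed.

End WKBSegment.

(** * Entire solutions of the Airy equation *)

Section EntireSeries.
Context {R : realType}.
Implicit Types (a b : nat -> R[i]) (w S : R[i]).

Definition has_csum b S : Prop :=
  forall e : R, 0 < e -> exists N, forall n, (N <= n)%N ->
    cmod (\sum_(k < n) b k - S) <= e.

Lemma has_csumD b b' S S' : has_csum b S -> has_csum b' S' ->
  has_csum (fun k => b k + b' k) (S + S').
Proof.
move=> H H' e e0; have e2 : 0 < e / 2 by rewrite divr_gt0.
have [N HN] := H _ e2; have [N' HN'] := H' _ e2.
exists (maxn N N') => n; rewrite geq_max => /andP[/HN h /HN' h'].
rewrite big_split /= opprD addrACA (splitr e).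
by rewrite (le_trans (le_cmodD _ _))// lerD.
Qed.

Lemma has_csumZ c b S : has_csum b S -> has_csum (fun k => c * b k) (c * S).
Proof.
move=> H e e0; have c0 : 0 < cmod c + 1 by rewrite ltr_pwDr// cmod_ge0.
have [N HN] := H _ (divr_gt0 e0 c0); exists N => n /HN h.
rewrite -mulr_sumr -mulrBr cmodM.
rewrite -[leRHS](@divfK _ (cmod c + 1)) ?gt_eqF// [leRHS]mulrC.
by rewrite ler_pM ?cmod_ge0// lerDl.
Qed.

Lemma has_csum_shift b S : has_csum (fun k => b k.+1) S ->
  has_csum b (b 0%N + S).
Proof.
move=> H e /H[N HN]; exists N.+1 => -[//|n] /HN.
by rewrite big_ord_recl opprD addrACA subrr add0r.
Qed.

Lemma has_csum_le b S B : has_csum b S ->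
  (forall n, cmod (\sum_(k < n) b k) <= B) -> cmod S <= B.
Proof.
move=> H HB; apply/ler_addgt0Pr => e /H[N HN].
have := HN N (leqnn N); have := HB N.
rewrite cmodB => h1 h2.
rewrite -(subrK (\sum_(k < N) b k) S) (le_trans (le_cmodD _ _))//.
by rewrite addrC lerD.
Qed.

Lemma has_csum_uniq b S S' : has_csum b S -> has_csum b S' -> S = S'.
Proof.
move=> H H'; apply/eqP; rewrite -subr_eq0 -cmod_eq0 eq_le cmod_ge0 andbT.
apply: (@has_csum_le (fun k => b k + -1 * b k)).
  by rewrite -(mulN1r S'); apply: has_csumD => //; apply: has_csumZ.
by move=> n; rewrite big1 ?cmod0// => k _; rewrite mulN1r subrr.
Qed.

Definition geometric_bound b (C : R) := forall k, cmod (b k) <= C * 2^-1 ^+ k.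

Lemma sum_half_le (C : R) n : 0 <= C -> \sum_(k < n) C * 2^-1 ^+ k <= 2 * C.
Proof.
move=> C0; rewrite -mulr_sumr mulrC ler_wpM2r//.
suff -> : \sum_(k < n) (2^-1 : R) ^+ k = 2 - 2 * 2^-1 ^+ n.
  by rewrite lerBlDr lerDl mulr_ge0// exprn_ge0// invr_ge0.
elim: n => [|n IH]; first by rewrite big_ord0 expr0; ring.
by rewrite big_ord_recr /= IH exprS; field.
Qed.

Lemma geometric_bound_ge0 b C : geometric_bound b C -> 0 <= C.
Proof. by move=> /(_ 0%N); rewrite expr0 mulr1; apply: le_trans; exact: cmod_ge0. Qed.

Lemma geometric_bound_le b C S : geometric_bound b C -> has_csum b S ->
  cmod S <= 2 * C.
Proof.
move=> H HS; apply: has_csum_le HS _ => n.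
apply: le_trans (sum_half_le n (geometric_bound_ge0 H)).
elim: n => [|n IH]; first by rewrite !big_ord0 cmod0.
by rewrite !big_ord_recr /= (le_trans (le_cmodD _ _))// lerD.
Qed.

Lemma geometric_bound_real_cvg (r : nat -> R) C :
  (forall k, `|r k| <= C * 2^-1 ^+ k) -> cvgn (series r).
Proof.
move=> H; apply: normed_cvg.
apply: (@series_le_cvg _ _ (geometric C 2^-1)) => [n|n|n|].
- exact: normr_ge0.
- by rewrite /geometric /= (le_trans _ (H n)).
- by rewrite /geometric /=.
- by apply: is_cvg_geometric_series; rewrite ger0_norm ?invr_ge0// invf_lt1// ltr1n.
Qed.

Lemma geometric_bound_has_csum b C : geometric_bound b C ->
  exists S, has_csum b S.
Proof.
move=> H.
have cR : cvgn (series (fun k => complex.Re (b k))).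
  apply: (@geometric_bound_real_cvg _ C) => k.
  exact: le_trans (normr_Re_le _) (H k).
have cI : cvgn (series (fun k => complex.Im (b k))).
  apply: (@geometric_bound_real_cvg _ C) => k.
  exact: le_trans (normr_Im_le _) (H k).
exists (limn (series (fun k => complex.Re (b k))) +i*
        limn (series (fun k => complex.Im (b k)))) => e e0.
have e2 : 0 < e / 2 by rewrite divr_gt0.
have /cvgrPdist_le/(_ _ e2)[N _ HN] := cR.
have /cvgrPdist_le/(_ _ e2)[N' _ HN'] := cI.
exists (maxn N N') => n; rewrite geq_max => /andP[/HN h /HN' h'].
rewrite (le_trans (cmod_le_ReIm _))// (splitr e).
have ReE : complex.Re (\sum_(k < n) b k) = series (fun k => complex.Re (b k)) n.
  rewrite /series /= big_mkord; elim: (n) => [|p IH]; first by rewrite !big_ord0.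
  by rewrite !big_ord_recr /= ReD IH.
have ImE : complex.Im (\sum_(k < n) b k) = series (fun k => complex.Im (b k)) n.
  rewrite /series /= big_mkord; elim: (n) => [|p IH]; first by rewrite !big_ord0.
  by rewrite !big_ord_recr /= ImD IH.
by rewrite lerD// ?ReD ?ImD ?ReN ?ImN ?ReE ?ImE distrC.
Qed.

(** Boundedness at every radius passes easily to derivatives and recurrences, and at twice a radius
    it yields a geometric majorant of ratio 1/2 by [half_exp_bound]. *)
Definition entire_coeff a := forall rho : R, 0 < rho ->
  exists C, forall k, cmod (a k) * rho ^+ k <= C.

(** The default value 0 is never taken for coefficients satisfying [entire_coeff], by [psumP]. *)
Definition psum a w : R[i] := xget 0 [set S | has_csum (fun k => a k * w ^+ k) S].

Lemma half_exp_bound (x y C : R) k : 0 <= x -> 0 <= y ->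
  x * (2 * y) ^+ k <= C -> x * y ^+ k <= C * 2^-1 ^+ k.
Proof.
move=> x0 y0; rewrite exprMn mulrCA => h.
by rewrite exprVn ler_pdivlMr ?exprn_gt0// mulrC.
Qed.

Lemma psumP a w : entire_coeff a -> has_csum (fun k => a k * w ^+ k) (psum a w).
Proof.
move=> ea; suff [S HS] : exists S, has_csum (fun k => a k * w ^+ k) S.
  by apply: (@xgetPex _ _ [set S | has_csum (fun k => a k * w ^+ k) S]); exists S.
have w0 : 0 < 2 * (cmod w + 1) by rewrite mulr_gt0// ltr_pwDr// cmod_ge0.
have [C HC] := ea _ w0; apply: (@geometric_bound_has_csum _ C) => k.
rewrite cmodM cmodX; apply: le_trans (half_exp_bound _ _ (HC k)).
- by rewrite ler_wpM2l ?cmod_ge0// lerXn2r ?nnegrE ?addr_ge0 ?cmod_ge0// lerDl.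
- exact: cmod_ge0.
- by rewrite addr_ge0 ?cmod_ge0.
Qed.

Definition dcoeff a k := k.+1%:R * a k.+1.

Lemma natr_le_exp2 (k : nat) : (k%:R : R) <= 2 ^+ k.
Proof. by rewrite -natrX ler_nat ltnW// ltn_expl. Qed.

Lemma entire_dcoeff a : entire_coeff a -> entire_coeff (dcoeff a).
Proof.
move=> ea rho r0.
have [C HC] := ea (2 * (rho + 1)) (mulr_gt0 (ltr0Sn _ 1) (addr_gt0 r0 ltr01)).
exists C => k; apply: le_trans (HC k.+1); rewrite /dcoeff cmodM cmod_nat.
rewrite exprMn mulrA [X in _ <= X * _]mulrC ler_pM ?mulr_ge0 ?exprn_ge0 ?cmod_ge0 ?(ltW r0)//.
  by rewrite ler_wpM2r ?cmod_ge0// natr_le_exp2.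
rewrite exprS -[leLHS]mul1r ler_pM ?exprn_ge0 ?(ltW r0)//; first by rewrite lerDr ltW.
by rewrite lerXn2r ?nnegrE ?addr_ge0 ?(ltW r0)// lerDl.
Qed.

(** The assumption [1 <= rho] lets lower powers be bounded by [rho ^ k]; the crude factor [k ^ 2] is
    harmless because coefficients are bounded at every radius. *)
Lemma expr_taylor2 (w w' : R[i]) (rho : R) k : 1 <= rho ->
  cmod w <= rho -> cmod w' <= rho ->
  cmod (w' ^+ k - w ^+ k - (w' - w) * (k%:R * w ^+ k.-1)) <=
    k%:R ^+ 2 * rho ^+ k * cmod (w' - w) ^+ 2.
Proof.
move=> r1 wr w'r; have r0 : 0 <= rho by rewrite (le_trans ler01).
elim: k => [|k IH].
  by rewrite !expr0 subrr mul0r mulr0 subrr cmod0 expr0n !mul0r.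
have -> : w' ^+ k.+1 - w ^+ k.+1 - (w' - w) * (k.+1%:R * w ^+ k.+1.-1) =
   w' * (w' ^+ k - w ^+ k - (w' - w) * (k%:R * w ^+ k.-1)) +
   (w' - w) ^+ 2 * (k%:R * w ^+ k.-1).
  case: k {IH} => [|k] /=; first by rewrite !expr1 !expr0; ring.
  by rewrite !exprS -[k.+2%:R]natr1; ring.
rewrite (le_trans (le_cmodD _ _))// !cmodM.
have h1 : cmod w' * cmod (w' ^+ k - w ^+ k - (w' - w) * (k%:R * w ^+ k.-1)) <=
   k%:R ^+ 2 * rho ^+ k.+1 * cmod (w' - w) ^+ 2.
  rewrite [rho ^+ k.+1]exprS [leRHS](_ : _ = rho * (k%:R ^+ 2 * rho ^+ k * cmod (w' - w) ^+ 2)).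
    by rewrite ler_pM ?cmod_ge0.
  by ring.
have h2 : cmod (k%:R : R[i]) * cmod (w ^+ k.-1) <= k%:R * rho ^+ k.+1.
  rewrite cmod_nat cmodX ler_wpM2l//.
  apply: le_trans (_ : rho ^+ k.-1 <= _).
    by rewrite lerXn2r ?nnegrE ?cmod_ge0//.
  by rewrite ler_weXn2l//; lia.
rewrite -expr2; have := ler_wpM2l (sqr_ge0 (cmod (w' - w))) h2.
have : 0 <= k.+1%:R * rho ^+ k.+1 * cmod (w' - w) ^+ 2.
  by rewrite mulr_ge0 ?sqr_ge0// mulr_ge0 ?exprn_ge0.
by move: h1; rewrite -[k.+1%:R]natr1; lra.
Qed.

Lemma cdiff_psum a w : entire_coeff a -> cdiff (psum a) w (psum (dcoeff a) w).
Proof.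
move=> ea e e0; pose rho := cmod w + 1.
have rho1 : 1 <= rho by rewrite lerDr cmod_ge0.
have rho0 : 0 < rho by rewrite (lt_le_trans ltr01).
(* The factor 4 pays for [k ^ 2 <= 4 ^ k], the factor 2 for the geometric majorant. *)
have [C HC] := ea (2 * (4 * rho)) (mulr_gt0 (ltr0Sn _ 1) (mulr_gt0 (ltr0Sn _ 3) rho0)).
have C0 : 0 <= C.
  by apply: le_trans (HC 0%N); rewrite expr0 mulr1 cmod_ge0.
have HC' k : cmod (a k) * (k%:R ^+ 2 * rho ^+ k) <= C * 2^-1 ^+ k.
  have := half_exp_bound (cmod_ge0 (a k)) (mulr_ge0 (ler0n _ 4) (ltW rho0)) (HC k).
  apply: le_trans; rewrite ler_wpM2l ?cmod_ge0// exprMn ler_wpM2r ?exprn_ge0 ?(ltW rho0)//.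
  rewrite (_ : 4 = 2 ^+ 2); last by rewrite -natrX.
  by rewrite exprAC lerXn2r ?nnegrE ?exprn_ge0// natr_le_exp2.
exists (Num.min 1 (e / (2 * C + 1))).
  by rewrite lt_min ltr01 divr_gt0// ltr_pwDr// mulr_ge0.
move=> w'; rewrite lt_min => /andP[w1 w2].
have w'rho : cmod w' <= rho.
  by rewrite -(subrK w w') (le_trans (le_cmodD _ _))// addrC lerD2l ltW.
have wrho : cmod w <= rho by rewrite lerDl.
have H : has_csum
   (fun k => a k * w' ^+ k + (-1 * (a k * w ^+ k) + - (w' - w) * (a k * (k%:R * w ^+ k.-1))))
   (psum a w' + (-1 * psum a w + - (w' - w) * psum (dcoeff a) w)).
  apply: has_csumD; first exact: psumP.
  apply: has_csumD; first by apply: has_csumZ; exact: psumP.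
  apply: has_csumZ.
  rewrite -[X in has_csum _ X]add0r.
  rewrite [X in has_csum _ (X + _)](_ : 0 = a 0%N * (0%:R * w ^+ 0%N.-1)); last by ring.
  apply: (@has_csum_shift (fun k => a k * (k%:R * w ^+ k.-1))).
  have := psumP w (entire_dcoeff ea).
  by congr has_csum; apply/funext => k; rewrite /dcoeff /=; ring.
have HB : geometric_bound
    (fun k => a k * w' ^+ k + (-1 * (a k * w ^+ k) + - (w' - w) * (a k * (k%:R * w ^+ k.-1))))
    (C * cmod (w' - w) ^+ 2).
  move=> k; rewrite (_ : _ + _ = a k * (w' ^+ k - w ^+ k - (w' - w) * (k%:R * w ^+ k.-1))); last first.
    by rewrite mulN1r mulNr !mulrBr addrA; congr (_ - _); rewrite mulrCA.
  rewrite cmodM mulrAC.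
  apply: le_trans (ler_wpM2l (cmod_ge0 _) (expr_taylor2 k rho1 wrho w'rho)) _.
  by rewrite mulrA ler_wpM2r ?sqr_ge0.
rewrite [X in cmod X <= _](_ : _ = psum a w' + (-1 * psum a w + - (w' - w) * psum (dcoeff a) w)); last first.
  by rewrite mulN1r mulNr addrA.
apply: le_trans (geometric_bound_le HB H) _.
rewrite expr2 !mulrA ler_wpM2r ?cmod_ge0//.
move: w2; rewrite ltr_pdivlMr; last by rewrite ltr_pwDr// mulr_ge0.
by have := cmod_ge0 (w' - w); lra.
Qed.

Lemma psum0 a : entire_coeff a -> psum a 0 = a 0%N.
Proof.
move=> ea; apply: has_csum_uniq (psumP 0 ea) _ => e e0; exists 1%N => -[//|n] _.
rewrite big_ord_recl big1 ?addr0 ?expr0 ?mulr1 ?subrr ?cmod0 ?ltW//.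
by move=> k _; rewrite exprS mul0r mulr0.
Qed.

Section AiryCoefficients.
Variables m c y0 y1 : R[i].

(** Taylor coefficients of the solution of [y'' = (m w + c) y]. Carrying three consecutive ones
    makes the three-step recurrence structurally recursive. *)
Fixpoint airy_triple (k : nat) : R[i] * R[i] * R[i] :=
  if k is k'.+1 then
    let: (p, q, r) := airy_triple k' in
    (q, r, (c * q + m * p) / (k'.+3%:R * k'.+2%:R))
  else (y0, y1, c * y0 / 2).

Definition airy_coeff k := (airy_triple k).1.1.

Lemma airy_coeffE k : airy_triple k = (airy_coeff k, airy_coeff k.+1, airy_coeff k.+2).
Proof. by rewrite /airy_coeff /=; case: (airy_triple k) => -[]. Qed.

Lemma airy_coeff3 k : airy_coeff k.+3 =
  (c * airy_coeff k.+1 + m * airy_coeff k) / (k.+3%:R * k.+2%:R).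
Proof.
have : airy_triple k.+1 = (airy_coeff k.+1, airy_coeff k.+2, airy_coeff k.+3).
  exact: airy_coeffE.
by rewrite /= airy_coeffE => -[<-].
Qed.

(** Past the index [K + 3] the denominator exceeds [A], so a weighted coefficient is bounded by any
    common bound of the earlier ones; the sum of the initial ones is such a bound. *)
Lemma entire_airy_coeff : entire_coeff airy_coeff.
Proof.
move=> rho r0; pose b k := cmod (airy_coeff k) * rho ^+ k.
have b0 k : 0 <= b k by rewrite mulr_ge0 ?cmod_ge0// exprn_ge0// ltW.
pose A := cmod c * rho ^+ 2 + cmod m * rho ^+ 3.
have A0 : 0 <= A by rewrite addr_ge0// mulr_ge0 ?cmod_ge0 ?exprn_ge0// ltW.
pose K := (Num.truncn A).+1.
have AK : A <= K%:R by rewrite ltW// truncnS_gt.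
exists (\sum_(k < K.+3) b k) => k; rewrite -/(b k).
set B := \sum_(k < _) _.
elim/ltn_ind: k => k IH.
have [kK|kK] := ltnP k K.+3.
  by rewrite /B (bigD1 (Ordinal kK)) //= lerDl sumr_ge0.
case: k kK IH => [|[|[|k]]]// kK IH.
rewrite /b airy_coeff3 cmodM cmodV cmodM !cmod_nat.
have k32 : 0 < (k.+3%:R * k.+2%:R : R) by rewrite mulr_gt0.
rewrite mulrAC ler_pdivrMr//.
have h1 := IH k.+1 (ltnW (ltnSn _)); have h0 := IH k (ltnW (ltnW (ltnSn _))).
have B0 : 0 <= B by rewrite sumr_ge0.
apply: le_trans (_ : B * A <= _).
  apply: le_trans (ler_wpM2r _ (le_cmodD _ _)) _; first by rewrite exprn_ge0// ltW.
  rewrite !cmodM.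
  have /ler_wpM2r h1' := h1; have /ler_wpM2r h0' := h0.
  have e1 : 0 <= cmod c * rho ^+ 2 by rewrite mulr_ge0 ?cmod_ge0// exprn_ge0// ltW.
  have e2 : 0 <= cmod m * rho ^+ 3 by rewrite mulr_ge0 ?cmod_ge0// exprn_ge0// ltW.
  have := h1' _ e1; have := h0' _ e2; rewrite /b /A !exprS; lra.
rewrite ler_wpM2l// (le_trans AK)// -natrM ler_nat; nia.
Qed.

Lemma airy_psum_eq w :
  psum (dcoeff (dcoeff airy_coeff)) w = (m * w + c) * psum airy_coeff w.
Proof.
have ea := entire_airy_coeff; have H := psumP w ea.
apply: has_csum_uniq (psumP w (entire_dcoeff (entire_dcoeff ea))) _.
rewrite mulrDl addrC; move/(has_csumZ c): (H) => H1.
have H2 : has_csum (fun k => if k is k'.+1 then m * w * (airy_coeff k' * w ^+ k') else 0)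
    (m * w * psum airy_coeff w).
  by rewrite -[X in has_csum _ X]add0r; apply: has_csum_shift; apply: has_csumZ.
have := has_csumD H1 H2; congr has_csum; apply/funext => -[|k].
  by rewrite /dcoeff expr0 /airy_coeff /=; field.
rewrite /dcoeff airy_coeff3 exprS; field.
by rewrite -!natrD !pnatr_eq0.
Qed.

End AiryCoefficients.

(** Expanding at [t0] makes the initial data the first two coefficients and shifts [c] to
    [c + m t0]. *)
Lemma airy_exists (m c t0 y0 y1 : R[i]) : exists Y Y1 : R[i] -> R[i],
  [/\ Y t0 = y0, Y1 t0 = y1, forall t, cdiff Y t (Y1 t) &
      forall t, cdiff Y1 t ((m * t + c) * Y t)].
Proof.
pose a := airy_coeff m (c + m * t0) y0 y1.
have ea : entire_coeff a by exact: entire_airy_coeff.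
have shift (A : R[i] -> R[i]) t d : cdiff A (t - t0) d ->
    cdiff (fun t => A (t - t0)) t d.
  move=> H e /H[del del0 Hd]; exists del => // t' t't.
  have E : t' - t0 - (t - t0) = t' - t by ring.
  by have := Hd (t' - t0); rewrite E; apply.
exists (fun t => psum a (t - t0)), (fun t => psum (dcoeff a) (t - t0)); split.
- by rewrite subrr psum0.
- by rewrite subrr psum0; [rewrite /dcoeff /= mul1r|exact: entire_dcoeff].
- by move=> t; apply: shift; exact: cdiff_psum.
- move=> t; apply: shift.
  have -> : (m * t + c) * psum a (t - t0) = psum (dcoeff (dcoeff a)) (t - t0).
    by rewrite airy_psum_eq; congr (_ * _); ring.
  by apply: cdiff_psum; exact: entire_dcoeff.
Qed.

End EntireSeries.

(** * Cube roots along a segment *)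

Section CubeRoot.
Context {R : realType}.
Implicit Types (z w : R[i]) (x y : R).

Lemma cisD x y : cis (x + y) = cis x * cis y.
Proof. by apply: eqC; rewrite /= ?cosD ?sinD// addrC [X in X + _]mulrC. Qed.

(** The open sector [|arg z| < pi / 3], the range of the principal cube root off the cut, written
    algebraically. *)
Definition sector3 z : Prop :=
  0 < complex.Re z /\ complex.Im z ^+ 2 < 3 * complex.Re z ^+ 2.

Lemma sector3_neq0 z : sector3 z -> z != 0.
Proof. by move=> [z0 _]; apply: contraTneq z0 => ->; rewrite ltxx. Qed.

(** Different cube roots of one number make an angle [2 pi / 3], which does not fit into the open
    sector. Algebraically, [X1 + i X2 = z * w^*] would be a root of [X ^ 2 + N X + N ^ 2] with
    [N = |w| ^ 2], whence [X1 = - N / 2]. *)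
Lemma sector3_cube_inj z w : sector3 z -> sector3 w -> z ^+ 3 = w ^+ 3 -> z = w.
Proof.
case: z => a b; case: w => c d [/= a0 ab] [/= c0 cd] E.
have [//|zw] := eqVneq (a +i* b) (c +i* d).
have zw0 : (a +i* b) - (c +i* d) != 0 by rewrite subr_eq0.
have : ((a +i* b) - (c +i* d)) *
    ((a +i* b) ^+ 2 + (a +i* b) * (c +i* d) + (c +i* d) ^+ 2) = 0.
  by transitivity ((a +i* b) ^+ 3 - (c +i* d) ^+ 3); [ring|rewrite E subrr].
move/eqP; rewrite mulf_eq0 (negbTE zw0) /= => /eqP Q.
pose N := c ^+ 2 + d ^+ 2; pose X1 := a * c + b * d; pose X2 := b * c - a * d.
have N0 : 0 < N by rewrite /N ltr_pwDl ?exprn_gt0 ?sqr_ge0.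
have XE : (X1 +i* X2) ^+ 2 + N%:C * (X1 +i* X2) + N%:C ^+ 2 = 0.
  rewrite -[RHS](mulr0 ((c -i* d) ^+ 2)) -Q.
  have -> : N%:C = (c -i* d) * (c +i* d) by apply: eqC; rewrite /N /=; ring.
  have -> : X1 +i* X2 = (c -i* d) * (a +i* b) by apply: eqC; rewrite /X1 /X2 /=; ring.
  by ring.
have Q1 : X1 ^+ 2 - X2 ^+ 2 + N * X1 + N ^+ 2 = 0.
  by move/(congr1 (@complex.Re R)): XE; rewrite !exprS !expr0 /=; lra.
have /eqP : X2 * (2 * X1 + N) = 0.
  by move/(congr1 (@complex.Im R)): XE; rewrite !exprS !expr0 /=; lra.
move=> X2E; exfalso; move: X2E; clear XE Q E zw zw0.
rewrite mulf_eq0 => /orP[/eqP X20|/eqP X1E].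
  have := sqr_ge0 (X1 + N / 2); have : 0 < N ^+ 2 by rewrite exprn_gt0.
  by move: Q1; rewrite X20; lra.
have {}X1E : X1 = - N / 2 by lra.
have NE : a ^+ 2 + b ^+ 2 = N.
  apply: (mulIf (lt0r_neq0 N0)).
  transitivity (X1 ^+ 2 + X2 ^+ 2); first by rewrite /X1 /X2 /N; ring.
  by rewrite X1E in Q1 *; lra.
have bd : - (b * d) < 3 * (a * c).
  have : `|b * d| < 3 * (a * c).
    rewrite -(@ltr_pXn2r _ 2)// ?nnegrE ?mulr_ge0 ?(ltW a0) ?(ltW c0)//.
    rewrite real_normK ?num_real// !exprMn.
    have := ltr_pM (sqr_ge0 b) (sqr_ge0 d) ab cd; lra.
  by rewrite ltr_norml => /andP[]; lra.
have := sqr_ge0 (a - c); have := sqr_ge0 (b + d).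
by move: X1E NE; rewrite /X1 /N; lra.
Qed.

(** For [|3 x| < pi] the numbers [sin (3 x)] and [sin x] have the same sign, and their quotient is
    [3 cos x ^ 2 - sin x ^ 2]. *)
Lemma sector3_cis x : - pi < 3 * x < pi -> sector3 (cis x).
Proof.
move=> /andP[x1 x2]; have pi0 := pi_gt0 R.
have c0 : 0 < cos x by apply: cos_gt0_pihalf; rewrite -?mulNr; lra.
split=> //=; rewrite -subr_gt0.
have s3 : sin (3 * x) = sin x * (3 * cos x ^+ 2 - sin x ^+ 2).
  rewrite (_ : 3 * x = x + (x + x)); last by ring.
  by rewrite sinD cosD sinD; ring.
have [x0|x0|x0] := ltgtP x 0.
- have : sin (3 * - x) > 0 by apply: sin_gt0_pi; rewrite ?mulrN; lra.
  have : sin (- x) > 0 by apply: sin_gt0_pi; lra.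
  by rewrite mulrN !sinN s3 -mulNr => sx; rewrite pmulr_rgt0.
- have : sin (3 * x) > 0 by apply: sin_gt0_pi; lra.
  have : sin x > 0 by apply: sin_gt0_pi; lra.
  by rewrite s3 => sx; rewrite pmulr_rgt0.
- by rewrite x0 cos0 sin0; lra.
Qed.

(** The half-angle formula: it gives the argument off the closed negative half-line by an expression
    that can be differentiated directly. *)
Lemma cis_2atan (X Y r : R) : 0 < r -> r ^+ 2 = X ^+ 2 + Y ^+ 2 -> 0 < r + X ->
  r%:C * cis (2 * atan (Y / (r + X))) = X +i* Y.
Proof.
move=> r0 rE rX; set t := Y / (r + X).
have t2 : 1 + t ^+ 2 = 2 * r / (r + X).
  rewrite /t exprMn -[Y ^+ 2](_ : r ^+ 2 - X ^+ 2 = _); last by rewrite rE addrC addKr.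
  by field; rewrite gt_eqF.
have c2 : cos (atan t) ^+ 2 = (r + X) / (2 * r).
  rewrite cos_atan exprVn sqr_sqrtr ?addr_ge0 ?sqr_ge0// t2 invf_div.
  by [].
have sE : sin (atan t) = t * cos (atan t).
  by rewrite -{2}(atanK t) /tan divfK// gt_eqF// cos_gt0_pihalf// atan_gtNpi2 atan_ltpi2.
rewrite /cis (_ : 2 * atan t = atan t + atan t); last by ring.
rewrite cosD sinD sE.
have -> : cos (atan t) * cos (atan t) - t * cos (atan t) * (t * cos (atan t)) =
  (1 - t ^+ 2) * cos (atan t) ^+ 2 by ring.
have -> : t * cos (atan t) * cos (atan t) + cos (atan t) * (t * cos (atan t)) =
  2 * t * cos (atan t) ^+ 2 by ring.
rewrite c2; apply: eqC => /=; rewrite !mul0r ?subr0 ?addr0.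
- rewrite (_ : 1 - t ^+ 2 = 2 - (1 + t ^+ 2)); last by ring.
  by rewrite t2; field; rewrite !gt_eqF.
- by rewrite /t; field; rewrite !gt_eqF.
Qed.

Lemma cder_ReIm (f : R -> R[i]) (s a b : R) :
  is_derive s 1 (fun y => complex.Re (f y)) a ->
  is_derive s 1 (fun y => complex.Im (f y)) b -> cder f s (a +i* b).
Proof. by []. Qed.

Lemma sqr_norm_gt0 (X Y : R) : X ^+ 2 + Y ^+ 2 != 0 -> 0 < X ^+ 2 + Y ^+ 2.
Proof. by move=> h; rewrite lt_neqAle eq_sym h addr_ge0 ?sqr_ge0. Qed.

(* The principal cube root along a straight path from 1, written with
   [arg (X + iY) = 2 atan (Y / (|X + iY| + X))]. *)
Lemma cube_root_line (k : R[i]) :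
  (forall s : R, 0 <= s <= 1 -> 1 + s%:C * k != 0) ->
  exists c : R -> R[i], forall s : R, 0 <= s <= 1 ->
    [/\ sector3 (c s), c s ^+ 3 = 1 + s%:C * k & exists d, cder c s d].
Proof.
case: k => k1 k2 H.
pose X (s : R) : R := 1 + s * k1; pose Y (s : R) : R := s * k2.
pose N (s : R) : R := X s ^+ 2 + Y s ^+ 2.
pose r (s : R) : R := expR (2^-1 * ln (N s)).
pose psi (s : R) : R := 2 / 3 * atan (Y s / (r s + X s)).
pose q (s : R) : R := expR (6^-1 * ln (N s)).
exists (fun s => (q s)%:C * cis (psi s)) => s s01.
have kE : 1 + s%:C * (k1 +i* k2) = X s +i* Y s.
  by apply: eqC; rewrite /X /Y /=; ring.
have N0 : 0 < N s.
  apply: sqr_norm_gt0; apply: contraNneq (H s s01) => Ns0.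
  have /andP[/eqP XX /eqP YY] : (X s == 0) && (Y s == 0).
    by rewrite -!(sqrf_eq0 (_ s)) -paddr_eq0 ?sqr_ge0//; apply/eqP.
  by rewrite kE XX YY.
have r0 : 0 < r s by exact: expR_gt0.
have rE : r s ^+ 2 = X s ^+ 2 + Y s ^+ 2.
  by rewrite /r -(expRM_natl 2) mulrA divff// mul1r lnK.
(* The quantity vanishes only on the closed negative half-line. A line issued from 1 that meets this
   half-line away from 0 is the real axis, so the segment would already have passed through 0. *)
have rX : 0 < r s + X s.
  have [X0|X0] := ltP 0 (X s); first by rewrite addr_gt0.
  have Y0 : Y s != 0.
    apply/eqP => Y0.
    have : X s < 0.
      rewrite lt_neqAle X0 andbT; apply: contraNneq (H s s01) => X00.
      by rewrite kE X00 Y0.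
    case/andP: s01 => s0 s1.
    have s_gt0 : 0 < s.
      rewrite lt_neqAle s0 andbT; apply/eqP => sE; move: X0.
      by rewrite /X -sE mul0r; lra.
    move=> Xn; have k1n : k1 < -1 by move: Xn; rewrite /X; nra.
    have k10 : k1 != 0 by rewrite lt_eqF//; lra.
    have k20 : k2 = 0.
      by move/eqP: Y0; rewrite /Y mulf_eq0 (gt_eqF s_gt0) => /eqP.
    have s'01 : 0 <= - k1^-1 <= 1.
      by apply/andP; split; rewrite -invrN ?invr_ge0 ?invf_le1; lra.
    have := H _ s'01; rewrite k20 => /negP; apply.
    apply/eqP/eqC => /=; last by ring.
    by field.
  have := sqr_ge0 (Y s); rewrite le_eqVlt eq_sym sqrf_eq0 (negbTE Y0) /= => Y2.
  have : (- X s) < r s.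
    by rewrite -(@ltr_pXn2r _ 2)// ?nnegrE ?oppr_ge0 ?(ltW r0)// sqrrN rE ltrDl.
  lra.
have a1 := atan_gtNpi2 (Y s / (r s + X s)).
have a2 := atan_ltpi2 (Y s / (r s + X s)).
have q0 : 0 < q s by exact: expR_gt0.
split.
- have [c0 c1] : sector3 (cis (psi s)).
    by apply: sector3_cis; rewrite /psi; lra.
  split; first by rewrite ReMl mulr_gt0.
  rewrite ReMl ImMl !exprMn [ltRHS]mulrCA ltr_pM2l ?exprn_gt0//.
- rewrite kE -(cis_2atan r0 rE rX) exprMn; congr (_ * _).
    rewrite -rmorphXn /= /q -(expRM_natl 3) /r; congr (expR _)%:C.
    by field.
  rewrite !exprS expr0 mulr1 -!cisD; congr cis.
  by rewrite /psi; field.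
have dY : is_derive s (1 : R) Y k2.
  apply: is_derive_eq (is_deriveM (is_derive_id s 1) (is_derive_cst k2 s 1)) _.
  by rewrite /GRing.scale /= mulr1 mulr0 add0r.
have dX : is_derive s (1 : R) X k1.
  have d1 : is_derive s (1 : R) (cst (1 : R) : R -> R) 0 by exact: is_derive_cst.
  have := is_deriveD d1 (is_deriveM (is_derive_id s (1 : R)) (is_derive_cst k1 s 1)).
  by rewrite /GRing.scale /= mulr1 mulr0 !add0r.
have dN := is_deriveD (is_deriveX 2 dX) (is_deriveX 2 dY).
have dln : is_derive s (1 : R) (fun s => ln (N s)) _ :=
  is_derive1_comp (is_derive1_ln N0) dN.
have dq : is_derive s (1 : R) q _ :=
  is_derive1_comp (is_derive_expR _) (is_deriveZ 6^-1 dln).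
have dr : is_derive s (1 : R) r _ :=
  is_derive1_comp (is_derive_expR _) (is_deriveZ 2^-1 dln).
have drX : is_derive s (1 : R) (fun s => r s + X s) _ := is_deriveD dr dX.
have dV : is_derive s (1 : R) (fun s => (r s + X s)^-1) _ :=
  @is_deriveV _ (fun s => r s + X s) s _ 1 (lt0r_neq0 rX) drX.
have dYV : is_derive s (1 : R) (fun s => Y s / (r s + X s)) _ := is_deriveM dY dV.
have dat : is_derive s (1 : R) (fun s => atan (Y s / (r s + X s))) _ :=
  is_derive1_comp (is_derive1_atan _) dYV.
have dpsi : is_derive s (1 : R) psi _ := is_deriveZ (2 / 3) dat.
have dcos : is_derive s (1 : R) (fun s => cos (psi s)) _ :=
  is_derive1_comp (is_derive_cos _) dpsi.
have dsin : is_derive s (1 : R) (fun s => sin (psi s)) _ :=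
  is_derive1_comp (is_derive_sin _) dpsi.
eexists; exact: cderM (cder_ReIm (f := fun s => (q s)%:C) dq (is_derive_cst _ _ _))
  (cder_ReIm (f := fun s => cis (psi s)) dcos dsin).
Qed.

End CubeRoot.

(** * Propagation along paths and across break points *)

Section WKBPath.
Context {R : realType}.
Implicit Types (m r y z w : R[i]) (h : R).

(* With [z = h y'], the function [ugrow] (resp. [vdecay]) vanishes on the
   second order WKB solution growing (resp. decaying) like
   [exp (+- int r / h)], where [r ^+ 2] is the linear potential of slope [m]. *)
Definition ugrow h m r y z : R[i] := z - (r - h%:C * m / (4 * r ^+ 2)) * y.
Definition vdecay h m r y z : R[i] := z + (r + h%:C * m / (4 * r ^+ 2)) * y.

(** The integral of [r dt]: from [r ^ 2 = m t + c] follows [dt = 2 r dr / m]. *)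
Definition action m r : R[i] := 2 / 3 * r ^+ 3 / m.

(* The end points of [0, 1] are allowed: one-sided agreement determines the
   derivative. *)
Lemma cder_unique01 (f g : R -> R[i]) (s : R) (d d' : R[i]) : 0 <= s <= 1 ->
  (forall t : R, 0 <= t <= 1 -> f t = g t) -> cder f s d -> cder g s d' -> d = d'.
Proof.
move=> /andP[s0 s1] fg df dg; apply/eqP; rewrite -subr_eq0 -cmod_eq0 eq_le cmod_ge0 andbT.
apply/ler_addgt0Pr => e e0; rewrite add0r.
have /cder_epsP/(_ e e0)[del del0 H] := cderB df dg.
pose a := Num.min (del / 2) (1 / 2).
have a0 : 0 < a by rewrite lt_min !divr_gt0.
have ad : a < del by rewrite gt_min; apply/orP; left; lra.
have a12 : a <= 1 / 2 by rewrite ge_min lexx orbT.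
have [t t01 tsE] : exists2 t : R, 0 <= t <= 1 & `|t - s| = a.
  have [s12|s12] := leP s (1 / 2).
    by exists (s + a); [apply/andP; split; lra|rewrite addrAC subrr add0r gtr0_norm].
  by exists (s - a); [apply/andP; split; lra|
    rewrite addrAC subrr add0r normrN gtr0_norm].
have := H t; rewrite tsE => /(_ ad).
rewrite !fg ?s0// !subrr sub0r cmodN cmodM cmod_real tsE mulrC.
by rewrite ler_pM2r.
Qed.

(** The sector condition guarantees that the continuous cube root starting at [ra] ends at [rb], and
    not at [rb] times a cube root of unity. *)
Lemma cube_root_path (ra rb : R[i]) : ra != 0 -> sector3 (rb / ra) ->
  (forall s : R, 0 <= s <= 1 -> ra ^+ 3 + s%:C * (rb ^+ 3 - ra ^+ 3) != 0) ->
  exists r : R -> R[i], [/\ r 0 = ra, r 1 = rb & forall s : R, 0 <= s <= 1 ->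
    [/\ r s != 0, r s ^+ 3 = ra ^+ 3 + s%:C * (rb ^+ 3 - ra ^+ 3) &
      cder r s ((rb ^+ 3 - ra ^+ 3) / (3 * r s ^+ 2))]].
Proof.
move=> ra0 rab H; pose k := (rb / ra) ^+ 3 - 1.
have kE (s : R) : ra ^+ 3 * (1 + s%:C * k) = ra ^+ 3 + s%:C * (rb ^+ 3 - ra ^+ 3).
  by rewrite /k; field.
have [s s01|c Hc] := @cube_root_line R k.
  by apply: contra_neq (H s s01) => E; rewrite -kE E mulr0.
exists (fun s => ra * c s).
have r3 (s : R) : 0 <= s <= 1 ->
    (ra * c s) ^+ 3 = ra ^+ 3 + s%:C * (rb ^+ 3 - ra ^+ 3).
  by move=> /Hc[_ cE _]; rewrite exprMn cE kE.
split.
- have [c3 cE _] := Hc 0 (introT andP (conj (lexx 0) ler01)).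
  rewrite (_ : c 0 = 1) ?mulr1//; apply: sector3_cube_inj => //.
    by split => /=; [exact: ltr01|rewrite expr0n expr1n /= mulr1].
  by rewrite cE mul0r addr0 expr1n.
- have [c3 cE _] := Hc 1 (introT andP (conj ler01 (lexx 1))).
  rewrite (_ : c 1 = rb / ra); last first.
    by apply: sector3_cube_inj => //; rewrite cE /k mul1r addrC subrK.
  by field.
- move=> s s01; have [c3 cE [d dc]] := Hc s s01.
  have cs0 := sector3_neq0 c3.
  have rs0 : ra * c s != 0 by rewrite mulf_neq0.
  split; [by []|exact: r3|].
  have d2 : cder (fun s => 1 + s%:C * k) s (0 + (1 * k + s%:C * 0)).
    apply: cderD; first exact: cder_cst.
    exact: cderM (cder_id s) (cder_cst k s).
  (* The existence of the derivative is known; its value comes from differentiating the cube, which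
     is affine only for [0 <= s <= 1]. *)
  have E := cder_unique01 s01 (fun t t01 => let: And3 _ cE _ := Hc t t01 in cE)
    (cderX 2 dc) d2.
  apply: cder_eq (cderZ ra dc) _.
  apply: (mulIf (_ : 3 * (ra * c s) ^+ 2 != 0)).
    by rewrite mulf_neq0 ?expf_neq0// pnatr_eq0.
  rewrite divfK ?mulf_neq0 ?expf_neq0// ?pnatr_eq0//.
  transitivity (ra ^+ 3 * (3 * c s ^+ 2 * d)); first by ring.
  by rewrite E /k; field.
Qed.

(** The point [t = (r ^ 2 - c) / m] runs through a complex curve on which the action is affine. In
    the coordinates [ugrow] and [vdecay] the Airy equation is then exactly the system of
    [wkb_segment]; [5 / 72] is the first correction coefficient in the classical asymptotic
    expansion of the Airy function. *)
Lemma segment_step (kap M del C : R) : 0 < kap -> 0 < M -> 0 < del -> 0 < C ->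
  exists h1 C' : R, [/\ 0 < h1, 0 < C' &
  forall (h : R) (m c ra rb : R[i]) (Y Y1 : R[i] -> R[i]), 0 < h < h1 ->
    m != 0 -> ra != 0 -> sector3 (rb / ra) ->
    let D := action m rb - action m ra in
    kap <= complex.Re D -> cmod D <= M ->
    (forall s : R, 0 <= s <= 1 -> del <= cmod (action m ra + s%:C * D)) ->
    (forall t, cdiff Y t (Y1 t)) ->
    (forall t, cdiff Y1 t ((m * t + c) / h%:C ^+ 2 * Y t)) ->
    let ta := (ra ^+ 2 - c) / m in let tb := (rb ^+ 2 - c) / m in
    let ua := ugrow h m ra (Y ta) (h%:C * Y1 ta) in
    let va := vdecay h m ra (Y ta) (h%:C * Y1 ta) in
    let ub := ugrow h m rb (Y tb) (h%:C * Y1 tb) in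
    let vb := vdecay h m rb (Y tb) (h%:C * Y1 tb) in
    va != 0 -> cmod ua <= C / h * cmod va ->
    vb != 0 /\ cmod ub <= C' * h ^+ 2 * cmod vb].
Proof.
move=> kap0 M0 del0 C0.
have [h1 [C' [h10 C'0 H]]] := wkb_segment kap0 M0 del0 C0.
exists h1, C'; split=> // h m c ra rb Y Y1 h01 m0 ra0 rab D DR DM SD dY dY1
  ta tb ua va ub vb va0 uva.
have h0 : h%:C != 0 by rewrite fmorph_eq0; case/andP: h01 => /gt_eqF->.
have DE : rb ^+ 3 - ra ^+ 3 = 3 / 2 * m * D by rewrite /D /action; field.
have [s s01|r [r0 r1 Hr]] := cube_root_path ra0 rab.
  have := SD s s01; have -> : action m ra + s%:C * D =
    2 / 3 / m * (ra ^+ 3 + s%:C * (rb ^+ 3 - ra ^+ 3)).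
    by rewrite /D /action; field.
  by move=> h2; apply/eqP => E; move: h2; rewrite E mulr0 cmod0 leNgt del0.
pose t s := (r s ^+ 2 - c) / m.
pose y s := Y (t s); pose z s := h%:C * Y1 (t s).
pose u s := ugrow h m (r s) (y s) (z s); pose v s := vdecay h m (r s) (y s) (z s).
have [u0E v0E] : u 0 = ua /\ v 0 = va by rewrite /u /v /y /z /t r0.
have [u1E v1E] : u 1 = ub /\ v 1 = vb by rewrite /u /v /y /z /t r1.
have SE s : 0 <= s <= 1 -> action m ra + s%:C * D = action m (r s).
  by move=> /Hr[_ r3 _]; rewrite /action r3 DE /D /action; field.
have Hd s : 0 <= s <= 1 -> [/\ cder r s (m * D / (2 * r s ^+ 2)),
    cder y s (D / (h%:C * r s) * z s), cder z s (D * r s / h%:C * y s) &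
    cder (fun s => h%:C * m / (4 * r s ^+ 2)) s
      (- h%:C * m * (m * D) / (4 * r s ^+ 5))].
  move=> s01; have [rs0 r3 dr] := Hr s s01.
  have {}dr : cder r s (m * D / (2 * r s ^+ 2)).
    by apply: cder_eq dr _; rewrite DE; field.
  have dt : cder t s (D / r s).
    apply: cder_eq (cderM (cderB (cderX 1 dr) (cder_cst c s)) (cder_cst m^-1 s)) _.
    by field; rewrite m0 rs0.
  have tE : m * t s + c = r s ^+ 2 by rewrite /t; field.
  split=> //.
  - apply: cder_eq (cder_comp (dY _) dt) _.
    by rewrite /z; field; rewrite rs0 h0.
  - apply: cder_eq (cderZ h%:C (cder_comp (dY1 _) dt)) _.
    by rewrite tE /y; field; rewrite rs0 h0.
  - have r40 : 4 * r s ^+ 2 != 0 by rewrite mulf_neq0 ?expf_neq0// pnatr_eq0.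
    apply: cder_eq (cderZ (h%:C * m) (cderV r40 (cderZ 4 (cderX 1 dr)))) _.
    by field.
rewrite -u1E -v1E; apply: (H h u v (action m ra) D) => //; last first.
- by rewrite u0E v0E.
- by rewrite v0E.
- move=> s s01; have [rs0 _ _] := Hr s s01; have [dr dy dz dp] := Hd s s01.
  rewrite SE//; apply: cder_eq (cderD dz (cderM (cderD dr dp) dy)) _.
  by rewrite /v /u /vdecay /ugrow /action; field; rewrite m0 rs0 h0.
- move=> s s01; have [rs0 _ _] := Hr s s01; have [dr dy dz dp] := Hd s s01.
  rewrite SE//; apply: cder_eq (cderB dz (cderM (cderB dr dp) dy)) _.
  by rewrite /v /u /vdecay /ugrow /action; field; rewrite m0 rs0 h0.
Qed.

End WKBPath.

(** * Admissible paths and their stability under perturbation of the end points *)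

Section GoodPaths.
Context {R : realType}.
Implicit Types (m r y z w : R[i]) (h : R).

(** The sector condition does two things: it keeps the straight segment from [ra ^ 3] to [rb ^ 3]
    away from 0, and it makes [rb] the continuation of [ra] along it. *)
Definition good_segment m ra rb : Prop :=
  [/\ ra != 0, sector3 (rb / ra) & 0 < complex.Re (action m rb - action m ra)].

Definition good_path m ra rb : Prop := good_segment m ra rb \/
  exists2 rm, good_segment m ra rm & good_segment m rm rb.

(** Replaces the quotient by a product, whose variation with both arguments is easier to bound. *)
Lemma sector3_conjE z w : w != 0 -> sector3 (z / w) <-> sector3 (z * w^*).
Proof.
move=> w0; have N0 : 0 < cmod w ^+ 2 by rewrite exprn_gt0// cmod_gt0.
have -> : z / w = ((cmod w ^+ 2)^-1)%:C * (z * w^*).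
  have ww : w * w^* = (cmod w ^+ 2)%:C.
    by rewrite sqr_cmod; apply: eqC; case: (w) => a b /=; ring.
  apply: (mulIf w0); rewrite divfK// -mulrA -[z * _ * w]mulrA [w^* * w]mulrC ww mulrCA.
  by rewrite -rmorphM /= mulVf ?gt_eqF// mulr1.
rewrite /sector3 ReMl ImMl !exprMn.
have V0 : 0 < (cmod w ^+ 2)^-1 by rewrite invr_gt0.
by rewrite pmulr_rgt0// (mulrCA 3) ltr_pM2l// exprn_gt0.
Qed.

Lemma sector3_near z : sector3 z -> exists2 e : R, 0 < e &
  forall w, cmod (w - z) < e -> sector3 w.
Proof.
case: z => a b [/= a0 ab]; pose g := 3 * a ^+ 2 - b ^+ 2.
have g0 : 0 < g by rewrite subr_gt0.
pose k := 6 * a + 2 * `|b| + 1.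
have k0 : 0 < k.
  by rewrite /k; have := normr_ge0 b; lra.
exists (Num.min (Num.min a 1) (g / k)).
  by rewrite !lt_min a0 ltr01 divr_gt0.
case=> c d; rewrite !lt_min -andbA => /and3P[h1 h2 h3].
have /= := normr_Re_le ((c +i* d) - (a +i* b)).
have /= := normr_Im_le ((c +i* d) - (a +i* b)).
set e := cmod _ in h1 h2 h3 *; move=> I1 R1.
have e0 : 0 <= e by exact: cmod_ge0.
move: R1; rewrite ler_norml => /andP[R1 R2].
have I2 : `|d| <= `|b| + e.
  by rewrite -(subrK b d) addrC (le_trans (ler_normD _ _))// lerD2l.
split => /=; first by lra.
rewrite -(real_normK (num_real d)).
have : `|d| ^+ 2 <= (`|b| + e) ^+ 2.
  by rewrite lerXn2r ?nnegrE ?addr_ge0.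
move/le_lt_trans; apply.
have : (a - e) ^+ 2 <= c ^+ 2 by rewrite lerXn2r ?nnegrE; lra.
move: h3; rewrite ltr_pdivlMr// /k /g -(real_normK (num_real b)) => h3.
move: h1 h2 h3 a0 e0 (normr_ge0 b); move: `|b| => x; clear; nra.
Qed.

Lemma action_lip m r : exists2 K : R, 0 < K &
  forall r', cmod (r' - r) <= 1 -> cmod (action m r' - action m r) <= K * cmod (r' - r).
Proof.
pose q := cmod r + 1; have q0 : 0 < q by rewrite ltr_pwDr// cmod_ge0.
exists (2 * cmod m^-1 * q ^+ 2 + 1).
  by rewrite ltr_pwDr// !mulr_ge0 ?cmod_ge0 ?exprn_ge0// ltW.
move=> r' r1.
rewrite (_ : _ - _ = 2 / 3 * m^-1 * (r' ^+ 2 + r' * r + r ^+ 2) * (r' - r)); last first.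
  by rewrite /action; ring.
rewrite cmodM ler_wpM2r ?cmod_ge0//.
have r'q : cmod r' <= q.
  by rewrite -(subrK r r') (le_trans (le_cmodD _ _))// addrC lerD2l.
have rq : cmod r <= q by rewrite lerDl.
have : cmod (r' ^+ 2 + r' * r + r ^+ 2) <= 3 * q ^+ 2.
  apply: le_trans (le_cmodD _ _) _; rewrite cmodX.
  have := le_cmodD (r' ^+ 2) (r' * r); rewrite cmodM cmodX.
  have : cmod r' ^+ 2 <= q ^+ 2 by rewrite lerXn2r ?nnegrE ?cmod_ge0// ltW.
  have : cmod r ^+ 2 <= q ^+ 2 by rewrite lerXn2r ?nnegrE ?cmod_ge0// ltW.
  have : cmod r' * cmod r <= q * q by rewrite ler_pM ?cmod_ge0.
  lra.
have c23 : cmod (2 / 3 * m^-1 : R[i]) = 2 / 3 * cmod m^-1.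
  by rewrite !cmodM [cmod 3^-1]cmodV !cmod_nat.
rewrite cmodM c23 => H.
have c0 : 0 <= 2 / 3 * cmod m^-1 by rewrite mulr_ge0 ?cmod_ge0.
have := ler_wpM2l c0 H; lra.
Qed.

(** The argument of [w ^ 3] stays strictly between [- pi] and [pi], so the segment from 1 to [w ^ 3]
    misses 0. *)
Lemma sector3_line_neq0 w : sector3 w -> forall s : R, 0 <= s <= 1 ->
  1 + s%:C * (w ^+ 3 - 1) != 0.
Proof.
case: w => a b [/= a0 ab] s /andP[s0 s1]; apply/negP => /eqP E.
have E1 := congr1 (@complex.Re R) E; have E2 := congr1 (@complex.Im R) E.
rewrite !exprS expr0 /= in E1 E2; clear E.
have {}E1 : 1 - s + s * (a ^+ 3 - 3 * a * b ^+ 2) = 0 by lra.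
have {E2}/eqP : s * (b * (3 * a ^+ 2 - b ^+ 2)) = 0 by lra.
rewrite !mulf_eq0 => /orP[/eqP s00|/orP[/eqP b0|/eqP]]; [|subst b|]; last by lra.
- by rewrite s00 in E1; lra.
- have : 0 < a ^+ 3 by rewrite exprn_gt0.
  move=> a3; have sa : 0 <= s * a ^+ 3 by rewrite mulr_ge0// ltW.
  have s1E : s = 1 by move: E1; rewrite expr0n /=; lra.
  by move: E1; rewrite s1E expr0n /=; lra.
Qed.

Lemma cmod_line_min (S0 D : R[i]) :
  (forall s : R, 0 <= s <= 1 -> S0 + s%:C * D != 0) ->
  exists2 del : R, 0 < del &
    forall s : R, 0 <= s <= 1 -> del <= cmod (S0 + s%:C * D).
Proof.
move=> H; pose f (s : R) : R := cmod (S0 + s%:C * D) ^+ 2.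
have df (s : R) : is_derive s (1 : R) f _ := is_derive_sqr_cmod
  (cderD (cder_cst S0 s) (cderM (cder_id s) (cder_cst D s))).
have [|c] := @EVT_min R f 0 1 ler01.
  by apply: continuous_subspaceT => s; exact: is_derive_real_continuous (df s).
rewrite in_itv /= => c01 Hc; exists (cmod (S0 + c%:C * D)); first by rewrite cmod_gt0 H.
move=> s s01; rewrite -(@ler_pXn2r _ 2) ?nnegrE ?cmod_ge0//.
by apply: Hc; rewrite in_itv.
Qed.

(** Every condition is open, and the distance of the action segment to 0 is positive by compactness.
    The constants for [segment_step] can therefore be fixed once for all nearby end points, that is,
    for all spectral parameters near a given one. *)
Lemma good_segment_near m ra rb : m != 0 -> good_segment m ra rb ->
  exists eta kap M del : R, [/\ 0 < eta, 0 < kap, 0 < M, 0 < del &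
    forall ra' rb', cmod (ra' - ra) < eta -> cmod (rb' - rb) < eta ->
      let D' := action m rb' - action m ra' in
      [/\ ra' != 0, sector3 (rb' / ra'), kap <= complex.Re D', cmod D' <= M &
        forall s : R, 0 <= s <= 1 -> del <= cmod (action m ra' + s%:C * D')]].
Proof.
move=> m0 [ra0 rab Dab]; set D := action m rb - action m ra in Dab.
have [s s01|del0 del00 Hdel] := @cmod_line_min (action m ra) D.
  have -> : action m ra + s%:C * D =
      action m ra * (1 + s%:C * ((rb / ra) ^+ 3 - 1)).
    by rewrite /D /action; field; rewrite ra0 m0.
  rewrite mulf_neq0 ?sector3_line_neq0// /action !mulf_neq0 ?invr_eq0 ?expf_neq0 ?pnatr_eq0//.
have [Ka Ka0 HKa] := action_lip m ra; have [Kb Kb0 HKb] := action_lip m rb.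
have [es es0 Hes] := sector3_near ((sector3_conjE rb ra0).1 rab).
pose K := Ka + Kb; pose q := cmod ra + cmod rb + 1.
have K0 : 0 < K by rewrite addr_gt0.
have q0 : 0 < q by rewrite ltr_pwDr// addr_ge0 ?cmod_ge0.
pose eta := Num.min (Num.min 1 (cmod ra / 2)) (Num.min (es / (2 * q))
   (Num.min (complex.Re D / (2 * K)) (del0 / (2 * K)))).
have eta0 : 0 < eta.
  by rewrite !lt_min ltr01 !divr_gt0 ?mulr_gt0// cmod_gt0.
exists eta, (complex.Re D / 2), (cmod D + K), (del0 / 2); split=> //.
- by rewrite divr_gt0.
- by rewrite ltr_wpDl ?cmod_ge0.
- by rewrite divr_gt0.
move=> ra' rb' ha hb D'.
move: (ha) (hb); rewrite !lt_min => /andP[/andP[a1 a2] /and3P[a3 a4 a5]].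
move=> /andP[/andP[b1 b2] /and3P[b3 b4 b5]].
have hKa : cmod (action m ra' - action m ra) <= Ka * cmod (ra' - ra).
  by apply: HKa; rewrite ltW.
have hKb : cmod (action m rb' - action m rb) <= Kb * cmod (rb' - rb).
  by apply: HKb; rewrite ltW.
have DD : cmod (D' - D) <= cmod (action m ra' - action m ra) +
    cmod (action m rb' - action m rb).
  rewrite (_ : D' - D = (action m rb' - action m rb) - (action m ra' - action m ra)).
    by rewrite [leRHS]addrC le_cmodB.
  by rewrite /D' /D; ring.
have ra'0 : ra' != 0.
  rewrite -cmod_gt0; have := cmod_le_sub ra (ra - ra').
  rewrite (_ : ra - (ra - ra') = ra'); last by ring.
  by rewrite (cmodB ra); have := cmod_gt0 ra; rewrite ra0; lra.
have Kle (t : R) : 0 <= t -> Ka * t <= K * t /\ Kb * t <= K * t.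
  by move=> t0; rewrite !ler_wpM2r ?lerDl ?lerDr// ltW.
have sumK (x : R) : cmod (ra' - ra) < x / (2 * K) -> cmod (rb' - rb) < x / (2 * K) ->
    cmod (action m ra' - action m ra) + cmod (action m rb' - action m rb) <= x / 2.
  rewrite !ltr_pdivlMr ?mulr_gt0// => xa xb.
  have hA : Ka * cmod (ra' - ra) <= Ka * (x / (2 * K)).
    by rewrite ler_wpM2l ?(ltW Ka0)// ler_pdivlMr ?mulr_gt0// ltW.
  have hB : Kb * cmod (rb' - rb) <= Kb * (x / (2 * K)).
    by rewrite ler_wpM2l ?(ltW Kb0)// ler_pdivlMr ?mulr_gt0// ltW.
  have : Ka * (x / (2 * K)) + Kb * (x / (2 * K)) = x / 2.
    by rewrite -mulrDl -/K; field; rewrite gt_eqF.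
  lra.
split=> //.
- apply/(sector3_conjE _ ra'0); apply: Hes.
  rewrite (_ : _ - _ = (rb' - rb) * ra'^* + rb * (ra' - ra)^*); last first.
    by rewrite rmorphB; ring.
  have cj w : cmod w^* = cmod w by rewrite /cmod normcJ.
  rewrite (le_lt_trans (le_cmodD _ _))// !cmodM !cj.
  have ra'q : cmod ra' <= cmod ra + 1.
    by rewrite -(subrK ra ra') (le_trans (le_cmodD _ _))// addrC lerD2l ltW.
  have h1 : cmod (rb' - rb) * cmod ra' <= es / (2 * q) * (cmod ra + 1).
    by rewrite ler_pM ?cmod_ge0// ltW.
  have h2 : cmod rb * cmod (ra' - ra) <= cmod rb * (es / (2 * q)).
    by rewrite ler_wpM2l ?cmod_ge0// ltW.
  have : es / (2 * q) * q = es / 2 by field; rewrite gt_eqF.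
  by rewrite {2}/q; lra.
- have := normr_Re_le (D' - D); rewrite ReD ReN ler_norml => /andP[+ _].
  by have := sumK _ a4 b4; lra.
- rewrite -(subrK D D') (le_trans (le_cmodD _ _))// addrC lerD2l (le_trans DD)//.
  have h1 : Ka * cmod (ra' - ra) <= Ka * 1 by rewrite ler_wpM2l ?(ltW Ka0) ?(ltW a1).
  have h2 : Kb * cmod (rb' - rb) <= Kb * 1 by rewrite ler_wpM2l ?(ltW Kb0) ?(ltW b1).
  by rewrite /K; lra.
- move=> s s01; have := Hdel s s01; case/andP: s01 => s0 s1.
  have := sumK _ a5 b5.
  have := cmod_le_sub (action m ra + s%:C * D) (action m ra + s%:C * D - (action m ra' + s%:C * D')).
  rewrite subKr (_ : _ - (_ + _) = (1 - s)%:C * - (action m ra' - action m ra) +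
     s%:C * - (action m rb' - action m rb)); last first.
    by rewrite /D /D' rmorphB rmorph1; ring.
  have := le_cmodD ((1 - s)%:C * - (action m ra' - action m ra))
     (s%:C * - (action m rb' - action m rb)).
  rewrite !cmodM !cmodN !cmod_real !ger0_norm ?subr_ge0//.
  have : (1 - s) * cmod (action m ra' - action m ra) <= 1 * cmod (action m ra' - action m ra).
    by rewrite ler_wpM2r ?cmod_ge0// lerBlDr lerDl.
  have : s * cmod (action m rb' - action m rb) <= 1 * cmod (action m rb' - action m rb).
    by rewrite ler_wpM2r ?cmod_ge0.
  lra.
Qed.

End GoodPaths.

(** * Transfer through a break point and along a whole piece *)

Section Chain.
Context {R : realType}.
Implicit Types (r s y z w : R[i]) (h : R).

(** One of the two roots of [w] satisfies [|r + r0| >= |r0|], and then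
    [(r - r0) (r + r0) = w - r0 ^ 2] bounds its distance to [r0]. *)
Lemma sqrt_near (r0 : R[i]) (e : R) : r0 != 0 -> 0 < e ->
  exists2 del : R, 0 < del & forall w, cmod (w - r0 ^+ 2) < del ->
    exists2 r, r ^+ 2 = w & cmod (r - r0) < e.
Proof.
move=> r00 e0; have r0p : 0 < cmod r0 by rewrite cmod_gt0.
exists (e * cmod r0); first by rewrite mulr_gt0.
move=> w hw; pose q := sqrtc w.
have qE : (q - r0) * (q + r0) = w - r0 ^+ 2.
  by rewrite -(sqr_sqrtc w) -/q; ring.
have h r : cmod r0 <= cmod (r + r0) -> (r - r0) * (r + r0) = w - r0 ^+ 2 ->
    cmod (r - r0) < e.
  move=> h1 h2; rewrite -(ltr_pM2r r0p); apply: le_lt_trans hw.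
  by rewrite -h2 cmodM ler_wpM2l ?cmod_ge0.
have [h1|h1] := leP (cmod r0) (cmod (q + r0)).
  by exists q; [exact: sqr_sqrtc|exact: h].
exists (- q); first by rewrite sqrrN; exact: sqr_sqrtc.
apply: h; last by rewrite -qE; ring.
have := cmod_le_sub (r0 + r0) (q + r0).
rewrite (_ : r0 + r0 - (q + r0) = - q + r0); last by ring.
have -> : cmod (r0 + r0) = 2 * cmod r0.
  by rewrite (_ : r0 + r0 = 2%:R * r0) ?cmodM ?cmod_nat//; ring.
by lra.
Qed.

(** The values [y] and [z] are continuous across the break; only the coordinates change, from slope
    [m] and root [r] to slope [m'] and root [s]. *)
Lemma break_step (rho c0 C0 : R) : 0 < rho -> 0 < c0 -> 0 < C0 ->
  exists h1 C : R, [/\ 0 < h1, 0 < C & forall h (m m' r s y z : R[i]),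
    0 < h < h1 -> r != 0 -> s != 0 ->
    cmod r <= rho -> cmod s <= rho -> cmod r^-1 <= rho -> cmod s^-1 <= rho ->
    cmod m <= rho -> cmod m' <= rho ->
    c0 * h <= cmod (r + s + h%:C * (m' / s ^+ 2 - m / r ^+ 2) / 4) ->
    vdecay h m r y z != 0 ->
    cmod (ugrow h m r y z) <= C0 * h ^+ 2 * cmod (vdecay h m r y z) ->
    vdecay h m' s y z != 0 /\
    cmod (ugrow h m' s y z) <= C / h * cmod (vdecay h m' s y z)].
Proof.
move=> rho0 c00 C00.
(* [P] bounds the coefficients [r +- h m / (4 r ^ 2)] when [h <= 1] *)
pose P := rho + rho ^+ 3.
have P0 : 0 < P by rewrite addr_gt0// exprn_gt0.
have a0 : 0 < (1 + C0) * rho * P by rewrite mulr_gt0// mulr_gt0// addr_gt0.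
pose B := (1 + C0) * rho * P + 1 + (1 + C0) * rho * P.
have B0 : 0 < B.
  by rewrite /B; lra.
pose h1 := Num.min 1 (c0 / (4 * P * C0)).
exists h1, (4 * rho * B / c0); split.
- by rewrite lt_min ltr01 divr_gt0 ?mulr_gt0.
- by rewrite divr_gt0 ?mulr_gt0.
move=> h m m' r s y z; rewrite lt_min => /andP[h0 /andP[hl1 hl2]] r0 s0.
move=> rr sr ri si mr m'r ck v0 uv.
pose p r m := h%:C * m / (4 * r ^+ 2).
have pP (q n : R[i]) : cmod q <= rho -> cmod q^-1 <= rho -> cmod n <= rho ->
    cmod q + cmod (p q n) <= P.
  move=> qr qi nr; rewrite /P lerD// /p !cmodM cmod_real gtr0_norm//.
  rewrite cmodV cmodM cmod_nat cmodX invfM -exprVn -cmodV.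
  have : cmod n * cmod q^-1 ^+ 2 <= rho * rho ^+ 2.
    by rewrite ler_pM ?cmod_ge0 ?sqr_ge0// lerXn2r ?nnegrE ?cmod_ge0// ltW.
  have n0 : 0 <= cmod n * cmod q^-1 ^+ 2 by rewrite mulr_ge0 ?sqr_ge0 ?cmod_ge0.
  have : h * (cmod n * cmod q^-1 ^+ 2) <= 1 * (cmod n * cmod q^-1 ^+ 2).
    by rewrite ler_wpM2r// ltW.
  by rewrite [rho ^+ 3]exprS; lra.
set u := ugrow h m r y z in uv *; set v := vdecay h m r y z in v0 uv *.
have yE : y = (v - u) / (2 * r) by rewrite /v /u /vdecay /ugrow; field.
have zE : z = v - (r + p r m) * y by rewrite /v /vdecay /p; ring.
have V0 : 0 < cmod v by rewrite cmod_gt0.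
have uv' : cmod u <= C0 * h * cmod v.
  apply: (le_trans uv); rewrite ler_wpM2r ?cmod_ge0// ler_wpM2l ?(ltW C00)//.
  by rewrite expr2 -[leRHS]mul1r ler_wpM2r ?(ltW h0)// ltW.
have uv1 : cmod u <= C0 * cmod v.
  apply: (le_trans uv'); rewrite -mulrA ler_wpM2l ?(ltW C00)//.
  by rewrite -[leRHS]mul1r ler_wpM2r ?cmod_ge0// ltW.
have yB : cmod y <= (1 + C0) * rho / 2 * cmod v.
  rewrite yE invfM !cmodM [cmod 2^-1]cmodV cmod_nat.
  have h3 : cmod (v - u) <= (1 + C0) * cmod v.
    by rewrite (le_trans (le_cmodB _ _))// mulrDl mul1r lerD2l.
  have : cmod (v - u) * cmod r^-1 <= (1 + C0) * cmod v * rho.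
    by rewrite ler_pM ?cmod_ge0.
  by lra.
have Pm := pP r m rr ri mr; have Pm' := pP s m' sr si m'r.
have coefB (q n : R[i]) : cmod q + cmod (p q n) <= P ->
    cmod ((q + p q n) * y) <= P * ((1 + C0) * rho / 2 * cmod v) /\
    cmod ((q - p q n) * y) <= P * ((1 + C0) * rho / 2 * cmod v).
  move=> h3; rewrite !cmodM; split; rewrite ler_pM ?cmod_ge0//.
    by rewrite (le_trans (le_cmodD _ _)).
  by rewrite (le_trans (le_cmodB _ _)).
have [c1 _] := coefB r m Pm; have [c2 c3] := coefB s m' Pm'.
have uB : cmod (ugrow h m' s y z) <= B * cmod v.
  rewrite /ugrow -/(p s m').
  apply: le_trans (le_cmodB _ _) _; rewrite {1}zE.
  have := le_cmodB v ((r + p r m) * y).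
  have : 0 <= (1 + C0) * rho * P * cmod v.
    by rewrite mulr_ge0 ?cmod_ge0// ltW.
  by rewrite /B; lra.
(* The change of coordinates. The first coefficient is at least [c0 h] in modulus, while [u]
   contributes only [O(h ^ 2)], so for small [h] the first term dominates. *)
have vE : 2 * r * vdecay h m' s y z =
   (r + s + h%:C * (m' / s ^+ 2 - m / r ^+ 2) / 4) * v -
   ((s + p s m') - (r + p r m)) * u.
  rewrite /vdecay zE yE /p; field.
  by rewrite r0 s0.
have vB : c0 * h / (4 * rho) * cmod v <= cmod (vdecay h m' s y z).
  rewrite -(ler_pM2l (_ : 0 < 2 * rho)) ?mulr_gt0//.
  apply: le_trans (_ : cmod (2 * r) * cmod (vdecay h m' s y z) <= _); last first.
    by rewrite ler_wpM2r ?cmod_ge0// cmodM cmod_nat ler_wpM2l.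
  rewrite -cmodM vE.
  have := cmod_le_sub ((r + s + h%:C * (m' / s ^+ 2 - m / r ^+ 2) / 4) * v)
     (((s + p s m') - (r + p r m)) * u).
  apply: le_trans; rewrite !cmodM.
  have h3 : cmod (s + p s m' - (r + p r m)) <= 2 * P.
    apply: le_trans (le_cmodB _ _) _.
    have := le_cmodD s (p s m'); have := le_cmodD r (p r m); lra.
  have h4 : cmod (s + p s m' - (r + p r m)) * cmod u <= 2 * P * (C0 * h ^+ 2 * cmod v).
    by rewrite ler_pM ?cmod_ge0.
  have h5 : c0 * h * cmod v <= cmod (r + s + h%:C * (m' / s ^+ 2 - m / r ^+ 2) / 4) * cmod v.
    by rewrite ler_wpM2r ?cmod_ge0.
  have h6 : 4 * P * C0 * h * (h * cmod v) <= c0 * (h * cmod v).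
    rewrite ler_wpM2r ?mulr_ge0 ?cmod_ge0 ?(ltW h0)// mulrC -ler_pdivlMr ?mulr_gt0//.
    exact: ltW.
  have : 2 * rho * (c0 * h / (4 * rho) * cmod v) = c0 * h * cmod v / 2.
    by field; rewrite gt_eqF.
  by lra.
have k0 : 0 < c0 * h / (4 * rho) by rewrite divr_gt0 ?mulr_gt0.
split.
  by rewrite -cmod_gt0 (lt_le_trans _ vB)// mulr_gt0.
apply: (le_trans uB).
rewrite (_ : 4 * rho * B / c0 / h * _ = B * (cmod (vdecay h m' s y z) / (c0 * h / (4 * rho)))).
  by rewrite ler_wpM2l ?(ltW B0)// ler_pdivlMr// mulrC.
by field; rewrite !gt_eqF.
Qed.

Definition airy_solution h (m c : R[i]) (Y Y1 : R[i] -> R[i]) : Prop :=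
  (forall t, cdiff Y t (Y1 t)) /\
  forall t, cdiff Y1 t ((m * t + c) / h%:C ^+ 2 * Y t).

(** The thresholds depend on neither [c] nor the moved end points, hence not on the spectral
    parameter, which enters through them. *)
Definition path_transfer m ra rb (C : R) : Prop :=
  exists eta h1 C' : R, [/\ 0 < eta, 0 < h1, 0 < C' &
  forall ra' rb' h (c : R[i]) (Y Y1 : R[i] -> R[i]),
    cmod (ra' - ra) < eta -> cmod (rb' - rb) < eta -> 0 < h < h1 ->
    airy_solution h m c Y Y1 ->
    let ta := (ra' ^+ 2 - c) / m in let tb := (rb' ^+ 2 - c) / m in
    let ua := ugrow h m ra' (Y ta) (h%:C * Y1 ta) in
    let va := vdecay h m ra' (Y ta) (h%:C * Y1 ta) in
    let ub := ugrow h m rb' (Y tb) (h%:C * Y1 tb) in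
    let vb := vdecay h m rb' (Y tb) (h%:C * Y1 tb) in
    va != 0 -> cmod ua <= C / h * cmod va ->
    vb != 0 /\ cmod ub <= C' * h ^+ 2 * cmod vb].

(** For two segments, the bound [C1 h ^ 2] reached at the intermediate point is weakened to
    [C1 / h], which is all that the second segment asks for. *)
Lemma path_step m ra rb (C : R) : m != 0 -> 0 < C -> good_path m ra rb ->
  path_transfer m ra rb C.
Proof.
move=> m0 C0.
have step ra1 rb1 (C1 : R) : 0 < C1 -> good_segment m ra1 rb1 -> path_transfer m ra1 rb1 C1.
  move=> C10 /(good_segment_near m0)[eta [kap [M [del [eta0 kap0 M0 del0 H]]]]].
  have [h1 [C' [h10 C'0 H']]] := segment_step kap0 M0 del0 C10.
  exists eta, h1, C'; split=> // ra' rb' h c Y Y1 ha hb h01 [dY dY1].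
  have [ra'0 rab' D1 D2 D3] := H _ _ ha hb.
  exact: H' h01 m0 ra'0 rab' D1 D2 D3 dY dY1.
case=> [|[rm g1 g2]]; first exact: step.
have [e1 [h1 [C1 [e10 h10 C10 H1]]]] := step _ _ C C0 g1.
have [e2 [h2 [C2 [e20 h20 C20 H2]]]] := step _ _ C1 C10 g2.
exists (Num.min e1 e2), (Num.min 1 (Num.min h1 h2)), C2; split=> //.
- by rewrite lt_min e10.
- by rewrite !lt_min ltr01 h10.
move=> ra' rb' h c Y Y1; rewrite !lt_min => /andP[a1 a2] /andP[b1 b2].
move=> /andP[h0 /and3P[hh hh1 hh2]] S ta tb ua va ub vb va0 uva.
have [||vm0 um] := H1 ra' rm h c Y Y1 a1 _ _ S va0 uva.
- by rewrite subrr cmod0.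
- by rewrite h0.
apply: (H2 rm rb' h c Y Y1) => //.
- by rewrite subrr cmod0.
- by rewrite h0.
apply: (le_trans um); rewrite ler_wpM2r ?cmod_ge0// ler_wpM2l ?(ltW C10)//.
apply: le_trans (_ : 1 <= _); first by rewrite exprn_ile1// ltW.
by rewrite invf_ge1// ltW.
Qed.

End Chain.

(** * Lower bound for the transfer coefficient at a break *)

Section Break.
Context {R : realType}.

Lemma cmod_near (r r0 : R[i]) (e : R) : r0 != 0 -> e <= 1 -> e <= cmod r0 / 2 ->
  cmod (r - r0) < e -> [/\ r != 0, cmod r <= cmod r0 + 1 & cmod r^-1 <= 2 * cmod r0^-1].
Proof.
move=> r00 e1 e2 h; have r0p : 0 < cmod r0 by rewrite cmod_gt0.
have r1 : cmod r0 / 2 <= cmod r.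
  have := cmod_le_sub r0 (r0 - r); rewrite subKr (cmodB r0).
  by lra.
have rp : 0 < cmod r by rewrite (lt_le_trans _ r1)// divr_gt0.
split; first by rewrite -cmod_gt0.
  rewrite -(subrK r0 r) (le_trans (le_cmodD _ _))// addrC lerD2l.
  by rewrite (le_trans (ltW h)).
rewrite !cmodV -[2 * _]invrK invfM invrK mulrC lef_pV2 ?posrE// divr_gt0//.
Qed.

(** If [a + b] is nonzero, the term [r + s] dominates for small [h]. If [b = - a], then [V] is
    continuous at the break and the coefficient is of order [h] with factor [m' - m], which is
    nonzero by hypothesis. *)
Lemma break_coefficient (m m' a b : R[i]) : a != 0 -> b != 0 ->
  (b ^+ 2 = a ^+ 2 -> m <> m') ->
  exists eta h1 c0 : R, [/\ 0 < eta, 0 < h1, 0 < c0 & forall r s (h : R),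
    cmod (r - b) < eta -> cmod (s - a) < eta -> 0 < h < h1 ->
    r ^+ 2 - b ^+ 2 = s ^+ 2 - a ^+ 2 ->
    c0 * h <= cmod (r + s + h%:C * (m' / s ^+ 2 - m / r ^+ 2) / 4)].
Proof.
move=> a0 b0 mm'.
have ap : 0 < cmod a by rewrite cmod_gt0.
have bp : 0 < cmod b by rewrite cmod_gt0.
pose rho := cmod a + cmod b + 1 + 2 * cmod a^-1 + 2 * cmod b^-1 + cmod m + cmod m'.
have rhoE : [/\ 0 < rho, cmod a + 1 <= rho, cmod b + 1 <= rho, 2 * cmod a^-1 <= rho & 2 * cmod b^-1 <= rho].
  have := cmod_ge0 a^-1; have := cmod_ge0 b^-1; have := cmod_ge0 m; have := cmod_ge0 m'.
  by rewrite /rho; split; lra.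
have [mrho m'rho] : cmod m <= rho /\ cmod m' <= rho.
  have := cmod_ge0 a^-1; have := cmod_ge0 b^-1; have := cmod_ge0 m; have := cmod_ge0 m'.
  by rewrite /rho; split; lra.
clearbody rho; case: rhoE => rho0 ra rb rai rbi.
pose eta0 := Num.min 1 (Num.min (cmod a / 2) (cmod b / 2)).
have eta00 : 0 < eta0 by rewrite !lt_min ltr01 !divr_gt0.
have near (r s : R[i]) : cmod (r - b) < eta0 -> cmod (s - a) < eta0 ->
   [/\ r != 0, s != 0, cmod r <= rho, cmod r^-1 <= rho & cmod s^-1 <= rho].
  move=> hr hs.
  have [|| r0 r1 r2] := cmod_near b0 _ _ hr; rewrite ?ge_min ?lexx ?orbT//.
  have [|| s0 s1 s2] := cmod_near a0 _ _ hs; rewrite ?ge_min ?lexx ?orbT//.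
  by split => //; [apply: le_trans r1 _|apply: le_trans r2 _|apply: le_trans s2 _].
have kB (r s : R[i]) : cmod (r - b) < eta0 -> cmod (s - a) < eta0 ->
    cmod (m' / s ^+ 2 - m / r ^+ 2) <= 2 * rho ^+ 3.
  move=> hr hs; have [r0 s0 r1 r2 s2] := near r s hr hs.
  have q (k t : R[i]) : cmod k <= rho -> cmod t^-1 <= rho -> cmod (k / t ^+ 2) <= rho ^+ 3.
    move=> k1 t1; rewrite cmodM -exprVn cmodX [rho ^+ 3]exprS.
    by rewrite ler_pM ?cmod_ge0 ?sqr_ge0// lerXn2r ?nnegrE ?cmod_ge0// ltW.
  by apply: le_trans (le_cmodB _ _) _; have := q m' s m'rho s2; have := q m r mrho r2; lra.
have rho3 : 0 < rho ^+ 3 by rewrite exprn_gt0.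
have [ab|ab] := eqVneq (b + a) 0.
- have bE : b = - a by apply/eqP; rewrite -subr_eq0 opprK ab.
  have mm : m != m' by apply/eqP/mm'; rewrite bE sqrrN.
  have mp : 0 < cmod (m' - m) by rewrite cmod_gt0 subr_eq0 eq_sym.
  exists eta0, 1, (cmod (m' - m) / (4 * rho ^+ 2)); split=> //.
    by rewrite divr_gt0 ?mulr_gt0 ?exprn_gt0.
  move=> r s h hr hs /andP[h0 h1] rs; have [r0 s0 r1 r2 s2] := near r s hr hs.
  (* Both squares are displaced by the same amount, so [r = - s] holds exactly and no term of order
     zero disturbs the slope term. *)
  have {}rs : r ^+ 2 = s ^+ 2 by move: rs; rewrite bE sqrrN => /addIr.
  have rsN : r = - s.
    have /eqP : (r + s) * (r - s) = 0 by transitivity (r ^+ 2 - s ^+ 2); [ring|rewrite rs subrr].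
    rewrite mulf_eq0 => /orP[/eqP E|/eqP E]; first by apply/eqP; rewrite -subr_eq0 opprK E.
    exfalso; have {}E : r = s by apply/eqP; rewrite -subr_eq0 E.
    have := le_cmodB (r - b) (s - a).
    rewrite E bE (_ : s - - a - (s - a) = 2%:R * a); last by ring.
    rewrite cmodM cmod_nat.
    move: hr hs; rewrite E bE !lt_min => /and3P[_ hr _] /and3P[_ hs _].
    by lra.
  rewrite (_ : _ + _ + _ = h%:C * (m' - m) / (4 * r ^+ 2)); last first.
    by rewrite rsN; field; rewrite s0.
  rewrite !cmodM cmod_real gtr0_norm// cmodV cmodM cmod_nat cmodX.
  rewrite mulrC mulrA ler_wpM2l ?mulr_ge0 ?cmod_ge0 ?(ltW h0)//.
  rewrite lef_pV2 ?posrE ?mulr_gt0 ?exprn_gt0 ?cmod_gt0// ler_wpM2l//.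
  by rewrite lerXn2r ?nnegrE ?cmod_ge0// ltW.
- clearbody eta0; pose sg := cmod (b + a); have sg0 : 0 < sg by rewrite cmod_gt0.
  exists (Num.min eta0 (sg / 4)), (Num.min 1 (sg / (4 * rho ^+ 3))), (sg / 8); split.
  + by rewrite lt_min eta00 divr_gt0.
  + by rewrite lt_min ltr01 divr_gt0 ?mulr_gt0.
  + by rewrite divr_gt0.
  move=> r s h; rewrite !lt_min => /andP[hr hr'] /andP[hs hs'] /and3P[h0 hl1 hl2] _.
  have := kB r s hr hs; set k := _ - _ / _ => kb.
  have e1 := cmod_le_sub (b + a) (b + a - (r + s)).
  rewrite subKr (_ : b + a - (r + s) = - ((r - b) + (s - a))) ?cmodN in e1; last by ring.
  have e2 := le_cmodD (r - b) (s - a).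
  have e3 := cmod_le_sub (r + s) (- (h%:C * k / 4)); rewrite opprK cmodN in e3.
  apply: le_trans e3.
  have -> : cmod (h%:C * k / 4) = h * cmod k / 4.
    by rewrite !cmodM cmod_real gtr0_norm// cmodV cmod_nat.
  have : h * cmod k <= h * (2 * rho ^+ 3) by rewrite ler_wpM2l ?(ltW h0).
  move: hl2; rewrite ltr_pdivlMr ?mulr_gt0// => hl2.
  have : sg / 8 * h <= sg / 8 * 1 by rewrite ler_wpM2l ?divr_ge0 ?(ltW sg0) ?(ltW hl1).
  by rewrite -/sg in e1; lra.
Qed.

End Break.

(** * Induction over the pieces *)

Section ChainNonvanishing.
Context {R : realType}.
Variables (n : nat) (x : nat -> R) (m l a b : nat -> R[i]) (z0 : R[i]).
Hypothesis n1 : (1 <= n)%N.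
Hypothesis m0 : forall i, (1 <= i <= n)%N -> m i != 0.
Hypothesis aE : forall i, (1 <= i <= n)%N -> a i ^+ 2 = m i * (x i.-1)%:C + l i - z0.
Hypothesis bE : forall i, (1 <= i <= n)%N -> b i ^+ 2 = m i * (x i)%:C + l i - z0.
Hypothesis ab : forall i, (1 <= i <= n)%N -> good_path (m i) (a i) (b i).
Hypothesis brk : forall i : nat, (1 <= i < n)%N ->
  m i * (x i)%:C + l i = m i.+1 * (x i)%:C + l i.+1 -> m i <> m i.+1.

Definition chain_solution (z : R[i]) (h : R) (Y Y1 : nat -> R[i] -> R[i]) : Prop :=
  [/\ forall i, (1 <= i <= n)%N -> airy_solution h (m i) (l i - z) (Y i) (Y1 i),
      forall i, (1 <= i < n)%N -> Y i (x i)%:C = Y i.+1 (x i)%:C /\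
                                  Y1 i (x i)%:C = Y1 i.+1 (x i)%:C,
      Y 1%N (x 0%N)%:C = 0 & Y1 1%N (x 0%N)%:C != 0].

(** Stated for every root [s] near [a i], since the actual root depends on [z] and is supplied by
    [sqrt_near] at the moment of use. *)
Let start_ok i := exists eta del h1 C : R, [/\ 0 < eta, 0 < del, 0 < h1, 0 < C &
  forall z h Y Y1 s, cmod (z - z0) < del -> 0 < h < h1 -> chain_solution z h Y Y1 ->
    s ^+ 2 = m i * (x i.-1)%:C + l i - z -> cmod (s - a i) < eta ->
    let u := ugrow h (m i) s (Y i (x i.-1)%:C) (h%:C * Y1 i (x i.-1)%:C) in
    let v := vdecay h (m i) s (Y i (x i.-1)%:C) (h%:C * Y1 i (x i.-1)%:C) in
    v != 0 /\ cmod u <= C / h * cmod v].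

Let end_ok i := exists eta del h1 C : R, [/\ 0 < eta, 0 < del, 0 < h1, 0 < C &
  forall z h Y Y1 r, cmod (z - z0) < del -> 0 < h < h1 -> chain_solution z h Y Y1 ->
    r ^+ 2 = m i * (x i)%:C + l i - z -> cmod (r - b i) < eta ->
    let u := ugrow h (m i) r (Y i (x i)%:C) (h%:C * Y1 i (x i)%:C) in
    let v := vdecay h (m i) r (Y i (x i)%:C) (h%:C * Y1 i (x i)%:C) in
    v != 0 /\ cmod u <= C * h ^+ 2 * cmod v].

Lemma good_path_neq0 i : (1 <= i <= n)%N -> a i != 0 /\ b i != 0.
Proof.
have S k ra rb : good_segment k ra rb -> ra != 0 /\ rb != 0.
  move=> [ra0 /sector3_neq0 + _]; rewrite mulf_eq0 negb_or => /andP[-> _].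
  by rewrite ra0.
by move=> /ab[/S//|[rm /S[ra0 _] /S[_ rb0]]].
Qed.

(** The Dirichlet condition gives [y = 0], so [ugrow] and [vdecay] both equal [h y'] and their ratio
    is 1, which is below [1 / h]. *)
Let base : start_ok 1.
Proof.
exists 1, 1, 1, 1; split=> // z h Y Y1 s _ /andP[h0 h1] [_ _ Y0 Y10] _ _ /=.
have hc : h%:C != 0 by rewrite fmorph_eq0 gt_eqF.
rewrite /ugrow /vdecay Y0 !mulr0 subr0 addr0 mulf_neq0//; split=> //.
by rewrite ler_peMl ?cmod_ge0// div1r invf_ge1// ltW.
Qed.

Let start_end i : (1 <= i <= n)%N -> start_ok i -> end_ok i.
Proof.
move=> ni [eta [del [h1 [C [eta0 del0 h10 C0 H]]]]].
have [ai0 bi0] := good_path_neq0 ni.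
have [eta' [h2 [C' [eta'0 h20 C'0 H']]]] := path_step (m0 ni) C0 (ab ni).
have e0 : 0 < Num.min eta eta' by rewrite lt_min eta0.
have [del2 del20 Hs] := sqrt_near ai0 e0.
exists eta', (Num.min del del2), (Num.min h1 h2), C'; split=> //.
- by rewrite lt_min del0.
- by rewrite lt_min h10.
move=> z h Y Y1 r; rewrite !lt_min => /andP[z1 z2] /and3P[h0 hh1 hh2] S rE rb.
have [s sE] : exists2 s, s ^+ 2 = m i * (x i.-1)%:C + l i - z &
    cmod (s - a i) < Num.min eta eta'.
  apply: Hs; rewrite aE// (_ : _ - _ - _ = z0 - z); last by ring.
  by rewrite cmodB.
rewrite lt_min => /andP[s1 s2].
have [|v0 uv] := H z h Y Y1 s z1 _ S sE s1; first by rewrite h0.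
have [S1 _ _ _] := S.
have tE (t : R) (w : R[i]) : w ^+ 2 = m i * t%:C + l i - z ->
    (w ^+ 2 - (l i - z)) / m i = t%:C.
  by move=> ->; field; exact: m0.
have := H' s r h (l i - z) (Y i) (Y1 i) s2 rb _ (S1 i ni).
by rewrite (tE _ _ sE) (tE _ _ rE) h0 hh2 => /(_ isT v0 uv).
Qed.

Let end_start i : (1 <= i < n)%N -> end_ok i -> start_ok i.+1.
Proof.
move=> ni [eta [del [h1 [C [eta0 del0 h10 C0 H]]]]].
have ni1 : (1 <= i <= n)%N by lia.
have ni2 : (1 <= i.+1 <= n)%N by lia.
have [_ bi0] := good_path_neq0 ni1; have [ai0 _] := good_path_neq0 ni2.
have brk' : b i ^+ 2 = a i.+1 ^+ 2 -> m i <> m i.+1.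
  by rewrite bE// aE//= => /addIr; exact: brk.
have [e2 [h2 [c0 [e20 h20 c00 Hc]]]] := break_coefficient ai0 bi0 brk'.
have ap : 0 < cmod (a i.+1) by rewrite cmod_gt0.
have bp : 0 < cmod (b i) by rewrite cmod_gt0.
pose rho := cmod (a i.+1) + cmod (b i) + 1 + 2 * cmod (a i.+1)^-1 + 2 * cmod (b i)^-1
  + cmod (m i) + cmod (m i.+1).
have [rho0 rhoa rhob] : [/\ 0 < rho, cmod (a i.+1) + 1 <= rho & cmod (b i) + 1 <= rho].
  have := cmod_ge0 (a i.+1)^-1; have := cmod_ge0 (b i)^-1.
  by have := cmod_ge0 (m i); have := cmod_ge0 (m i.+1); rewrite /rho; split; lra.
have [rhoa' rhob' rhom rhom'] : [/\ 2 * cmod (a i.+1)^-1 <= rho,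
    2 * cmod (b i)^-1 <= rho, cmod (m i) <= rho & cmod (m i.+1) <= rho].
  have := cmod_ge0 (a i.+1)^-1; have := cmod_ge0 (b i)^-1.
  by have := cmod_ge0 (m i); have := cmod_ge0 (m i.+1); rewrite /rho; split; lra.
have [h3 [C' [h30 C'0 H']]] := break_step rho0 c00 C0.
pose e3 := Num.min (Num.min 1 e2) (Num.min (cmod (a i.+1) / 2) (cmod (b i) / 2)).
have e30 : 0 < e3 by rewrite !lt_min ltr01 e20 !divr_gt0.
have [e31 e32 e33 e34] : [/\ e3 <= 1, e3 <= e2, e3 <= cmod (a i.+1) / 2 &
    e3 <= cmod (b i) / 2] by rewrite !ge_min !lexx ?orbT.
clearbody e3; have e0 : 0 < Num.min eta e3 by rewrite lt_min eta0.
have [del2 del20 Hs] := sqrt_near bi0 e0.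
exists e3, (Num.min del del2), (Num.min h1 (Num.min h2 h3)), C'; split=> //.
- by rewrite lt_min del0.
- by rewrite !lt_min h10 h20.
move=> z h Y Y1 s; rewrite !lt_min => /andP[z1 z2] /and4P[h0 hh1 hh2 hh3] S sE sa.
have [r rE] : exists2 r, r ^+ 2 = m i * (x i)%:C + l i - z &
    cmod (r - b i) < Num.min eta e3.
  apply: Hs; rewrite bE// (_ : _ - _ - _ = z0 - z); last by ring.
  by rewrite cmodB.
rewrite lt_min => /andP[r1 r2].
have [|v0 uv] := H z h Y Y1 r z1 _ S rE r1; first by rewrite h0.
have [_ S2 _ _] := S; have [YE Y1E] := S2 i ni.
have [|| r3 r4 r5] := cmod_near bi0 _ _ r2 => //.
have [|| s3 s4 s5] := cmod_near ai0 _ _ sa => //.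
rewrite /= -YE -Y1E.
apply: H' v0 uv => //; rewrite ?h0 ?hh3//; try by [apply: le_trans rhoa|apply: le_trans rhob|apply: le_trans rhoa'|apply: le_trans rhob'].
apply: Hc; rewrite ?h0 ?hh2//.
- exact: lt_le_trans r2 e32.
- exact: lt_le_trans sa e32.
- by rewrite rE sE bE// aE//=; ring.
Qed.

Let start_all i : (i < n)%N -> start_ok i.+1.
Proof.
elim: i => [_|i IH ni]; first exact: base.
by apply: end_start; [lia|apply: start_end; [lia|apply: IH; lia]].
Qed.

(** If the solution vanished at the right end, [ugrow] and [vdecay] would coincide there, against
    [|u| <= C h ^ 2 |v|] with [C h ^ 2 < 1]. *)
Lemma chain_nonvanishing : exists del h1 : R, [/\ 0 < del, 0 < h1 &
  forall z h Y Y1, cmod (z - z0) < del -> 0 < h < h1 -> chain_solution z h Y Y1 ->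
    Y n (x n)%:C != 0].
Proof.
have nn : (1 <= n <= n)%N by rewrite n1 leqnn.
have : end_ok n.
  by apply: start_end => //; case: n n1 start_all => // k _; apply.
move=> [eta [del [h1 [C [eta0 del0 h10 C0 H]]]]].
have [_ b0] := good_path_neq0 nn.
have [del2 del20 Hs] := sqrt_near b0 eta0.
exists (Num.min del del2), (Num.min h1 (Num.min 1 C^-1)); split.
- by rewrite lt_min del0.
- by rewrite !lt_min h10 ltr01 invr_gt0.
move=> z h Y Y1; rewrite !lt_min => /andP[z1 z2] /and4P[h0 hh1 hh2 hh3] S.
have [r rE rb] : exists2 r, r ^+ 2 = m n * (x n)%:C + l n - z & cmod (r - b n) < eta.
  apply: Hs; rewrite bE// (_ : _ - _ - _ = z0 - z); last by ring.
  by rewrite cmodB.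
have [|v0 uv] := H z h Y Y1 r z1 _ S rE rb; first by rewrite h0.
apply/eqP => Y0; move: v0 uv; rewrite Y0 /ugrow /vdecay !mulr0 subr0 addr0.
rewrite -cmod_gt0 => v0; apply/negP; rewrite -ltNge -[ltRHS]mul1r ltr_pM2r//.
move: hh3; rewrite -div1r ltr_pdivlMr// => hh3.
by apply: le_lt_trans hh3; rewrite mulrC ler_wpM2r ?(ltW C0)// expr2 ler_piMl// ltW.
Qed.

End ChainNonvanishing.

(** * Geometry of Y(alpha, beta) *)

Section SectorGeometry.
Context {R : realType}.
Implicit Types (t w z r ra rb rm ta tb k : R[i]) (s : R).

Local Notation s3 := (Num.sqrt 3 : R).

Lemma sqrt3_sqr : s3 ^+ 2 = 3. Proof. by rewrite sqr_sqrtr. Qed.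
Lemma sqrt3_gt0 : 0 < s3. Proof. by rewrite sqrtr_gt0. Qed.

(** For [s = 1] or [s = -1] this is [cis (s pi / 3)], and [twelfth s] is [cis (s pi / 6)]. *)
Definition sixth (s : R) : R[i] := (1 / 2) +i* (s * s3 / 2).
Definition twelfth (s : R) : R[i] := (s3 / 2) +i* (s / 2).

Lemma sixth_cube s : s ^+ 2 = 1 -> sixth s ^+ 3 = -1.
Proof.
move=> s1; have := sqrt3_sqr; rewrite /sixth => h.
rewrite !exprS expr0 mulr1; apply: eqC => /=.
  transitivity (1 / 8 - 3 / 8 * s ^+ 2 * s3 ^+ 2); first by field.
  by rewrite s1 h; field.
transitivity (s * s3 * (3 / 8 - s ^+ 2 * s3 ^+ 2 / 8)); first by field.
by rewrite s1 h; field.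
Qed.

Lemma twelfth_sqr s : s ^+ 2 = 1 -> twelfth s ^+ 2 = sixth s.
Proof.
move=> s1; have := sqrt3_sqr; rewrite /sixth /twelfth => h.
rewrite expr2; apply: eqC => /=; last by field.
transitivity (s3 ^+ 2 / 4 - s ^+ 2 / 4); first by field.
by rewrite s1 h; field.
Qed.

Lemma sixth_neq0 s : sixth s != 0.
Proof. by apply/eqP => /(congr1 (@complex.Re R)) /=; lra. Qed.

Lemma twelfth_neq0 s : twelfth s != 0.
Proof. by have := sqrt3_gt0 => h; apply/eqP => /(congr1 (@complex.Re R)) /=; lra. Qed.

(** A good segment after the rotation that removes the argument of [m]; the action is then a
    positive multiple of [r ^ 3]. *)
Definition monotone_segment ra rb : Prop :=
  [/\ ra != 0, sector3 (rb / ra) & complex.Re (ra ^+ 3) < complex.Re (rb ^+ 3)].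

Definition monotone_path ra rb : Prop := monotone_segment ra rb \/
  exists2 rm, monotone_segment ra rm & monotone_segment rm rb.

(* The closed sector [|arg t| <= pi / 6], whose boundary is a zero set of
   [Re (t ^+ 3)]; its squares form the sector [|arg w| <= pi / 3]. *)
Definition hill t : Prop := 0 < complex.Re t /\ 3 * complex.Im t ^+ 2 <= complex.Re t ^+ 2.
Definition hill_int t : Prop := 0 < complex.Re t /\ 3 * complex.Im t ^+ 2 < complex.Re t ^+ 2.

Lemma hill_intW t : hill_int t -> hill t.
Proof. by move=> [? /ltW]. Qed.

Lemma hill_neq0 t : hill t -> t != 0.
Proof. by move=> [t0 _]; apply: contraTneq t0 => ->; rewrite ltxx. Qed.

Lemma Re_cube t : complex.Re (t ^+ 3) =
  complex.Re t * (complex.Re t ^+ 2 - 3 * complex.Im t ^+ 2).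
Proof. by case: t => a b; rewrite !exprS expr0 /=; ring. Qed.

Lemma hill_int_cube t : hill_int t -> 0 < complex.Re (t ^+ 3).
Proof. by move=> [t0 t1]; rewrite Re_cube mulr_gt0// subr_gt0. Qed.

Lemma hill_intP t : hill t -> complex.Re (t ^+ 3) != 0 -> hill_int t.
Proof.
move=> [t0 t1]; rewrite Re_cube mulf_eq0 (gt_eqF t0) /= subr_eq0 => h.
by split=> //; rewrite lt_neqAle eq_sym h.
Qed.

(** Both arguments lie within [pi / 6] of 0, one of them strictly, so they differ by less than
    [pi / 3]. *)
Lemma hill_ratio ta tb : hill ta -> hill_int tb ->
  sector3 (tb / ta) /\ sector3 (ta / tb).
Proof.
move=> ha hb; have ta0 := hill_neq0 ha; have tb0 := hill_neq0 (hill_intW hb).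
case: ta tb ha hb ta0 tb0 => [X Y] [X' Y'] [/= X0 XY] [/= X'0 XY'] ta0 tb0.
have yy : `|X * Y'| + `|X' * Y| < s3^-1 * (2 * (X * X')).
  have h1 : `|Y| <= X / s3.
    rewrite -(@ler_pXn2r _ 2) ?nnegrE ?divr_ge0 ?(ltW X0) ?(ltW sqrt3_gt0)//.
    rewrite real_normK ?num_real// exprMn exprVn sqrt3_sqr; lra.
  have h2 : `|Y'| < X' / s3.
    rewrite -(@ltr_pXn2r _ 2)// ?nnegrE ?divr_ge0 ?(ltW X'0) ?(ltW sqrt3_gt0)//.
    rewrite real_normK ?num_real// exprMn exprVn sqrt3_sqr; lra.
  rewrite !normrM (gtr0_norm X0) (gtr0_norm X'0).
  have : X * `|Y'| < X * (X' / s3) by rewrite ltr_pM2l.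
  have : X' * `|Y| <= X' * (X / s3) by rewrite ler_pM2l.
  by lra.
have XX : 0 < X * X' by rewrite mulr_gt0.
have YY : 3 * `|Y * Y'| <= X * X'.
  rewrite -(@ler_pXn2r _ 2) ?nnegrE ?(ltW XX) ?mulr_ge0//.
  rewrite exprMn real_normK ?num_real// !exprMn.
  have := ler_pM (mulr_ge0 (ler0n _ 3) (sqr_ge0 Y)) (mulr_ge0 (ler0n _ 3) (sqr_ge0 Y')) XY (ltW XY').
  by lra.
move: YY; rewrite -ler_pdivlMl// ler_norml => /andP[YY _].
have Re0 : 2 / 3 * (X * X') <= X * X' + Y * Y' by lra.
have Im2 (a b : R) : `|a| + `|b| < s3^-1 * (2 * (X * X')) ->
    (a - b) ^+ 2 < 3 * (X * X' + Y * Y') ^+ 2.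
  move=> ab; rewrite -(real_normK (num_real (a - b))).
  have h1 : `|a - b| ^+ 2 < (s3^-1 * (2 * (X * X'))) ^+ 2.
    rewrite ltrXn2r ?nnegrE ?mulr_ge0 ?invr_ge0 ?(ltW sqrt3_gt0) ?(ltW XX)//.
    by rewrite (le_lt_trans (ler_normB _ _)).
  apply: lt_le_trans h1 _; rewrite exprMn exprVn sqrt3_sqr.
  have : (2 / 3 * (X * X')) ^+ 2 <= (X * X' + Y * Y') ^+ 2.
    by rewrite lerXn2r ?nnegrE ?mulr_ge0 ?(ltW XX)//; lra.
  by rewrite !exprMn; lra.
split.
- apply/(sector3_conjE _ ta0); split => /=; first by lra.
  have := Im2 (X * Y') (X' * Y) yy; rewrite (_ : X' * X - Y' * - Y = X * X' + Y * Y'); last by ring.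
  by rewrite (_ : X' * - Y + Y' * X = X * Y' - X' * Y)//; ring.
- apply/(sector3_conjE _ tb0); split => /=; first by lra.
  rewrite addrC in yy.
  have := Im2 (X' * Y) (X * Y') yy; rewrite (_ : X * X' - Y * - Y' = X * X' + Y * Y'); last by ring.
  by rewrite (_ : X * - Y' + Y * X' = X' * Y - X * Y')//; ring.
Qed.

(** The roots [k t] and [- k t] have the same square and opposite cubes, so a common choice of sign
    makes the real part of the cube increase. One segment suffices: the two cubes have different
    real parts, hence one of the points is interior to the hill. *)
Lemma same_sector_path k ta tb : k ^+ 3 = 1 \/ k ^+ 3 = -1 -> hill ta -> hill tb ->
  complex.Re (ta ^+ 3) != complex.Re (tb ^+ 3) ->
  exists ra rb, [/\ ra ^+ 2 = k ^+ 2 * ta ^+ 2, rb ^+ 2 = k ^+ 2 * tb ^+ 2 &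
    monotone_path ra rb].
Proof.
move=> k31 ha hb ab.
have k0 : k != 0.
  apply/eqP => k0; move: k31; rewrite k0 expr0n /=.
  by case=> /(congr1 (@complex.Re R)) /=; lra.
have ta0 := hill_neq0 ha.
have [k' k'2 [k'0 k'3]] : exists2 k', k' ^+ 2 = k ^+ 2 &
    k' != 0 /\ (complex.Re (ta ^+ 3) < complex.Re (tb ^+ 3) /\ k' ^+ 3 = 1 \/
    complex.Re (tb ^+ 3) < complex.Re (ta ^+ 3) /\ k' ^+ 3 = -1).
  have nk : (- k) ^+ 3 = - k ^+ 3 by ring.
  have [lt|gt|E] := ltgtP (complex.Re (ta ^+ 3)) (complex.Re (tb ^+ 3)); last first.
  - by rewrite E eqxx in ab.
  - case: k31 => E; [exists (- k); rewrite ?sqrrN//|exists k => //].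
      by split; [rewrite oppr_eq0|right; rewrite nk E].
    by split=> //; right.
  - case: k31 => E; [exists k => //|exists (- k); rewrite ?sqrrN//].
      by split=> //; left.
    by split; [rewrite oppr_eq0|left; rewrite nk E opprK].
exists (k' * ta), (k' * tb); split; [by rewrite exprMn k'2|by rewrite exprMn k'2|].
left; split; first by rewrite mulf_neq0.
  rewrite (_ : k' * tb / (k' * ta) = tb / ta); last by field; rewrite ta0.
  have [E|E] := eqVneq (complex.Re (tb ^+ 3)) 0.
    by apply: (hill_ratio hb (hill_intP ha _)).2; rewrite -E.
  exact: (hill_ratio ha (hill_intP hb E)).1.
rewrite !exprMn; case: k'3 => -[lt ->]; first by rewrite !mul1r.
by rewrite !mulN1r !ReN ltrN2.
Qed.

(** Since [k ^ 3 = -1], the root [k * ta] has a cube of negative real part and [k * sixth s * tb]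
    one of positive real part. The angle between them may exceed [pi / 3], so the path stops at
    [k * twelfth s], on the bisecting ray where the real part of the cube is 0. *)
Lemma distinct_sector_path k s ta tb : k ^+ 3 = -1 -> s ^+ 2 = 1 ->
  hill_int ta -> hill_int tb ->
  exists ra rb, [/\ ra ^+ 2 = k ^+ 2 * ta ^+ 2,
    rb ^+ 2 = k ^+ 2 * sixth s ^+ 2 * tb ^+ 2 & monotone_path ra rb].
Proof.
move=> k3 s1 ha hb.
have k0 : k != 0.
  by apply/eqP => k0; move: k3; rewrite k0 expr0n /= => /(congr1 (@complex.Re R)) /=; lra.
have ta0 := hill_neq0 (hill_intW ha); have tb0 := hill_neq0 (hill_intW hb).
exists (k * ta), (k * sixth s * tb); split; [by rewrite exprMn|by rewrite !exprMn|].
have hg (e : R) : e ^+ 2 = 1 -> hill (twelfth e).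
  move=> e1; split; first by rewrite /= divr_gt0// sqrt3_gt0.
  by rewrite /= !exprMn exprVn e1 sqrt3_sqr; lra.
have g3 : complex.Re ((k * twelfth s) ^+ 3) = 0.
  rewrite exprMn k3 mulN1r ReN Re_cube /= !exprMn exprVn s1 sqrt3_sqr.
  by field.
right; exists (k * twelfth s); split.
- by rewrite mulf_neq0.
- rewrite (_ : k * twelfth s / (k * ta) = twelfth s / ta); last by field; rewrite ta0.
  exact: (hill_ratio (hg s s1) ha).2.
- rewrite g3 exprMn k3 mulN1r ReN oppr_lt0; exact: hill_int_cube.
- by rewrite mulf_neq0// twelfth_neq0.
- rewrite (_ : k * sixth s * tb / (k * twelfth s) = tb / twelfth (- s)).
    by apply: (hill_ratio _ hb).1; apply: hg; rewrite sqrrN.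
  have gg : twelfth s * twelfth (- s) = 1.
    have := sqrt3_sqr => h; apply: eqC; rewrite /twelfth /=; last by ring.
    transitivity (s3 ^+ 2 / 4 + s ^+ 2 / 4); first by field.
    by rewrite h s1; field.
  have g0 := twelfth_neq0 s; have g0' := twelfth_neq0 (- s).
  rewrite -twelfth_sqr//.
  transitivity (tb * (twelfth s * twelfth (- s)) / twelfth (- s)).
    by field; rewrite g0 k0 g0'.
  by rewrite gg mulr1.
- rewrite g3 !exprMn k3 sixth_cube// mulN1r opprK mul1r; exact: hill_int_cube.
Qed.

Lemma hill_root w : 0 < complex.Re w -> complex.Im w ^+ 2 <= 3 * complex.Re w ^+ 2 ->
  exists2 t, hill t & t ^+ 2 = w.
Proof.
move=> w0 w1.
have [t t0 tE] : exists2 t, 0 <= complex.Re t & t ^+ 2 = w.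
  have [h|h] := leP 0 (complex.Re (sqrtc w)).
    by exists (sqrtc w) => //; exact: sqr_sqrtc.
  exists (- sqrtc w); first by rewrite ReN oppr_ge0 ltW.
  by rewrite sqrrN; exact: sqr_sqrtc.
exists t => //; move: t0 w0 w1; rewrite -tE; case: t {tE} => X Y /= X0.
move=> XY.
have X1 : 0 < X.
  rewrite lt_neqAle X0 andbT; apply/eqP => E; move: XY; rewrite -E.
  by have := sqr_ge0 Y; lra.
move=> h; split => //=.
have : 0 <= (X ^+ 2 - 3 * Y ^+ 2) * (3 * X ^+ 2 - Y ^+ 2).
  by lra.
rewrite pmulr_lge0 ?subr_ge0//.
by have := sqr_ge0 X; rewrite -[X * X]expr2 -[Y * Y]expr2 in XY *; nra.
Qed.

(** The hypotheses say that [(X + i Y) ^ 2] moves to the right by [p]. With [X Y] fixed this forces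
    [X] to increase, and [X Y ^ 2 = (X Y) ^ 2 / X] to decrease. *)
Lemma cubic_mono (X1 Y1 X2 Y2 p : R) : 0 < X1 -> 0 < X2 -> X1 * Y1 = X2 * Y2 ->
  X2 ^+ 2 - Y2 ^+ 2 = X1 ^+ 2 - Y1 ^+ 2 + p -> 0 < p ->
  X1 ^+ 3 - 3 * X1 * Y1 ^+ 2 < X2 ^+ 3 - 3 * X2 * Y2 ^+ 2.
Proof.
move=> X10 X20 E D p0.
have Y2E : Y2 = X1 * Y1 / X2 by rewrite E mulrC mulKf// gt_eqF.
have X12 : X1 < X2.
  rewrite ltNge; apply/negP => le21.
  have h1 : X2 ^+ 2 <= X1 ^+ 2 by rewrite lerXn2r ?nnegrE ?(ltW X10) ?(ltW X20).
  have : X2 ^+ 2 * Y1 ^+ 2 <= X2 ^+ 2 * Y2 ^+ 2.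
    by rewrite -[leRHS]exprMn -E exprMn ler_wpM2r ?sqr_ge0//.
  rewrite ler_pM2l ?exprn_gt0// => h2; lra.
have h1 : X1 ^+ 3 < X2 ^+ 3 by rewrite ltrXn2r// ltW.
have h2 : X2 * Y2 ^+ 2 <= X1 * Y1 ^+ 2.
  rewrite (_ : X2 * Y2 ^+ 2 = (X1 * Y1) ^+ 2 / X2); last first.
    by rewrite E; field; rewrite gt_eqF.
  rewrite (_ : X1 * Y1 ^+ 2 = (X1 * Y1) ^+ 2 / X1); last by field; rewrite gt_eqF.
  by rewrite ler_wpM2l ?sqr_ge0// lef_pV2 ?posrE// ltW.
by lra.
Qed.

(** Here [T + i X = sixth 1 * t], so that its cube is [- t ^ 3]. In these coordinates a displacement
    of [t ^ 2] in the direction [sixth 1] becomes a real one. *)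
Lemma Re_twelfth t : let T := (complex.Re t - s3 * complex.Im t) / 2 in
  let X := (s3 * complex.Re t + complex.Im t) / 2 in
  [/\ complex.Re (t ^+ 3) = - (T ^+ 3 - 3 * T * X ^+ 2),
      complex.Re (t ^+ 2) = (X ^+ 2 - T ^+ 2 + 2 * s3 * T * X) / 2 &
      complex.Im (t ^+ 2) = (s3 * (X ^+ 2 - T ^+ 2) - 2 * T * X) / 2].
Proof.
have h := sqrt3_sqr; case: t => a b T X; rewrite /T /X /= !exprS expr0 !mulr1 /=.
have s33 : s3 ^+ 3 = 3 * s3 by rewrite exprSr h.
split.
- transitivity (- ((a - s3 * b) ^+ 3 - 3 * (a - s3 * b) * (s3 * a + b) ^+ 2) / 8); last by field.
  rewrite (_ : (a - s3 * b) ^+ 3 - 3 * (a - s3 * b) * (s3 * a + b) ^+ 2 =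
    a ^+ 3 - 9 * s3 * a ^+ 2 * b + 9 * s3 ^+ 2 * a * b ^+ 2 - s3 ^+ 3 * b ^+ 3
    + 3 * s3 ^+ 3 * a ^+ 2 * b - 3 * s3 ^+ 2 * a ^+ 3 - 3 * a * b ^+ 2 + 3 * s3 * b ^+ 3); last by ring.
  by rewrite s33 h; field.
- transitivity (((s3 * a + b) ^+ 2 - (a - s3 * b) ^+ 2 + 2 * s3 * (a - s3 * b) * (s3 * a + b)) / 8); last by field.
  rewrite (_ : (s3 * a + b) ^+ 2 - (a - s3 * b) ^+ 2 + 2 * s3 * (a - s3 * b) * (s3 * a + b) =
    3 * s3 ^+ 2 * a ^+ 2 + (6 * s3 - 2 * s3 ^+ 3) * a * b - 3 * s3 ^+ 2 * b ^+ 2 + b ^+ 2 - a ^+ 2); last by ring.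
  by rewrite s33 h; field.
- transitivity ((s3 * ((s3 * a + b) ^+ 2 - (a - s3 * b) ^+ 2) - 2 * (a - s3 * b) * (s3 * a + b)) / 8); last by field.
  rewrite (_ : s3 * ((s3 * a + b) ^+ 2 - (a - s3 * b) ^+ 2) - 2 * (a - s3 * b) * (s3 * a + b) =
    (s3 ^+ 3 - 3 * s3) * a ^+ 2 + (6 * s3 ^+ 2 - 2) * a * b + (3 * s3 - s3 ^+ 3) * b ^+ 2); last by ring.
  by rewrite s33 h; field.
Qed.

Lemma hill_cube_mono_real t1 t2 (p : R) : hill t1 -> hill t2 ->
  t2 ^+ 2 = t1 ^+ 2 + p%:C -> 0 <= p ->
  complex.Re (t1 ^+ 3) <= complex.Re (t2 ^+ 3) /\
  (0 < p -> complex.Re (t1 ^+ 3) < complex.Re (t2 ^+ 3)).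
Proof.
case: t1 t2 => [X1 Y1] [X2 Y2] [X10 _] [X20 _] E; rewrite /= in X10 X20.
have E1 := congr1 (@complex.Re R) E; have E2 := congr1 (@complex.Im R) E.
rewrite !expr2 /= in E1 E2.
have lt : 0 < p -> complex.Re ((X1 +i* Y1) ^+ 3) < complex.Re ((X2 +i* Y2) ^+ 3).
  move=> p0; rewrite !Re_cube /=.
  have := @cubic_mono X1 Y1 X2 Y2 p X10 X20; rewrite !mulrBr -!exprS => h.
  have {}h : X1 ^+ 3 - 3 * X1 * Y1 ^+ 2 < X2 ^+ 3 - 3 * X2 * Y2 ^+ 2.
    by apply: h => //; lra.
  by lra.
rewrite le_eqVlt => /orP[/eqP p0|p0]; last by split=> //; exact/ltW/lt.
split; last by rewrite -p0 ltxx.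
have E' : (X2 +i* Y2) ^+ 2 = (X1 +i* Y1) ^+ 2 by rewrite E -p0 addr0.
have /eqP := E'; rewrite eqf_sqr => /orP[/eqP->//|/eqP/(congr1 (@complex.Re R)) /=].
by move=> E3; move: X20; rewrite E3 oppr_gt0 ltNge (ltW X10).
Qed.

(** Adding [q * sixth 1] to [t ^ 2] subtracts [q] from [(T + i X) ^ 2], so [cubic_mono] applies with
    the two points exchanged. Strictness is lost only on the edge [arg t = pi / 6], where [T = 0]
    and the real part of the cube is 0. *)
Lemma hill_cube_mono_sixth t1 t2 (q : R) : hill t1 -> hill t2 ->
  t2 ^+ 2 = t1 ^+ 2 + q%:C * sixth 1 -> 0 <= q ->
  complex.Re (t1 ^+ 3) <= complex.Re (t2 ^+ 3) /\
  (0 < q -> s3 * complex.Im t2 < complex.Re t2 ->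
   complex.Re (t1 ^+ 3) < complex.Re (t2 ^+ 3)).
Proof.
move=> h1 h2 E; rewrite le_eqVlt => /orP[/eqP q0|q0].
  have E' : t2 ^+ 2 = t1 ^+ 2 by rewrite E -q0 mul0r addr0.
  have [/= t10 _] := h1; have [/= t20 _] := h2.
  have /eqP := E'; rewrite eqf_sqr => /orP[/eqP->|/eqP E2].
    by split=> //; rewrite -q0 ltxx.
  by move: t20; rewrite E2 ReN oppr_gt0 ltNge (ltW t10).
have h := sqrt3_sqr; have h0 := sqrt3_gt0.
have [C1 R1 I1] := Re_twelfth t1; have [C2 R2 I2] := Re_twelfth t2.
have Tge t : hill t -> 0 <= (complex.Re t - s3 * complex.Im t) / 2.
  move=> [t0 t1']; rewrite divr_ge0// subr_ge0.
  rewrite (le_trans (ler_norm _))// -(@ler_pXn2r _ 2) ?nnegrE ?(ltW t0)//.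
  by rewrite real_normK ?num_real// exprMn h.
have Xgt t : hill t -> 0 < (s3 * complex.Re t + complex.Im t) / 2.
  move=> [t0 t1']; rewrite divr_gt0//.
  have : `|complex.Im t| < s3 * complex.Re t.
    rewrite -(@ltr_pXn2r _ 2)// ?nnegrE ?mulr_ge0 ?(ltW t0) ?(ltW h0)//.
    rewrite real_normK ?num_real// exprMn h.
    have : 0 < complex.Re t ^+ 2 by rewrite exprn_gt0.
    have := sqr_ge0 (complex.Im t); lra.
  by rewrite ltr_norml => /andP[+ _]; lra.
have [T1 T2] := (Tge _ h1, Tge _ h2); have [X1 X2] := (Xgt _ h1, Xgt _ h2).
have E1 := congr1 (@complex.Re R) E; have E2 := congr1 (@complex.Im R) E.
rewrite !ReD !ImD ReMl ImMl R1 R2 I1 I2 /= in E1 E2; rewrite {}C1 {}C2.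
have -> : (s3 * complex.Im t2 < complex.Re t2) = (0 < (complex.Re t2 - s3 * complex.Im t2) / 2).
  by rewrite pmulr_lgt0 ?invr_gt0// subr_gt0.
move: T1 T2 X1 X2 E1 E2; set T1 := (_ - _) / 2; set T2 := (complex.Re t2 - _) / 2.
set X1 := (_ + _) / 2; set X2 := (_ + complex.Im t2) / 2.
clearbody T1 T2 X1 X2 => T10 T20 X10 X20 E1 E2.
have TX : T2 * X2 = T1 * X1.
  have e1 : s3 * (X2 ^+ 2 - T2 ^+ 2 + 2 * s3 * T2 * X2) =
    s3 * (X1 ^+ 2 - T1 ^+ 2 + 2 * s3 * T1 * X1) + s3 * q.
    by have := congr1 (fun y : R => 2 * s3 * y) E1 => /=; lra.
  have e2 : s3 ^+ 2 * (T2 * X2) + T2 * X2 = s3 ^+ 2 * (T1 * X1) + T1 * X1 by lra.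
  by rewrite h in e2; lra.
have TD : X2 ^+ 2 - T2 ^+ 2 = X1 ^+ 2 - T1 ^+ 2 + q.
  have e3 : s3 * (T2 * X2) = s3 * (T1 * X1) by rewrite TX.
  by lra.
rewrite !lerN2 !ltrN2.
have [T2p|T2n] := ltP 0 T2.
  have T1p : 0 < T1.
    rewrite lt_neqAle T10 andbT; apply/eqP => T1E; move: TX; rewrite -T1E mul0r => /eqP.
    by rewrite mulf_eq0 !gt_eqF.
  have lt : T2 ^+ 3 - 3 * T2 * X2 ^+ 2 < T1 ^+ 3 - 3 * T1 * X1 ^+ 2.
    by apply: (@cubic_mono T2 X2 T1 X1 q) => //; lra.
  by split=> //; exact: ltW.
have T2E : T2 = 0 by apply/eqP; rewrite eq_le T2n T20.
have T1E : T1 = 0.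
  by move/esym/eqP: TX; rewrite T2E mul0r mulf_eq0 (gt_eqF X10) orbF => /eqP.
by rewrite T2E T1E; split=> //; rewrite !expr0n /= !mulr0 !mul0r.
Qed.

(* Coordinates in the basis [-1], [cis (pi / 3)]. The cube root sectors of the
   plane are [u <= 0, u <= v], [0 <= u, 0 <= v] and [v <= 0, v <= u]. *)
Definition oblique (u v : R) : R[i] := (- u + v / 2) +i* (v * s3 / 2).

Lemma obliqueD (u v p q : R) :
  oblique (u - p) (v + q) = oblique u v + p%:C + q%:C * sixth 1.
Proof. by apply: eqC => /=; field. Qed.

Lemma sixth_sqr s : s ^+ 2 = 1 -> sixth s ^+ 2 = (- (1 / 2)) +i* (s * s3 / 2).
Proof.
move=> s1; rewrite expr2; apply: eqC => /=; last by field.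
transitivity (1 / 4 - s ^+ 2 * s3 ^+ 2 / 4); first by field.
by rewrite s1 sqrt3_sqr; field.
Qed.

(** Multiplication by a cube root of unity permutes the three sectors, so that roots need only be
    extracted in the first one, around the positive real axis. *)
Lemma oblique_rot1 u v : oblique u v = sixth 1 ^+ 2 * oblique (- v) (u - v).
Proof.
rewrite sixth_sqr ?expr1n//; apply: eqC => /=; last by field.
transitivity (- (u + v) / 4 - s3 ^+ 2 * (u - v) / 4); last by field.
by rewrite sqrt3_sqr; field.
Qed.

Lemma oblique_rot2 u v : oblique u v = sixth (-1) ^+ 2 * oblique (v - u) (- u).
Proof.
rewrite sixth_sqr ?sqrrN ?expr1n//; apply: eqC => /=; last by field.
transitivity (- (u - 2 * v) / 4 - s3 ^+ 2 * u / 4); last by field.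
by rewrite sqrt3_sqr; field.
Qed.

Lemma oblique_conj u v : (oblique u v)^* = oblique (u - v) (- v).
Proof. by apply: eqC => /=; field. Qed.

Lemma oblique_root (u v : R) : u <= 0 -> u <= v -> ~~ ((u == 0) && (v == 0)) ->
  exists2 t, hill t & t ^+ 2 = oblique u v.
Proof.
move=> u0 uv uv0; have h := sqrt3_sqr; apply: hill_root; rewrite /oblique /=.
  have [u00|u00] := eqVneq u 0.
    move: uv0; rewrite u00 eqxx /= => v0.
    have : 0 < v by rewrite lt_neqAle eq_sym v0 -u00.
    by lra.
  have : u < 0 by rewrite lt_neqAle u00.
  by lra.
rewrite !exprMn h.
by have := mulr_ge0 (_ : 0 <= - u) (_ : 0 <= v - u); rewrite oppr_ge0 subr_ge0; nra.
Qed.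

Lemma oblique_hill_int (u v : R) t : hill t -> t ^+ 2 = oblique u v ->
  u < 0 -> u < v -> hill_int t.
Proof.
move=> [t0 t1] E u0 uv; split=> //; rewrite lt_neqAle t1 andbT; apply/eqP => E'.
have E1 := congr1 (@complex.Re R) E; have E2 := congr1 (@complex.Im R) E.
case: t t0 E' E1 E2 {t1 E} => X Y /= X0 E' E1 E2.
have h := sqrt3_sqr.
have : (v * s3 / 2) ^+ 2 = 3 * (- u + v / 2) ^+ 2.
  rewrite -E1 -E2.
  have {}E' : X * X = 3 * (Y * Y) by rewrite -!expr2.
  by transitivity (4 * (X * X) * (Y * Y)); [ring|rewrite E'; ring].
rewrite !exprMn h => {}h.
have : 0 < - u * (v - u) by rewrite mulr_gt0 ?oppr_gt0 ?subr_gt0.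
by lra.
Qed.

Lemma oblique_upper (u v : R) t : hill t -> t ^+ 2 = oblique u v ->
  u < 0 -> s3 * complex.Im t < complex.Re t.
Proof.
move=> [t0 t1] E u0; have h := sqrt3_sqr; have h0 := sqrt3_gt0.
rewrite lt_neqAle; apply/andP; split.
  apply/eqP => E'.
  have E1 := congr1 (@complex.Re R) E; have E2 := congr1 (@complex.Im R) E.
  case: t t0 E' E1 E2 {t1 E} => X Y /= X0 E' E1 E2.
  rewrite -E' in E1 E2.
  have e1 : s3 ^+ 2 * Y ^+ 2 - Y ^+ 2 = - u + v / 2 by lra.
  have e2 : s3 * (2 * Y ^+ 2) = s3 * (v / 2) by lra.
  rewrite h in e1; move/(mulfI (lt0r_neq0 h0)): e2; lra.
rewrite (le_trans (ler_norm _))// -(@ler_pXn2r _ 2) ?nnegrE ?(ltW t0)//.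
by rewrite real_normK ?num_real// exprMn h.
Qed.

(** The displacement is split at [oblique u (v + q)], which lies in the same sector: a step along
    [sixth 1], then a real one. If [p = 0], strictness comes from the first step, since [u - p < 0]
    keeps its end off the upper edge. *)
Lemma oblique_cube_mono (u v p q : R) t1 t2 : 0 <= p -> 0 <= q -> 0 < p + q ->
  u <= 0 -> u <= v -> hill t1 -> hill t2 -> t1 ^+ 2 = oblique u v ->
  t2 ^+ 2 = oblique (u - p) (v + q) -> u - p < 0 ->
  complex.Re (t1 ^+ 3) < complex.Re (t2 ^+ 3).
Proof.
move=> p0 q0 pq u0 uv h1 h2 E1 E2 u2.
have [t h E] : exists2 t, hill t & t ^+ 2 = oblique (u - 0) (v + q).
  apply: oblique_root; [lra|lra|].
  apply/negP => /andP[/eqP a /eqP b]; have := expf_neq0 2 (hill_neq0 h1).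
  have u00 : u = 0 by lra.
  have v00 : v = 0 by lra.
  rewrite E1 u00 v00.
  by rewrite /oblique oppr0 !mul0r addr0 eqxx.
have D1 : t ^+ 2 = t1 ^+ 2 + q%:C * sixth 1 by rewrite E obliqueD E1 addr0.
have D2 : t2 ^+ 2 = t ^+ 2 + p%:C by rewrite D1 E2 obliqueD E1; ring.
have [l1 s1] := hill_cube_mono_sixth h1 h D1 q0.
have [l2 s2] := hill_cube_mono_real h h2 D2 p0.
move: p0; rewrite le_eqVlt => /orP[/eqP p0|/s2 s2'].
  have {}q0 : 0 < q by lra.
  by apply: lt_le_trans (s1 q0 _) l2; apply: oblique_upper h E _; lra.
exact: le_lt_trans l1 s2'.
Qed.

(** The second alternative covers the cut: for [w] on the negative half-line, the principal root is
    the one on the positive imaginary axis. *)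
Lemma cpow_three_half w r : r ^+ 2 = w -> 0 < complex.Re r \/
  complex.Re r = 0 /\ 0 < complex.Im r -> cpow w (3 / 2) = r ^+ 3.
Proof.
move=> rw r0.
have w0 : w != 0.
  rewrite -rw expf_eq0 /=; apply/eqP => rE; move: r0; rewrite rE /=.
  by case=> [|[_]]; rewrite ltxx.
have [/andP[a1 a2] wE] := cargP w0.
have cw : 0 < cmod w by rewrite cmod_gt0.
pose r' : R[i] := (cmod w `^ (1 / 2))%:C * cis (carg w / 2).
have cisM n (a : R) : cis a ^+ n = cis (n%:R * a).
  elim: n => [|n IH]; first by rewrite expr0 mul0r /cis cos0 sin0.
  by rewrite exprS IH -cisD -[n.+1%:R]natr1; congr cis; ring.
have r'2 : r' ^+ 2 = w.
  rewrite [RHS]wE /r' exprMn cisM -rmorphXn /= -powR_mulrn ?powR_ge0//.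
  by rewrite -powRrM mul1r mulVf// powRr1 ?(ltW cw)//; congr (_ * cis _); field.
have r'3 : cpow w (3 / 2) = r' ^+ 3.
  rewrite /cpow /r' exprMn cisM -rmorphXn /= -powR_mulrn ?powR_ge0//.
  by rewrite -powRrM; congr ((_ `^ _)%:C * cis _); field.
rewrite r'3; congr (_ ^+ 3).
have /eqP : r' ^+ 2 = r ^+ 2 by rewrite r'2 rw.
rewrite eqf_sqr => /orP[/eqP//|/eqP rN].
have rp : 0 < cmod w `^ (1 / 2) by rewrite powR_gt0.
have pi0 := pi_gt0 R.
have R' : 0 <= complex.Re r'.
  by rewrite ReMl mulr_ge0 ?(ltW rp)//= cos_ge0_pihalf//; apply/andP; split; lra.
exfalso; move: R'; rewrite rN ReN oppr_ge0 => R'.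
case: r0 => [r0|[r0 r1]]; first by move: R'; rewrite leNgt r0.
have : 0 < complex.Im r'.
  rewrite ImMl mulr_gt0//=; apply: sin_gt0_pi; apply/andP; split; last by lra.
  rewrite ltNge; apply/negP => c0.
  have : 0 < complex.Re r'.
    by rewrite ReMl mulr_gt0//= cos_gt0_pihalf//; apply/andP; split; lra.
  by rewrite rN ReN r0 oppr0 ltxx.
by rewrite rN ImN oppr_gt0 ltNge (ltW r1).
Qed.

End SectorGeometry.

(** * Case analysis on the sectors of the two end points *)

Section PathsOffY.
Context {R : realType}.
Local Notation s3 := (Num.sqrt 3 : R).

Lemma le_or_lt (x y : R) : x <= y \/ y < x.
Proof. by case: leP; [left|right]. Qed.

Lemma lt_or_le (x y : R) : x < y \/ y <= x.
Proof. by case: ltP; [left|right]. Qed.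

Lemma hill_conj (t : R[i]) : hill t -> hill t^*.
Proof. by case: t => a b; rewrite /hill /= sqrrN. Qed.

Lemma Re_conj_cube (t : R[i]) : complex.Re (t^* ^+ 3) = complex.Re (t ^+ 3).
Proof. by rewrite !Re_cube; case: t => a b /=; rewrite sqrrN. Qed.

Lemma sixthN1 : sixth (1 : R) * sixth (-1) = 1.
Proof.
apply: eqC => /=; last by field.
transitivity (1 / 4 + s3 ^+ 2 / 4); first by field.
by rewrite sqrt3_sqr; field.
Qed.

(** Normal form of the geometry: [A] and [B] are the rotated [alpha - z] and [beta - z]. The first
    two exclusions are the segments of [Y], the third is its curve. Distinct sectors always admit a
    path once the points are interior; within one sector the only obstruction is a tie of the real
    parts of the cubes, and a tie is possible only in the sector [0 <= u], [0 <= v]. *)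
Lemma oblique_path (ua va p q : R) : 0 <= p -> 0 <= q -> 0 < p + q ->
  let A := oblique ua va in let B := oblique (ua - p) (va + q) in
  ~ (va = 0 /\ 0 <= ua <= p) -> ~ (ua - p = 0 /\ 0 <= va + q <= q) ->
  (p <= ua -> 0 <= va ->
     complex.Re (cpow A (3 / 2)) <> complex.Re (cpow B (3 / 2))) ->
  exists ra rb, [/\ ra ^+ 2 = A, rb ^+ 2 = B & monotone_path ra rb].
Proof.
move=> p0 q0 pq A B N1 N2 N3.
have k1 : sixth (1 : R) ^+ 3 = -1 by rewrite sixth_cube ?expr1n.
have k2 : sixth (-1 : R) ^+ 3 = -1 by rewrite sixth_cube ?sqrrN ?expr1n.
have ss : (-1 : R) ^+ 2 = 1 by rewrite sqrrN expr1n.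
have root0 (u v : R) : u <= 0 -> u <= v -> u < 0 \/ u < v ->
    exists2 t, hill t & t ^+ 2 = oblique u v.
  move=> h1 h2 h3; apply: oblique_root => //; apply/negP => /andP[/eqP a /eqP b].
  by case: h3; rewrite ?a ?b ltxx.
have root1 (u v : R) : 0 <= u -> 0 <= v -> 0 < u \/ 0 < v ->
    exists2 t, hill t & sixth 1 ^+ 2 * t ^+ 2 = oblique u v.
  move=> h1 h2 h3; have [||| t ht tE] := root0 (- v) (u - v); [lra|lra|by case: h3; [right|left]; lra|].
  by exists t; rewrite // tE -oblique_rot1.
have root2 (u v : R) : v <= 0 -> v <= u -> v < 0 \/ v < u ->
    exists2 t, hill t & t ^+ 2 = oblique (v - u) (- u).
  move=> h1 h2 h3; apply: root0; [lra|lra|].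
  by case: h3; [right|left]; lra.
have int1 (u v : R) (t : R[i]) : hill t -> sixth 1 ^+ 2 * t ^+ 2 = oblique u v -> 0 < u -> 0 < v -> hill_int t.
  move=> ht tE u0 v0; apply: (@oblique_hill_int _ (- v) (u - v)) => //; [|lra|lra].
  by apply: (mulfI (expf_neq0 2 (sixth_neq0 1))); rewrite -oblique_rot1.
have caseS0 : ua < 0 -> ua <= va ->
    exists ra rb, [/\ ra ^+ 2 = A, rb ^+ 2 = B & monotone_path ra rb].
  move=> u0 uv.
  have [ta hta taE] : exists2 t, hill t & t ^+ 2 = A by apply: root0; lra.
  have [tb htb tbE] : exists2 t, hill t & t ^+ 2 = B by apply: root0; lra.
  rewrite -taE -tbE.
  have [|| ra [rb [raE rbE P]]] := @same_sector_path R 1 ta tb _ hta htb.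
  - by left; rewrite expr1n.
  - have ub : ua - p < 0 by lra.
    by rewrite lt_eqF//; apply: oblique_cube_mono tbE ub; rewrite ?p0 ?q0 ?pq//; lra.
  by exists ra, rb; rewrite raE rbE !expr1n !mul1r.
have caseS2 : va < 0 -> va < ua ->
    exists ra rb, [/\ ra ^+ 2 = A, rb ^+ 2 = B & monotone_path ra rb].
  move=> v0 vu.
  have [ta hta taE] : exists2 t, hill t & t ^+ 2 = oblique (va - ua) (- ua).
    by apply: root2; lra.
  have tai : hill_int ta by apply: oblique_hill_int taE _ _ => //; lra.
  have AE : A = sixth (-1) ^+ 2 * ta ^+ 2 by rewrite taE -oblique_rot2.
  have same2 : va + q <= 0 -> va + q <= ua - p -> va + q < 0 \/ va + q < ua - p ->
      exists ra rb, [/\ ra ^+ 2 = A, rb ^+ 2 = B & monotone_path ra rb].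
    move=> h1 h2 h3; have [tb htb tbE] := root2 _ _ h1 h2 h3.
    have BE : B = sixth (-1) ^+ 2 * tb ^+ 2 by rewrite tbE -oblique_rot2.
    rewrite AE BE; apply: same_sector_path => //; first by right.
    (* Conjugation carries this sector to the first one, exchanging [p] with [q] and the start with
       the end; hence the cube decreases in real part from [ta] to [tb]. *)
    rewrite eq_sym lt_eqF// -(Re_conj_cube tb) -(Re_conj_cube ta).
    have cj (u v : R) (t : R[i]) : t ^+ 2 = oblique (v - u) (- u) -> t^* ^+ 2 = oblique v u.
      move=> E; rewrite (_ : t^* ^+ 2 = (t ^+ 2)^*); last by rewrite rmorphXn.
      rewrite E oblique_conj.
      by congr oblique; ring.
    apply: (@oblique_cube_mono _ (va + q) (ua - p) q p) => //; rewrite ?(addrC q)//.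
    - exact: hill_conj.
    - exact: hill_conj.
    - exact: cj.
    - by rewrite addrK subrK; exact: cj.
    - by rewrite addrK.
  have [ub0|ub0] := lt_or_le (ua - p) 0.
    have [uvb|uvb] := lt_or_le (ua - p) (va + q).
      have [tb htb tbE] : exists2 t, hill t & t ^+ 2 = B by apply: root0; lra.
      have tbi : hill_int tb by apply: oblique_hill_int tbE _ _ => //; lra.
      have [ra [rb [raE rbE P]]] := distinct_sector_path k2 (expr1n _ 2) tai tbi.
      exists ra, rb; split=> //; first by rewrite raE AE.
      by rewrite rbE -exprMn (mulrC (sixth (-1))) sixthN1 expr1n mul1r tbE.
    by apply: same2; [lra|lra|left; lra].
  have [vb0|vb0] := le_or_lt (va + q) 0.
    have vub : va + q < ua - p \/ va + q < 0.
      have [|vb1] := lt_or_le (va + q) 0; first by right.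
      have [|ub1] := lt_or_le 0 (ua - p); first by left; lra.
      by exfalso; apply: N2; split; [lra|apply/andP; split; lra].
    apply: same2 => //; first by lra.
    by case: vub; [right|left]; lra.
  have ub1 : 0 < ua - p.
    rewrite lt_neqAle ub0 andbT eq_sym; apply/eqP => E; apply: N2; split=> //.
    by apply/andP; split; lra.
  have [|| tb htb tbE] := root1 (ua - p) (va + q) _ _ (or_introl ub1); [lra|lra|].
  have tbi := int1 _ _ _ htb tbE ub1 vb0.
  have [ra [rb [raE rbE P]]] := distinct_sector_path k2 ss tai tbi.
  exists ra, rb; split=> //; first by rewrite raE AE.
  rewrite rbE /B -tbE; congr (_ * _).
  have := sixthN1; set e := sixth 1; set e' := sixth (-1) => ee.
  have e'6 : e' ^+ 6 = 1 by rewrite (exprM _ 3 2) k2 sqrrN expr1n.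
  transitivity (e ^+ 2 * e' ^+ 6); last by rewrite e'6 mulr1.
  transitivity ((e * e') ^+ 2 * e' ^+ 4); last by ring.
  by rewrite ee expr1n mul1r; ring.
have [ua0|ua0] := le_or_lt 0 ua; have [va0|va0] := le_or_lt 0 va.
- have a1 : 0 < ua \/ 0 < va.
    have [|ua1] := lt_or_le 0 ua; first by left.
    have [|va1] := lt_or_le 0 va; first by right.
    by exfalso; apply: N1; split; [lra|apply/andP; split; lra].
  have [ta hta taE] := root1 ua va ua0 va0 a1.
  have [ub0|ub0] := le_or_lt 0 (ua - p).
    have b1 : 0 < ua - p \/ 0 < va + q.
      have [|ub1] := lt_or_le 0 (ua - p); first by left.
      have [|vb1] := lt_or_le 0 (va + q); first by right.
      by exfalso; apply: N2; split; [lra|apply/andP; split; lra].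
    have [|| tb htb tbE] := root1 (ua - p) (va + q) _ _ b1; [lra|lra|].
    rewrite /A /B -taE -tbE; apply: same_sector_path => //; first by right.
    (* The root [sixth 1 * t] has argument between [pi / 6] and [pi / 2], so it is the principal
       one. *)
    have cE (t : R[i]) : hill t -> cpow (sixth 1 ^+ 2 * t ^+ 2) (3 / 2) = - t ^+ 3.
      move=> [t0 t1]; rewrite (@cpow_three_half _ _ (sixth 1 * t)).
      - by rewrite exprMn sixth_cube ?expr1n// mulN1r.
      - by rewrite exprMn.
      have h := @sqrt3_sqr R; have h0 := @sqrt3_gt0 R.
      have : s3 * `|complex.Im t| <= complex.Re t.
        rewrite -(@ler_pXn2r _ 2) ?nnegrE ?mulr_ge0 ?(ltW t0) ?(ltW h0)//.
        by rewrite exprMn h real_normK ?num_real.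
      rewrite -ler_pdivlMl// ler_norml => /andP[i1 i2].
      have e1 : s3 * (s3^-1 * complex.Re t) = complex.Re t by rewrite mulVKf ?gt_eqF.
      have e2 : s3 * complex.Im t <= complex.Re t by rewrite -e1 ler_pM2l.
      have e3 : s3^-1 * complex.Re t * 3 = s3 * complex.Re t.
        by rewrite -[X in _ * X = _]h; field; rewrite gt_eqF.
      have e4 : 0 < s3 * complex.Re t by rewrite mulr_gt0.
      rewrite ReM ImM /=.
      have [r0|r0] := lt_or_le 0 (1 / 2 * complex.Re t - 1 * s3 / 2 * complex.Im t).
        by left.
      right; split; first by lra.
      by lra.
    apply/eqP => E; apply: N3; [lra|lra|].
    by rewrite /A /B -taE -tbE !cE// !ReN E.
  have [tb htb tbE] : exists2 t, hill t & t ^+ 2 = B by apply: root0; lra.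
  have tbi : hill_int tb by apply: oblique_hill_int tbE _ _ => //; lra.
  (* If [ua = 0], then [A] is on the wall and belongs to the first sector as well, which contains
     [B]. *)
  have [ua1|ua1] := lt_or_le 0 ua; last first.
    have [ta' hta' ta'E] : exists2 t, hill t & t ^+ 2 = A by apply: root0; lra.
    rewrite -ta'E -tbE.
    have [|| ra [rb [raE rbE P]]] := @same_sector_path R 1 ta' tb _ hta' htb.
    - by left; rewrite expr1n.
    - have ub : ua - p < 0 by lra.
      by rewrite lt_eqF//; apply: oblique_cube_mono tbE ub; rewrite ?p0 ?q0 ?pq//; lra.
    by exists ra, rb; rewrite raE rbE !expr1n !mul1r.
  have [va1|va1] := lt_or_le 0 va; last first.
    by exfalso; apply: N1; split; [lra|apply/andP; split; lra].
  have [ra [rb [raE rbE P]]] := distinct_sector_path k1 ss (int1 _ _ _ hta taE ua1 va1) tbi.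
  exists ra, rb; split=> //; first by rewrite raE taE.
  by rewrite rbE -exprMn sixthN1 expr1n mul1r tbE.
- by apply: caseS2; lra.
- by apply: caseS0; lra.
- by have [uv|uv] := le_or_lt ua va; [apply: caseS0|apply: caseS2].
Qed.

End PathsOffY.

(** * Reduction of a general pair of end points to the normal form *)

Section YsetPaths.
Context {R : realType}.
Local Notation s3 := (Num.sqrt 3 : R).

Lemma cis0 : cis (0 : R) = 1.
Proof. by rewrite /cis cos0 sin0. Qed.

Lemma cisNK (x : R) : cis (- x) * cis x = 1.
Proof. by rewrite -cisD addNr cis0. Qed.

Lemma cis_neq0 (x : R) : cis x != 0.
Proof. by apply/eqP => E; have := cisNK x; rewrite E mulr0 => /eqP; rewrite eq_sym oner_eq0. Qed.

Lemma cos_pi3 : cos (pi / 3 : R) = 1 / 2.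
Proof.
have pi0 := pi_gt0 R; set x : R := pi / 3.
have c0 : 0 < cos x by apply: cos_gt0_pihalf; rewrite /x; apply/andP; split; lra.
have : cos (x + (x + x)) = -1 by rewrite -cospi; congr cos; rewrite /x; field.
rewrite !(cosD, sinD) => h.
have {}h : cos x * (cos x ^+ 2 - sin x ^+ 2) - 2 * cos x * sin x ^+ 2 = -1 by lra.
rewrite sin2cos2 in h.
(* The triple angle formula at [cos (3 x) = -1], factored. *)
have /eqP : (cos x + 1) * (2 * cos x - 1) ^+ 2 = 0 by lra.
rewrite mulf_eq0 sqrf_eq0 => /orP[/eqP|/eqP]; lra.
Qed.

Lemma sin_pi3 : sin (pi / 3 : R) = s3 / 2.
Proof.
have pi0 := pi_gt0 R.
have s0 : 0 < sin (pi / 3 : R) by apply: sin_gt0_pi; apply/andP; split; lra.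
have h3 : 0 <= s3 / 2 by rewrite divr_ge0// sqrtr_ge0.
apply/eqP; rewrite -(@eqrXn2 _ 2 _ _ _ (ltW s0) h3)//.
by rewrite sin2cos2 cos_pi3 !exprMn sqrt3_sqr; apply/eqP; field.
Qed.

Lemma cis_two_thirds (s : R) : s = 1 \/ s = -1 ->
  cis (2 * - s * pi / 3) = - sixth s.
Proof.
move=> s1.
have -> : (2 * - s * pi / 3 : R) = s * (pi / 3 - pi) by field.
have c : cos (s * (pi / 3 - pi)) = - (1 / 2).
  have -> : cos (s * (pi / 3 - pi)) = cos (pi / 3 - pi : R).
    by case: s1 => ->; rewrite ?mul1r ?mulN1r ?cosN.
  by rewrite cosB cospi sinpi mulr0 addr0 cos_pi3 mulrN1.
have si : sin (s * (pi / 3 - pi)) = - (s * s3 / 2).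
  have -> : sin (s * (pi / 3 - pi)) = s * sin (pi / 3 - pi : R).
    by case: s1 => ->; rewrite ?mul1r ?mulN1r ?sinN.
  by rewrite sinB cospi sinpi mulr0 subr0 sin_pi3; ring.
by rewrite /cis c si /sixth; apply: eqC => /=.
Qed.

(** Conjugation negates the argument, except on the negative half-line where it stays [pi]; the
    cosine is the same in both cases. *)
Lemma Re_cpow_conj (w : R[i]) (a : R) :
  complex.Re (cpow w^* a) = complex.Re (cpow w a).
Proof.
have cE : cmod w^* = cmod w by rewrite /cmod normcJ.
rewrite /cpow !ReMl /= cE; congr (_ * _).
rewrite /carg cE; case: w {cE} => x y /=.
by case: ifP => _; case: ifP => _; rewrite ?mulrN ?cosN.
Qed.

Lemma sector_polar (s U v : R) : s = 1 \/ s = -1 -> 0 <= U -> 0 <= v ->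
  exists r p : R, [/\ 0 <= r, 0 <= p <= 2 * pi / 3 &
    U%:C - v%:C * sixth s = r%:C * cis (- s * p)].
Proof.
move=> s1 U0 v0; have h := @sqrt3_sqr R; have h0 := @sqrt3_gt0 R.
have pi0 := pi_gt0 R.
pose X := U - v / 2; pose Y := v * s3 / 2; pose r := Num.sqrt (X ^+ 2 + Y ^+ 2).
have Y0 : 0 <= Y by rewrite /Y divr_ge0// mulr_ge0// ltW.
have wE : U%:C - v%:C * sixth s = X +i* (- s * Y).
  by apply: eqC; rewrite /X /Y /=; field.
have r0 : 0 <= r by rewrite sqrtr_ge0.
have r2 : r ^+ 2 = X ^+ 2 + Y ^+ 2 by rewrite sqr_sqrtr// addr_ge0 ?sqr_ge0.
have [rE|rn0] := eqVneq r 0.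
  exists 0, 0; split=> //; first by rewrite lexx divr_ge0 ?mulr_ge0 ?(ltW pi0).
  rewrite mul0r wE; move: r2; rewrite rE expr0n /= => /esym/eqP.
  by rewrite paddr_eq0 ?sqr_ge0// !sqrf_eq0 => /andP[/eqP-> /eqP->]; rewrite mulr0.
have rp : 0 < r by rewrite lt_neqAle eq_sym rn0.
have Xr : `|X| <= r by rewrite -sqrtr_sqr ler_wsqrtr// lerDl sqr_ge0.
have XB : -1 <= X / r <= 1.
  by rewrite ler_pdivlMr// ler_pdivrMr// mul1r mulN1r -ler_norml.
exists r, (acos (X / r)); split=> //; last first.
  have cosE : r * cos (acos (X / r)) = X.
    by rewrite acosK ?in_itv//= mulrC divfK ?gt_eqF.
  have sinE : r * sin (acos (X / r)) = Y.
    have rE : r = Num.sqrt (r ^+ 2) by rewrite sqrtr_sqr gtr0_norm.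
    rewrite sin_acos// {1}rE -sqrtrM ?sqr_ge0// mulrBr mulr1 -exprMn.
    rewrite [r * _]mulrC divfK ?gt_eqF// r2 addrC addKr.
    by rewrite sqrtr_sqr ger0_norm.
  have -> : cis (- s * acos (X / r)) = cos (acos (X / r)) +i* (- s * sin (acos (X / r))).
    by rewrite /cis; case: s1 => ->; rewrite ?opprK ?mulN1r ?mul1r ?cosN ?sinN.
  rewrite wE; apply: eqC => /=; rewrite mul0r ?subr0 ?addr0 ?cosE//.
  by rewrite [RHS]mulrCA sinE.
have a0 := acos_ge0 XB; rewrite a0 /=.
have c3 : cos (2 * pi / 3 : R) = - (1 / 2).
  rewrite (_ : 2 * pi / 3 = pi - pi / 3); last by field.
  by rewrite cosB cospi sinpi mul0r addr0 cos_pi3 mulN1r.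
(* A larger angle means [X / r < - 1 / 2], that is [r < v - 2 U]. Squaring gives [U (U - v) > 0],
   although [v > 2 U >= 0]. *)
rewrite leNgt; apply/negP => lt.
have : cos (acos (X / r)) < cos (2 * pi / 3 : R).
  rewrite ltr_cos// in_itv /=; last by rewrite a0 acos_lepi.
  by apply/andP; split; lra.
rewrite acosK ?in_itv//= c3 ltr_pdivrMr// => {}lt.
have {}lt : r < v - 2 * U by move: lt; rewrite /X; lra.
have h1 : r ^+ 2 < (v - 2 * U) ^+ 2 by rewrite ltrXn2r ?nnegrE//; lra.
have h2 : r ^+ 2 = U ^+ 2 - U * v + v ^+ 2.
  rewrite r2 /X /Y; transitivity (U ^+ 2 - U * v + v ^+ 2 / 4 + v ^+ 2 * s3 ^+ 2 / 4).
    by field.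
  by rewrite h; field.
have h3 : 0 < U * (U - v) by rewrite h2 in h1; lra.
by have : U * (U - v) <= 0 by [apply: mulr_ge0_le0; lra]; lra.
Qed.

(* Reflection in the real axis when [b] is false: it reduces the case
   [carg (beta - alpha) < 0] to the other one. *)
Definition reflect_if (b : bool) (w : R[i]) : R[i] := if b then w else w^*.

Lemma reflect_ifK b : involutive (reflect_if b).
Proof. by case: b => w //=; rewrite /reflect_if conjcK. Qed.

Lemma reflect_ifM b w z : reflect_if b (w * z) = reflect_if b w * reflect_if b z.
Proof. by case: b => //=; rewrite /reflect_if rmorphM. Qed.

Lemma reflect_ifD b w z : reflect_if b (w + z) = reflect_if b w + reflect_if b z.
Proof. by case: b => //=; rewrite /reflect_if rmorphD. Qed.

Lemma reflect_ifX b w n : reflect_if b (w ^+ n) = reflect_if b w ^+ n.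
Proof. by case: b => //=; rewrite /reflect_if rmorphXn. Qed.

Lemma reflect_ifV b w : reflect_if b w^-1 = (reflect_if b w)^-1.
Proof. by case: b => //=; rewrite /reflect_if; exact: conjc_inv. Qed.

Lemma reflect_if_real b (x : R) : reflect_if b x%:C = x%:C.
Proof. by case: b => //; rewrite /reflect_if conjc_real. Qed.

Lemma Re_reflect_if b w : complex.Re (reflect_if b w) = complex.Re w.
Proof. by case: b => //=; case: w. Qed.

Lemma reflect_if_eq0 b w : (reflect_if b w == 0) = (w == 0).
Proof. by case: b => //=; rewrite /reflect_if conjc_eq0. Qed.

Lemma sector3_reflect_if b w : sector3 w -> sector3 (reflect_if b w).
Proof. by case: b => //=; case: w => x y; rewrite /sector3 /= sqrrN. Qed.

(** A rotation by [- T] and, for negative [theta], a reflection bring [beta - alpha] to an argument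
    between 0 and [pi / 3], where [oblique_path] applies. The path found is carried back by a map
    under which the action is a positive multiple of the cube, up to conjugation, so the sign of its
    increments is kept. *)
Lemma Yset_path (al be z m : R[i]) (t : R) : al != be -> 0 < t ->
  m = t%:C * (be - al) -> ~ Yset al be z ->
  exists a b, [/\ a ^+ 2 = al - z, b ^+ 2 = be - z & good_path m a b].
Proof.
move=> albe t0 mE nY.
have h := @sqrt3_sqr R; have h0 := @sqrt3_gt0 R; have pi0 := pi_gt0 R.
have ba0 : be - al != 0 by rewrite subr_eq0 eq_sym.
have [/andP[th1 th2] baE] := cargP ba0.
move: nY; rewrite /Yset; set th := carg (be - al) in th1 th2 baE *.
set c := cmod (be - al) in baE; have c0 : 0 < c by rewrite cmod_gt0.
pose b0 := 0 <= th; pose s : R := if b0 then 1 else -1.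
have -> : (if 0 <= th then -1 else 1 : R) = - s.
  by rewrite /s /b0; case: ifP => _; rewrite ?opprK.
have s1 : s = 1 \/ s = -1 by rewrite /s; case: (b0); [left|right].
set T := 2 * th / 3.
pose cj := reflect_if b0.
have cj6 : cj (sixth 1) = sixth s.
  by rewrite /cj /s; case: (b0) => //=; apply: eqC => //=; ring.
(* The argument of [beta - alpha] after rotation and reflection, [|theta| / 3]. *)
pose psi := s * th / 3.
have psi0 : 0 <= psi <= pi / 3.
  rewrite /psi /s /b0; have [th0|th0] := leP 0 th; apply/andP; split; lra.
have cj_cis : cj (cis (th / 3)) = cis psi.
  rewrite /cj /psi /s; case: (b0) => /=; first by rewrite mul1r.
  by rewrite /cis; apply: eqC => /=; rewrite mulN1r mulNr ?cosN ?sinN.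
(* Coordinates of [c cis psi] in the basis 1, [sixth 1]; they are nonnegative because
   [0 <= psi <= pi / 3]. *)
pose p := c * (cos psi - sin psi / s3); pose q := 2 * c * sin psi / s3.
have cpsi : 0 < cos psi.
  by apply: cos_gt0_pihalf; case/andP: psi0 => *; apply/andP; split; lra.
have spsi : 0 <= sin psi.
  by apply: sin_ge0_pi; case/andP: psi0 => *; apply/andP; split; lra.
have p0 : 0 <= p.
  rewrite /p mulr_ge0 ?(ltW c0)// subr_ge0 ler_pdivrMr//.
  have : 0 <= sin (pi / 3 - psi).
    by apply: sin_ge0_pi; case/andP: psi0 => *; apply/andP; split; lra.
  by rewrite sinB sin_pi3 cos_pi3; lra.
have q0 : 0 <= q by rewrite /q divr_ge0 ?(ltW h0)// mulr_ge0// mulr_ge0// ltW.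
have pq : 0 < p + q.
  have -> : p + q = c * cos psi + c * sin psi / s3 by rewrite /p /q; ring.
  by rewrite ltr_pwDl ?mulr_gt0// divr_ge0 ?(ltW h0)// mulr_ge0// ltW.
have pqE : p%:C + q%:C * sixth 1 = c%:C * cis psi.
  apply: eqC; rewrite /p /q /=; field; first by rewrite gt_eqF.
  by rewrite gt_eqF.
pose A := cj (cis (- T) * (al - z)).
pose va := 2 * complex.Im A / s3; pose ua := va / 2 - complex.Re A.
have AE : A = oblique ua va.
  by apply: eqC; rewrite /ua /va /=; field; rewrite gt_eqF.
have BE : cj (cis (- T) * (be - z)) = oblique (ua - p) (va + q).
  rewrite obliqueD -AE -addrA pqE /A.
  rewrite (_ : be - z = (al - z) + (be - al)); last by ring.
  rewrite mulrDr /cj reflect_ifD; congr (_ + _).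
  rewrite baE mulrCA reflect_ifM reflect_if_real -/cj; congr (_ * _).
  by rewrite -cisD -cj_cis; congr (cj (cis _)); rewrite /T; field.
clearbody va ua.
have cjI w v : cj w = v -> w = cj v by move=> <-; rewrite /cj reflect_ifK.
have alE : al - z = cis T * cj (oblique ua va).
  by rewrite -AE /A /cj reflect_ifK mulrA [cis T * _]mulrC cisNK mul1r.
have beE : be - z = cis T * cj (oblique (ua - p) (va + q)).
  by rewrite -BE /cj reflect_ifK mulrA [cis T * _]mulrC cisNK mul1r.
(* This is the apex of [Y]: [p] and [q] are its distances to [al] and [be] along the two rays. *)
pose G := al + p%:C * cis T.
have beG : be = G + q%:C * (cis T * sixth s).
  apply/eqP; rewrite -subr_eq0; apply/eqP.
  transitivity ((be - z) - (al - z) - p%:C * cis T - q%:C * (cis T * sixth s)).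
    by rewrite /G; ring.
  rewrite alE beE obliqueD /cj !reflect_ifD reflect_ifM !reflect_if_real -/cj cj6.
  by ring.
have G1 : ray al T G by exists p.
have c6 : cis (T + 2 * - s * pi / 3) = - (cis T * sixth s).
  by rewrite cisD cis_two_thirds// mulrN.
have G2 : ray be (T + 2 * - s * pi / 3) G.
  by exists q => //; rewrite c6 beG; ring.
move=> nY.
have {}nY : ~ ((segment al G `|` segment be G `|`
     (sector G T (- s) (2 * pi / 3) `&`
      [set z | complex.Re (cpow (cis (- T) * (al - z)) (3 / 2)) =
               complex.Re (cpow (cis (- T) * (be - z)) (3 / 2))])) z).
  by move=> H; apply: nY; exists G.
have N1 : ~ (va = 0 /\ 0 <= ua <= p).
  move=> [va0 /andP[ua0 uap]]; apply: nY; left; left.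
  have zE : z = al + ua%:C * cis T.
    have : oblique ua va = (- ua)%:C by rewrite va0; apply: eqC => /=; ring.
    by move=> E; move: alE; rewrite E /cj reflect_if_real rmorphN => /eqP;
      rewrite subr_eq => /eqP ->; ring.
  (* For [p = 0], that is [theta = pi], the apex is [al] and the segment reduces to a point. *)
  have [p00|pn0] := eqVneq p 0.
    have ua00 : ua = 0 by lra.
    exists 0; first by rewrite /= lexx ler01.
    by rewrite subr0 mul0r mul1r addr0 zE ua00 mul0r addr0.
  have pp : 0 < p by rewrite lt_neqAle eq_sym pn0.
  exists (ua / p); first by rewrite /= divr_ge0//= ler_pdivrMr// mul1r.
  rewrite zE /G rmorphB rmorph1.
  have -> : ua%:C = (ua / p)%:C * p%:C by rewrite -rmorphM /= divfK.
  by ring.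
have N2 : ~ (ua - p = 0 /\ 0 <= va + q <= q).
  move=> [ua0 /andP[va0 vaq]]; apply: nY; left; right.
  have zE : z = be - (va + q)%:C * (cis T * sixth s).
    have : oblique (ua - p) (va + q) = (va + q)%:C * sixth 1.
      by rewrite ua0; apply: eqC => /=; field.
    move=> E; move: beE; rewrite E /cj reflect_ifM reflect_if_real -/cj cj6 => /eqP.
    by rewrite subr_eq => /eqP ->; ring.
  have [q00|qn0] := eqVneq q 0.
    have va00 : va + q = 0 by lra.
    exists 0; first by rewrite /= lexx ler01.
    by rewrite subr0 mul0r mul1r addr0 zE va00 mul0r subr0.
  have qp : 0 < q by rewrite lt_neqAle eq_sym qn0.
  exists ((va + q) / q); first by rewrite /= divr_ge0//= ler_pdivrMr// mul1r.
  rewrite zE rmorphB rmorph1 beG.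
  have -> : (va + q)%:C = ((va + q) / q)%:C * q%:C by rewrite -rmorphM /= divfK.
  by ring.
have N3 : p <= ua -> 0 <= va -> complex.Re (cpow (oblique ua va) (3 / 2)) <>
    complex.Re (cpow (oblique (ua - p) (va + q)) (3 / 2)).
  move=> pu va0 E; apply: nY; right; split.
    have U0 : 0 <= ua - p by rewrite subr_ge0.
    have [r [p' [r0 p'0 rE]]] := sector_polar s1 U0 va0.
    exists r, p'; split=> //.
    rewrite cisD mulrCA -rE -cj6.
    transitivity (al - (al - z)); first by ring.
    rewrite alE (_ : oblique ua va = (- ua)%:C + va%:C * sixth 1); last first.
      by apply: eqC => /=; field.
    rewrite /cj reflect_ifD reflect_ifM !reflect_if_real /G rmorphN rmorphB.
    by ring.
  have cpE w : complex.Re (cpow (cj w) (3 / 2)) = complex.Re (cpow w (3 / 2)).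
    by rewrite /cj /reflect_if; case: (b0) => //; exact: Re_cpow_conj.
  change (complex.Re (cpow (cis (- T) * (al - z)) (3 / 2)) =
          complex.Re (cpow (cis (- T) * (be - z)) (3 / 2))).
  by rewrite -cpE -/A AE E -BE cpE.
have [ra [rb [raE rbE P]]] := oblique_path p0 q0 pq N1 N2 N3.
(* Squaring turns the half rotation [cis (th / 3)] into the rotation [cis T] that undoes the
   normalisation. *)
pose k w := cis (th / 3) * cj w.
have kE w : k w ^+ 2 = cis T * cj (w ^+ 2).
  rewrite /k exprMn /cj reflect_ifX; congr (_ * _).
  by rewrite expr2 -cisD; congr cis; rewrite /T; field.
exists (k ra), (k rb); split.
- by rewrite kE raE.
- by rewrite kE rbE.
(* The factor [cis (th / 3) ^ 3] cancels the argument of [m]. *)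
have k3 w : action m (k w) = (2 / (3 * t * c))%:C * cj (w ^+ 3).
  have tc : t%:C != 0 :> R[i] by rewrite fmorph_eq0 gt_eqF.
  have cc : c%:C != 0 :> R[i] by rewrite fmorph_eq0 gt_eqF.
  have th3 : cis (th / 3) ^+ 3 = cis th.
    by rewrite !exprS expr0 mulr1 -!cisD; congr cis; field.
  rewrite /action mE baE /k exprMn th3 /cj reflect_ifX.
  have -> : (2 / (3 * t * c))%:C = 2 / (3 * t%:C * c%:C) :> R[i].
    by rewrite fmorph_div !rmorphM /= !rmorph_nat.
  by field; rewrite tc cc cis_neq0.
have seg r1 r2 : monotone_segment r1 r2 -> good_segment m (k r1) (k r2).
  move=> [r10 r12 re]; split.
  - by rewrite /k mulf_neq0 ?cis_neq0// reflect_if_eq0.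
  - rewrite (_ : k r2 / k r1 = cj (r2 / r1)); first exact: sector3_reflect_if.
    rewrite /k /cj reflect_ifM reflect_ifV; field.
    by rewrite reflect_if_eq0 r10 cis_neq0.
  - rewrite !k3 -mulrBr ReMl mulr_gt0//; first by rewrite divr_gt0 ?mulr_gt0.
    by rewrite ReD ReN !Re_reflect_if subr_gt0.
by case: P => [/seg|[rm /seg g1 /seg g2]]; [left|right; exists (k rm)].
Qed.

End YsetPaths.

(** * Primitives of integrable functions on [-1, 1] *)

Section Primitives.
Context {R : realType}.
Local Notation mu := (@lebesgue_measure R).
Local Notation D := (`[(-1 : R), 1]%classic).
Implicit Types (f g k : R -> R).

Definition integrable11 k : Prop := mu.-integrable D (EFin \o k).

Lemma ltN11 : (-1 : R) < 1. Proof. by lra. Qed.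

Lemma I11E : @I11 R = `]-1, 1[%classic.
Proof. by apply/seteqP; split => x; rewrite /I11 /= in_itv. Qed.

Lemma mD : measurable D. Proof. exact: measurable_itv. Qed.

Lemma mu_D_lty : (mu D < +oo)%E.
Proof.
have := lebesgue_measure_itv `[(-1 : R), 1]; rewrite /= => ->.
by case: ifP => _; rewrite -?EFinB ltry.
Qed.

Lemma measurable_I11_closed k : measurable_fun (@I11 R) k -> measurable_fun D k.
Proof. by rewrite I11E => /measurable_fun_itv_obnd_cbndP/measurable_fun_itv_bndo_bndcP. Qed.

Lemma RintegralI11 k : measurable_fun (@I11 R) k ->
  \int[mu]_(x in @I11 R) k x = \int[mu]_(x in D) k x.
Proof.
rewrite I11E => mk; rewrite /Rintegral (@integral_itv_bndoo _ (-1) 1 (EFin \o k) true false)//.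
exact/measurable_EFinP.
Qed.

Lemma integrable_I11_closed k : mu.-integrable (@I11 R) (EFin \o k) -> integrable11 k.
Proof.
move=> /integrableP[/measurable_EFinP mk fk]; apply/integrableP; split.
  by apply/measurable_EFinP; exact: measurable_I11_closed mk.
rewrite (@integral_itv_bndoo _ (-1) 1 (fun x => `|(k x)%:E|)%E true false) -?I11E//.
by apply: measurableT_comp => //; exact/measurable_EFinP.
Qed.

Lemma bounded_integrable11 k (B : R) : measurable_fun D k ->
  (forall x, D x -> `|k x| <= B) -> integrable11 k.
Proof.
move=> mk kB; apply: (@measurable_bounded_integrable _ _ _ mu k _ mD mu_D_lty mk).
exists B; split; first exact: num_real.
by move=> M BM x Dx /=; rewrite (le_trans (kB x Dx))// ltW.
Qed.

Lemma continuous_integrable11 k : {within D, continuous k} -> integrable11 k.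
Proof. by move=> ck; apply: continuous_compact_integrable => //; exact: segment_compact. Qed.

Lemma integrable11D k g : integrable11 k -> integrable11 g ->
  integrable11 (fun x => k x + g x).
Proof. by move=> ik ig; exact: (@integrableD _ _ _ mu D mD _ _ ik ig). Qed.

Lemma integrable11Z (c : R) k : integrable11 k -> integrable11 (fun x => c * k x).
Proof. by move=> ik; exact: (@integrableZl _ _ _ mu D mD c _ ik). Qed.

Lemma integrable11_sub (k : R -> R) (a b : R) : integrable11 k -> -1 <= a -> b <= 1 ->
  mu.-integrable `[a, b] (EFin \o k).
Proof.
move=> ik a1 b1; apply: integrableS ik => //.
by move=> x /=; rewrite !in_itv /= => /andP[ax xb]; rewrite (le_trans a1)// (le_trans xb).
Qed.

Definition primitive k (x : R) : R := parameterized_integral mu (-1) x k.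

Lemma primitiveN1 k : primitive k (-1) = 0.
Proof. by rewrite /primitive /parameterized_integral set_itv1 Rintegral_set1. Qed.

Lemma primitive_continuous k : integrable11 k -> {within D, continuous (primitive k)}.
Proof. by move=> ik; apply: parameterized_integral_continuous => //; exact: ltW ltN11. Qed.

Lemma primitive_derive k x : integrable11 k -> -1 < x < 1 -> {for x, continuous k} ->
  is_derive x 1 (primitive k) (k x).
Proof.
move=> ik /andP[x0 x1] ck.
have [dk kE] := continuous_FTC1_closed x1 ik x0 ck.
by apply: DeriveDef; [exact: dk | rewrite -derive1E; exact: kE].
Qed.

Lemma primitiveD k g x : integrable11 k -> integrable11 g -> D x ->
  primitive (fun t => k t + g t) x = primitive k x + primitive g x.
Proof.
rewrite /= in_itv /= => ik ig /andP[x0 x1].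
rewrite /primitive /parameterized_integral RintegralD//; exact: integrable11_sub.
Qed.

Lemma primitiveZ (c : R) k x : integrable11 k -> D x ->
  primitive (fun t => c * k t) x = c * primitive k x.
Proof.
rewrite /= in_itv /= => ik /andP[x0 x1].
rewrite /primitive /parameterized_integral RintegralZl//; exact: integrable11_sub.
Qed.

Lemma primitive_ae k g x : integrable11 k -> integrable11 g ->
  (k = g %[ae mu in @I11 R]) -> D x -> primitive k x = primitive g x.
Proof.
rewrite /= in_itv /= => ik ig kg /andP[x0 x1].
have [ik' ig'] : mu.-integrable `[-1, x] (EFin \o k) /\
    mu.-integrable `[-1, x] (EFin \o g).
  by split; apply: integrable11_sub.
rewrite /primitive /parameterized_integral /Rintegral.
have h (u : R -> R) : mu.-integrable `[-1, x] (EFin \o u) ->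
    (\int[mu]_(t in `[(-1)%R, x]) (u t)%:E = \int[mu]_(t in `](-1)%R, x[) (u t)%:E)%E.
  move=> /integrableP[mu' _]; apply: (@integral_itv_bndoo _ (-1) x (EFin \o u) true false).
  by apply: measurable_funS mu' => //; exact: subset_itv_oo_cc.
rewrite !h//; congr fine; apply: ae_eq_integral => //.
- by case/integrableP: ik' => m1 _; apply: measurable_funS m1 => //; exact: subset_itv_oo_cc.
- by case/integrableP: ig' => m1 _; apply: measurable_funS m1 => //; exact: subset_itv_oo_cc.
- move: kg; apply: filterS; first exact: (ae_filter_ringOfSetsType mu).
  move=> t /= H tx; congr EFin; apply: H.
  by move: tx; rewrite in_itv /= /I11 /= => /andP[-> /lt_le_trans ->].
Qed.

Lemma primitive_le k x : integrable11 k -> D x ->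
  `|primitive k x| <= \int[mu]_(t in D) `|k t|.
Proof.
move=> ik Dx; have := Dx; rewrite /= in_itv /= => /andP[x0 x1].
have ikx : mu.-integrable `[-1, x] (EFin \o k) by exact: integrable11_sub.
rewrite (le_trans (le_normr_Rintegral _ ikx))//.
rewrite /Rintegral fine_le//.
- apply: integrable_fin_num => //; exact: integrable_norm.
- exact: (@integrable_fin_num _ _ _ mu D mD _ (integrable_norm ik)).
- apply: ge0_subset_integral => //.
    by case/integrableP: ik => /measurable_EFinP mk _; apply/measurable_EFinP/measurableT_comp.
  by move=> t /=; rewrite !in_itv /= => /andP[-> /le_trans ->].
Qed.

(** Induction on the exceptional points: the interval is cut at a point of [E] lying inside it, and
    continuity joins the two halves. *)
Lemma constant_off_finite (E : seq R) (f : R -> R) (a b : R) : a <= b ->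
  {within `[a, b], continuous f} ->
  (forall x, a < x < b -> x \notin E -> is_derive x 1 f 0) -> f a = f b.
Proof.
elim: E a b => [|e E IH] a b.
  rewrite le_eqVlt => /orP[/eqP->//|ab] cf df.
  have [|c _] := MVT ab _ cf (df := fun=> 0).
    by move=> x; rewrite in_itv /= => xab; apply: df.
  by rewrite mul0r => /eqP; rewrite subr_eq0 => /eqP.
move=> ab cf df.
have [/andP[ae eb]|eab] := boolP (a < e < b).
  have sub (c d : R) : a <= c -> d <= b -> {within `[c, d], continuous f}.
    move=> ac db; apply: continuous_subspaceW cf => t /=; rewrite !in_itv /=.
    by move=> /andP[ct td]; rewrite (le_trans ac)// (le_trans td).
  transitivity (f e); apply: IH; rewrite ?(ltW ae) ?(ltW eb)//.
  - by apply: sub => //; exact: ltW.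
  - move=> x /andP[ax xe] xE; apply: df; rewrite ?ax ?(lt_trans xe)//.
    by rewrite inE negb_or xE andbT lt_eqF.
  - by apply: sub => //; exact: ltW.
  - move=> x /andP[ex xb] xE; apply: df; rewrite ?xb ?(lt_trans ae)//.
    by rewrite inE negb_or xE andbT gt_eqF.
apply: IH => // x xab xE; apply: df => //.
by rewrite inE negb_or xE andbT; apply: contraNneq eab => <-.
Qed.

Lemma constant_off_finite11 (E : seq R) (f : R -> R) :
  {within D, continuous f} ->
  (forall x, -1 < x < 1 -> x \notin E -> is_derive x 1 f 0) ->
  forall x, D x -> f x = f (-1).
Proof.
move=> cf df x /=; rewrite in_itv /= => /andP[x0 x1]; apply/esym.
apply: (@constant_off_finite E) => //.
  apply: continuous_subspaceW cf => t /=; rewrite !in_itv /=.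
  by move=> /andP[-> /le_trans ->].
by move=> t /andP[t0 t1]; apply: df; rewrite t0 (lt_le_trans t1).
Qed.

End Primitives.

(** * Bump functions and distributional derivatives *)

Section SmoothFunctions.
Context {R : realType}.
Implicit Types (f g : R -> R) (x : R).

(** A whole sequence of successive derivatives is given as data, so that closure properties are
    proved without handling iterated derivatives. *)
Definition smooth f : Prop := exists F : nat -> R -> R,
  F 0%N = f /\ forall k x, is_derive x (1 : R) (F k) (F k.+1 x).

(** Serves classes such as sums of products or the functions [flat p], whose derivatives stay in the
    class but have no convenient closed formula at order [k]. *)
Lemma smooth_class (P : (R -> R) -> Prop) :
  (forall f, P f -> exists2 f', P f' & forall x, is_derive x (1 : R) f (f' x)) ->
  forall f, P f -> smooth f.
Proof.
move=> H f Pf.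
pose next (u : {f | P f}) : {f | P f} :=
  let: exist2 f' Pf' _ := cid2 (H (sval u) (svalP u)) in exist _ f' Pf'.
exists (fun k => sval (iter k next (exist _ f Pf))); split=> // k x /=.
by rewrite /next; case: (cid2 _).
Qed.

Lemma smooth_derive1n f (F : nat -> R -> R) : F 0%N = f ->
  (forall k x, is_derive x (1 : R) (F k) (F k.+1 x)) -> forall k, derive1n k f = F k.
Proof.
move=> F0 dF; elim=> [//|k IH]; rewrite derive1nS IH.
by apply/funext => x; rewrite derive1E; exact: derive_val.
Qed.

Lemma smoothP f : smooth f -> forall k x, derivable (derive1n k f) x 1.
Proof.
move=> [F [F0 dF]] k x; rewrite (smooth_derive1n F0 dF).
exact: ex_derive.
Qed.

Lemma is_derive_ext f g x (d d' : R) : is_derive x (1 : R) f d -> f =1 g -> d = d' ->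
  is_derive x 1 g d'.
Proof. by move=> df /funext <- <-. Qed.

Lemma is_derive_affine (f : R -> R) (s c x d : R) : is_derive (s * x + c) (1 : R) f d ->
  is_derive x (1 : R) (fun y => f (s * y + c)) (s * d).
Proof.
move=> df.
have d1 : is_derive x (1 : R) (fun y : R => s * y + c) (s *: 1 + 0).
  exact: is_deriveD (is_deriveZ s (is_derive_id x 1)) (is_derive_cst c x 1).
apply: (is_derive_ext (@is_derive1_comp _ f (fun y => s * y + c) x _ _ df d1)) => //.
by rewrite /GRing.scale /= mulr1 addr0 mulrC.
Qed.

Lemma smooth_affine f (s c : R) : smooth f -> smooth (fun x => f (s * x + c)).
Proof.
move=> [F [F0 dF]]; exists (fun k x => s ^+ k * F k (s * x + c)); split.
  by apply/funext => x; rewrite expr0 mul1r F0.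
move=> k x; rewrite exprSr -mulrA.
exact: is_derive_ext (is_deriveZ (s ^+ k) (is_derive_affine (dF k _))) _ _.
Qed.

Lemma smoothB f g : smooth f -> smooth g -> smooth (fun x => f x - g x).
Proof.
move=> [F [F0 dF]] [G [G0 dG]]; exists (fun k x => F k x - G k x); split.
  by rewrite F0 G0.
by move=> k x; exact: is_deriveB (dF k x) (dG k x).
Qed.

Lemma smoothM f g : smooth f -> smooth g -> smooth (fun x => f x * g x).
Proof.
move=> [F [F0 dF]] [G [G0 dG]].
apply: (@smooth_class (fun u => exists l : seq (nat * nat),
  u = fun x => \sum_(p <- l) F p.1 x * G p.2 x)); last first.
  by exists [:: (0%N, 0%N)]; apply/funext => x; rewrite big_seq1 /= F0 G0.
move=> u [l ->].
exists (fun x => \sum_(p <- l) (F p.1 x * G p.2.+1 x + G p.2 x * F p.1.+1 x)).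
  exists (flatten [seq [:: (p.1, p.2.+1); (p.1.+1, p.2)] | p <- l]).
  apply/funext => x; elim: l => [|p l IH]; first by rewrite !big_nil.
  by rewrite /= !big_cons /= IH; ring.
move=> x; elim: l => [|p l IH].
  rewrite big_nil; under eq_fun do rewrite big_nil.
  exact: is_derive_cst.
rewrite big_cons; under eq_fun do rewrite big_cons.
exact: is_deriveD (is_deriveM (dF _ _) (dG _ _)) IH.
Qed.

Lemma smooth_primitive f g : (forall x, is_derive x (1 : R) g (f x)) -> smooth f -> smooth g.
Proof.
move=> dg [F [F0 dF]]; exists (fun k => if k is k'.+1 then F k' else g).
by split=> // -[|k] x //; rewrite F0.
Qed.

(** For [p = 1] this is the classical [exp (- 1 / x)]; the polynomial factor in [1 / x] closes the
    family under differentiation. *)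
Definition flat (p : {poly R}) (x : R) : R :=
  if 0 < x then p.[x^-1] * expR (- x^-1) else 0.

Lemma pow_le_expR (y : R) (k : nat) : 0 <= y -> y ^+ k <= k%:R ^+ k * expR y.
Proof.
case: k => [|k] y0; first by rewrite !expr0 mul1r; have := expR_ge1Dx y; lra.
have h : (y / k.+1%:R) ^+ k.+1 <= expR y.
  have yE : y = k.+1%:R * (y / k.+1%:R) by rewrite mulrC divfK ?pnatr_eq0.
  rewrite [in leRHS]yE expRM_natl lerXn2r ?nnegrE ?expR_ge0 ?divr_ge0//.
  by apply: le_trans (expR_ge1Dx _); rewrite lerDr.
have k0 : 0 < (k.+1%:R : R) ^+ k.+1 by rewrite exprn_gt0.
have := ler_wpM2l (ltW k0) h.
by rewrite -exprMn [k.+1%:R * _]mulrC divfK ?pnatr_eq0.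
Qed.

Lemma poly_le_expR (p : {poly R}) (k : nat) : exists2 C : R, 0 <= C & forall y, 0 <= y ->
  `|p.[y]| * y ^+ k <= C * expR y.
Proof.
elim/poly_ind: p k => [|p c IH] k.
  by exists 0 => // y y0; rewrite horner0 normr0 !mul0r.
have [C C0 h] := IH k.+1.
exists (C + `|c| * k%:R ^+ k); first by rewrite addr_ge0 ?mulr_ge0 ?exprn_ge0.
move=> y y0; rewrite hornerMXaddC.
have yk : 0 <= y ^+ k by rewrite exprn_ge0.
have h1 := h y y0; have h2 := ler_wpM2l (normr_ge0 c) (pow_le_expR k y0).
have := ler_wpM2r yk (ler_normD (p.[y] * y) c).
rewrite normrM (ger0_norm y0) => h3.
rewrite (le_trans h3)// [leLHS]mulrDl -mulrA -exprS [leRHS]mulrDl -mulrA.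
exact: lerD.
Qed.

(** A quadratic bound is what gives derivative 0 at the origin in [flat_derive]. *)
Lemma flat_le_sqr (p : {poly R}) : exists2 C : R, 0 <= C & forall x, `|flat p x| <= C * x ^+ 2.
Proof.
have [C C0 h] := poly_le_expR p 2.
exists C => // x; rewrite /flat; case: ltP => x0; last by rewrite normr0 mulr_ge0// sqr_ge0.
have xi : 0 <= x^-1 by rewrite invr_ge0 ltW.
have := h _ xi; rewrite normrM (ger0_norm (expR_ge0 _)) expRN exprVn.
rewrite ler_pdivrMr ?exprn_gt0// => h'.
rewrite ler_pdivrMr ?expR_gt0//; apply: le_trans h' _.
by rewrite mulrAC.
Qed.

Lemma is_derive_horner (p : {poly R}) x : is_derive x (1 : R) (fun y : R => p.[y]) p^`().[x].
Proof.
elim/poly_ind: p => [|p c IH].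
  rewrite deriv0 horner0; under eq_fun do rewrite horner0.
  exact: is_derive_cst.
under eq_fun do rewrite hornerMXaddC.
apply: is_derive_ext (is_deriveD (is_deriveM IH (is_derive_id x 1)) (is_derive_cst c x 1)) _ _ => //.
by rewrite derivD derivC !addr0 derivM derivX mulr1 hornerD hornerM hornerX /GRing.scale /=; ring.
Qed.

Lemma flat_derive (p : {poly R}) x : is_derive x (1 : R) (flat p) (flat ((p - p^`()) * 'X^2) x).
Proof.
have [x0|x0|->] := ltgtP x 0.
- rewrite /flat ltNge (ltW x0) /=.
  apply: (@near_eq_is_derive _ _ _ (cst 0)).
    near=> y; have y0 : y < 0 by near: y; exact: lt_nbhsl.
    by rewrite /flat ltNge (ltW y0).
- rewrite /flat x0.
  apply: (@near_eq_is_derive _ _ _ (fun y : R => p.[y^-1] * expR (- y^-1))).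
    near=> y; have y0 : 0 < y by near: y; exact: lt_nbhsr.
    by rewrite /flat y0.
  have xN : x != 0 by rewrite gt_eqF.
  have dV : is_derive x (1 : R) (fun y : R => y^-1) (- x ^- 2 *: 1).
    exact: is_deriveV xN (is_derive_id x 1).
  have dN : is_derive x (1 : R) (fun y : R => - y^-1) (- (- x ^- 2 *: 1)) by exact: is_deriveN.
  have dp := @is_derive1_comp _ _ (fun y : R => y^-1) x _ _ (is_derive_horner p x^-1) dV.
  have de := @is_derive1_comp _ _ (fun y : R => - y^-1) x _ _ (is_derive_expR (- x^-1)) dN.
  apply: is_derive_ext (is_deriveM dp de) _ _ => //.
  by rewrite !hornerE /GRing.scale /= -!exprVn !expr2; ring.
have [C C0 h] := flat_le_sqr p.
rewrite {2}/flat ltxx.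
apply/is_derive_epsP => e e0.
exists (e / (C + 1)); first by rewrite divr_gt0//; lra.
move=> t; rewrite subr0 mulr0 subr0 => te.
rewrite {2}/flat ltxx subr0 (le_trans (h t))// -real_normK ?num_real// expr2 mulrA.
rewrite ler_wpM2r//; rewrite ltr_pdivlMr in te; last by lra.
by have := normr_ge0 t; nra.
Unshelve. all: by end_near.
Qed.

Lemma smooth_flat (p : {poly R}) : smooth (flat p).
Proof.
apply: (@smooth_class (fun u => exists p, u = flat p)); last by exists p.
move=> _ [q ->]; exists (flat ((q - q^`()) * 'X^2)); first by eexists.
exact: flat_derive.
Qed.

Definition bump (a b x : R) : R := flat 1 (x - a) * flat 1 (b - x).

Lemma bump_gt0 a b x : a < x < b -> 0 < bump a b x.
Proof.
move=> /andP[ax xb]; rewrite /bump /flat !subr_gt0 ax xb !hornerC !mul1r.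
by rewrite mulr_gt0 ?expR_gt0.
Qed.

Lemma bump_eq0 a b x : ~~ (a < x < b) -> bump a b x = 0.
Proof.
rewrite negb_and /bump /flat !subr_gt0.
by case/orP => /negbTE ->; rewrite ?mul0r ?mulr0.
Qed.

Lemma smooth_bump a b : smooth (bump a b).
Proof.
apply: smoothM.
  have := smooth_affine 1 (- a) (smooth_flat 1).
  by congr smooth; apply/funext => x; rewrite mul1r.
have := smooth_affine (-1) b (smooth_flat 1).
by congr smooth; apply/funext => x; congr flat; ring.
Qed.

Lemma smooth_continuous f : smooth f -> continuous f.
Proof.
move=> [F [<- dF]] x; apply: differentiable_continuous.
by apply/derivable1_diffP; exact: ex_derive.
Qed.

End SmoothFunctions.

(** * Integration by parts on the interval *)

Section WeakPrimitive.
Context {R : realType}.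
Local Notation mu := (@lebesgue_measure R).
Local Notation D := (`[(-1 : R), 1]%classic).
Implicit Types (f g k F G : R -> R).

Definition continuous11 f : Prop := {within D, continuous f}.

Lemma continuous11_at f (x : R) : continuous11 f -> -1 < x < 1 -> {for x, continuous f}.
Proof. by move=> cf x11; apply: (within_continuous_continuous ltN11 cf); rewrite in_itv. Qed.

Lemma continuous11D f g : continuous11 f -> continuous11 g ->
  continuous11 (fun x => f x + g x).
Proof. by move=> cf cg x; apply: cvgD; [exact: cf|exact: cg]. Qed.

Lemma continuous11B f g : continuous11 f -> continuous11 g ->
  continuous11 (fun x => f x - g x).
Proof. by move=> cf cg x; apply: cvgB; [exact: cf|exact: cg]. Qed.

Lemma continuous11M f g : continuous11 f -> continuous11 g ->
  continuous11 (fun x => f x * g x).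
Proof. by move=> cf cg x; apply: cvgM; [exact: cf|exact: cg]. Qed.

Lemma continuous11_cst (c : R) : continuous11 (fun=> c).
Proof. by move=> x; exact: cvg_cst. Qed.

Lemma continuousT11 f : continuous f -> continuous11 f.
Proof. exact: continuous_subspaceT. Qed.

Lemma continuous11_measurable f : continuous11 f -> measurable_fun D f.
Proof. by apply: subspace_continuous_measurable_fun; exact: mD. Qed.

Lemma continuous11_bounded f : continuous11 f ->
  exists2 B, 0 <= B & forall x, D x -> `|f x| <= B.
Proof.
move=> cf; have cn : continuous11 (fun x => `|f x|) by move=> x; apply: cvg_norm; exact: cf.
have [c _ h] := EVT_max (ltW ltN11) cn.
by exists `|f c| => // x Dx; apply: h.
Qed.

Lemma integrable11M k g : integrable11 k -> measurable_fun D g ->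
  (exists B, forall x, D x -> `|g x| <= B) -> integrable11 (fun x => k x * g x).
Proof.
move=> ik mg [B gB]; apply: (@integrableMl _ _ _ mu D (@mD R) (EFin \o k) g ik mg).
exists B; split; first exact: num_real.
by move=> M BM x Dx /=; rewrite (le_trans (gB x Dx))// ltW.
Qed.

Lemma integrable11Mc k g : integrable11 k -> continuous11 g -> integrable11 (fun x => k x * g x).
Proof.
move=> ik cg; apply: integrable11M => //; first exact: continuous11_measurable.
by have [B _ gB] := continuous11_bounded cg; exists B.
Qed.

Lemma integrable11_norm k : integrable11 k -> integrable11 (fun x => `|k x|).
Proof. by move=> ik; exact: (integrable_norm ik). Qed.

Lemma integrable11B k g : integrable11 k -> integrable11 g ->
  integrable11 (fun x => k x - g x).
Proof. by move=> ik ig; exact: (@integrableB _ _ _ mu D (@mD R) _ _ ik ig). Qed.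

Lemma D1 : D 1. Proof. by rewrite /= in_itv /= lexx andbT; have := ltN11 (R:=R) => /ltW. Qed.

Lemma primitiveB k g (x : R) : integrable11 k -> integrable11 g -> D x ->
  primitive (fun t => k t - g t) x = primitive k x - primitive g x.
Proof.
rewrite /= in_itv /= => ik ig /andP[x0 x1].
rewrite /primitive /parameterized_integral RintegralB//; exact: integrable11_sub.
Qed.

Lemma primitive_ext k g (x : R) : D x -> (forall t, D t -> k t = g t) -> primitive k x = primitive g x.
Proof.
rewrite /= in_itv /= => /andP[x0 x1] kg; apply: eq_Rintegral => t.
rewrite inE /= in_itv /= => /andP[t0 t1]; apply: kg.
by rewrite /= in_itv /= t0 (le_trans t1).
Qed.

Lemma primitive_mono k g : integrable11 k -> integrable11 g ->
  (forall x, D x -> k x <= g x) -> primitive k 1 <= primitive g 1.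
Proof. by move=> ik ig kg; apply: le_Rintegral => //; exact: mD. Qed.

Lemma primitive_cst1 (c : R) : primitive (fun=> c) 1 = c * fine (mu D).
Proof. by rewrite /primitive /parameterized_integral Rintegral_cst//; exact: mD. Qed.

Lemma primitive_norm_le k (x : R) : integrable11 k -> D x ->
  `|primitive k x| <= primitive (fun t => `|k t|) 1.
Proof. exact: primitive_le. Qed.

Lemma primitiveE (E : seq R) F f : continuous11 F -> integrable11 f ->
  (forall x : R, -1 < x < 1 -> x \notin E -> {for x, continuous f}) ->
  (forall x : R, -1 < x < 1 -> x \notin E -> is_derive x 1 F (f x)) ->
  forall x, D x -> primitive f x = F x - F (-1).
Proof.
move=> cF jf cf dF x Dx.
suff h : primitive f x - F x = primitive f (-1) - F (-1).
  by rewrite primitiveN1 sub0r in h; rewrite addrC -h; ring.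
apply: (@constant_off_finite11 R E (fun x => primitive f x - F x)) => //.
  by apply: continuous11B => //; exact: primitive_continuous.
move=> t t11 tE; rewrite -[0](subrr (f t)).
exact: is_deriveB (primitive_derive jf t11 (cf t t11 tE)) (dF t t11 tE).
Qed.

Lemma primitive_parts F f G g : continuous11 F -> continuous11 G ->
  continuous11 f -> continuous11 g ->
  (forall x : R, -1 < x < 1 -> is_derive x 1 F (f x)) ->
  (forall x : R, -1 < x < 1 -> is_derive x 1 G (g x)) ->
  primitive (fun x => f x * G x) 1 + primitive (fun x => F x * g x) 1
  = F 1 * G 1 - F (-1) * G (-1).
Proof.
move=> cF cG cf cg dF dG.
have c1 := continuous11M cf cG; have c2 := continuous11M cF cg.
transitivity (primitive (fun x => f x * G x + F x * g x) 1).
  by rewrite primitiveD//; [exact: continuous_integrable11 | exact: continuous_integrable11 | exact: D1].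
apply: (@primitiveE [::] (fun x => F x * G x)).
- exact: continuous11M.
- by apply: continuous_integrable11; exact: continuous11D.
- by move=> x x11 _; apply: continuous11_at x11; exact: continuous11D.
- move=> x x11 _.
  apply: is_derive_ext (is_deriveM (dF x x11) (dG x x11)) _ _ => //.
  by rewrite /GRing.scale /=; ring.
- exact: D1.
Qed.

(** For continuous [k] this is ordinary integration by parts. The defect [L] is additive under
    differences and bounded by a multiple of the L^1 norm, so it vanishes for every integrable [k]
    by density of the continuous functions. *)
Lemma primitive_parts0 k G g : integrable11 k -> continuous11 G -> continuous11 g ->
  (forall x : R, -1 < x < 1 -> is_derive x 1 G (g x)) -> G 1 = 0 ->
  primitive (fun x => k x * G x) 1 = - primitive (fun x => primitive k x * g x) 1.
Proof.
move=> ik cG cg dG G1.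
pose L u := primitive (fun x => u x * G x) 1 + primitive (fun x => primitive u x * g x) 1.
have iJ u : integrable11 u -> integrable11 (fun x => primitive u x * g x).
  move=> iu; apply: continuous_integrable11; apply: continuous11M => //.
  exact: primitive_continuous.
have [B B0 GB] := continuous11_bounded cG; have [C C0 gC] := continuous11_bounded cg.
pose M := B + C * fine (mu D).
have L_le u : integrable11 u -> `|L u| <= primitive (fun t => `|u t|) 1 * M.
  move=> iu; have inu := integrable11_norm iu.
  rewrite (le_trans (ler_normD _ _))// mulrDr lerD//.
    rewrite (le_trans (primitive_norm_le _ D1))//; first exact: integrable11Mc.
    rewrite mulrC -primitiveZ//; last exact: D1.
    apply: primitive_mono; first by apply: integrable11_norm; exact: integrable11Mc.
      exact: integrable11Z.
    by move=> x Dx; rewrite normrM mulrC ler_wpM2r// GB.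
  rewrite (le_trans (primitive_norm_le (iJ _ iu) D1))// mulrA -primitive_cst1.
  apply: primitive_mono; first by apply: integrable11_norm; exact: iJ.
    by apply: continuous_integrable11; exact: continuous11_cst.
  by move=> x Dx; rewrite normrM ler_pM// ?gC// primitive_norm_le.
have Lc c : continuous c -> L c = 0.
  move=> cc; have c11 := continuousT11 cc.
  have jc := continuous_integrable11 c11.
  have -> : L c = primitive c 1 * G 1 - primitive c (-1) * G (-1).
    apply: primitive_parts => //; first exact: primitive_continuous.
    by move=> x x11; exact: primitive_derive (cc x).
  by rewrite G1 primitiveN1 mul0r mulr0 subrr.
have LB c : integrable11 c -> L (fun x => k x - c x) = L k - L c.
  move=> ic; rewrite /L.
  have -> : primitive (fun x => (k x - c x) * G x) 1
    = primitive (fun x => k x * G x) 1 - primitive (fun x => c x * G x) 1.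
    rewrite -primitiveB; [|exact: integrable11Mc..|exact: D1].
    by apply: primitive_ext; [exact: D1 | move=> t _; ring].
  have -> : primitive (fun x => primitive (fun x => (k x - c x)) x * g x) 1
    = primitive (fun x => primitive k x * g x) 1 - primitive (fun x => primitive c x * g x) 1.
    rewrite -primitiveB; [|exact: iJ..|exact: D1].
    by apply: primitive_ext; [exact: D1 | move=> t Dt; rewrite primitiveB//; ring].
  by rewrite opprD addrACA.
have Lk e : 0 < e -> `|L k| <= e * M.
  move=> e0.
  have [c_ [cc ic]] := approximation_continuous_integrable (@mD R) (@mu_D_lty R) ik.
  move=> /fine_cvgP[_ /cvgrPdist_lt/(_ e e0)[n _ /(_ n (leqnn n))]] /=.
  rewrite sub0r normrN => h.
  have -> : L k = L (fun x => k x - c_ n x) by rewrite (LB (c_ n) (ic n)) (Lc (c_ n) (cc n)) subr0.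
  rewrite (le_trans (L_le _ (integrable11B ik (ic n))))// ler_wpM2r//.
    by rewrite addr_ge0// mulr_ge0// fine_ge0.
  exact: le_trans (ler_norm _) (ltW h).
apply/eqP; rewrite -addr_eq0 -normr_le0; apply/ler_addgt0Pl => e e0.
have M0 : 0 <= M by rewrite addr_ge0// mulr_ge0// fine_ge0.
rewrite addr0 (le_trans (Lk (e / (M + 1)) _))//; first by rewrite divr_gt0//; lra.
by rewrite mulrAC ler_pdivrMr; nra.
Qed.

End WeakPrimitive.

(** * From distributional to classical derivatives *)

Section DuBoisReymond.
Context {R : realType}.
Local Notation mu := (@lebesgue_measure R).
Local Notation D := (`[(-1 : R), 1]%classic).
Implicit Types (f g k F G phi : R -> R).

(** A smooth step. The base point -2 is to the left of the support of the bump, as [del < 1]. *)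
Definition bump_primitive (del x : R) : R :=
  \int[mu]_(t in `[-2, x]) bump (- del) del t.

Lemma Rintegral_eq0 (A : set R) f : (forall x, A x -> f x = 0) -> \int[mu]_(t in A) f t = 0.
Proof. by move=> f0; rewrite /Rintegral integral0_eq// => x Ax; rewrite f0. Qed.

Lemma bump_continuous (a b : R) : continuous (bump a b).
Proof. exact: smooth_continuous (smooth_bump a b). Qed.

Lemma bump_primitive_derive (del x : R) : 0 < del < 1 ->
  is_derive x (1 : R) (bump_primitive del) (bump (- del) del x).
Proof.
(* Left of [- 3 / 2] the integral is identically 0, also left of the base point where the interval
   is empty; elsewhere the fundamental theorem applies. *)
move=> /andP[d0 d1]; have [x2|x2] := ltP x (- (3 / 2)).
  have b0 (t : R) : t <= - (3 / 2) -> bump (- del) del t = 0.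
    by move=> t2; apply: bump_eq0; rewrite negb_and -leNgt; apply/orP; left; lra.
  rewrite b0 ?ltW//.
  apply: (@near_eq_is_derive _ _ _ (cst 0)).
  near=> t; have t2 : t < - (3 / 2) by near: t; exact: lt_nbhsl.
  rewrite /bump_primitive Rintegral_eq0// => y.
  by rewrite /= in_itv /= => /andP[_ yt]; rewrite b0//; lra.
have ib (u : R) : mu.-integrable `[-2, u] (EFin \o bump (- del) del).
  apply: continuous_compact_integrable; first exact: segment_compact.
  by apply: continuous_subspaceT; exact: bump_continuous.
have x2' : -2 < x by lra.
have [dk kE] := continuous_FTC1_closed (ltr_pwDr ltr01 (lexx x)) (ib (x + 1)) x2'
  (bump_continuous (x := x)).
by apply: DeriveDef; [exact: dk | rewrite -derive1E; exact: kE].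
Unshelve. all: by end_near.
Qed.

Lemma bump_primitive_smooth (del : R) : 0 < del < 1 -> smooth (bump_primitive del).
Proof.
move=> d01; apply: smooth_primitive (smooth_bump (- del) del) => x.
exact: bump_primitive_derive.
Qed.

Lemma bump_primitive_left (del x : R) : 0 < del < 1 -> x <= - del -> bump_primitive del x = 0.
Proof.
move=> d01 xd; rewrite /bump_primitive Rintegral_eq0// => t.
rewrite /= in_itv /= => /andP[_ tx].
by rewrite bump_eq0// negb_and -leNgt (le_trans tx).
Qed.

Lemma bump_primitive_right (del x : R) : 0 < del < 1 -> del <= x ->
  bump_primitive del x = bump_primitive del del.
Proof.
move=> d01 xd; apply/esym; apply: (@constant_off_finite R [::]) => //.
  apply: continuous_subspaceT; exact: smooth_continuous (bump_primitive_smooth d01).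
move=> t /andP[dt _] _; rewrite -(@bump_eq0 R (- del) del t); first exact: bump_primitive_derive.
by rewrite negb_and -(leNgt del) (ltW dt) orbT.
Qed.

Lemma bump_primitive_gt0 (del : R) : 0 < del < 1 -> 0 < bump_primitive del del.
Proof.
move=> d01; have d0 : - del < del by move: d01 => /andP[]; lra.
have [c] := @MVT R (bump_primitive del) (bump (- del) del) (- del) del d0
  (fun x _ => bump_primitive_derive x d01)
  (continuous_subspaceT (smooth_continuous (bump_primitive_smooth d01))).
rewrite in_itv /= (bump_primitive_left d01 (lexx _)) subr0 => /bump_gt0 c0 ->.
by rewrite mulr_gt0// subr_gt0.
Qed.

Lemma test_function_smooth phi (r : R) : smooth phi -> 0 < r < 1 ->
  (forall x, ~~ (- r < x < r) -> phi x = 0) -> test_function phi.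
Proof.
move=> sphi r01 phi0; split; first exact: smoothP.
have cl : closed `[- r, r]%classic by exact: interval_closed.
apply: (@subset_trans _ `[- r, r]%classic); last first.
  by move=> x /=; rewrite in_itv /I11 /= => /andP[? ?]; apply/andP; lra.
rewrite [X in _ `<=` X](_ : _ = closure `[- r, r]%classic); last by rewrite -closure_id.
apply: closure_subset => x /=; apply: contraNP => /negP xr; apply/eqP; apply: phi0.
by apply: contra xr => /andP[? ?]; rewrite in_itv /= !ltW.
Qed.

Lemma test_function_end phi (n : nat) (x : R) : test_function phi -> ~ I11 x ->
  derive1n n phi x = 0.
Proof.
move=> [dphi sphi] x11.
have nx : \forall t \near x, phi t = 0.
  have cx : (~` closure [set x | phi x != 0]) x by move=> /sphi.
  have co : open (~` closure [set x | phi x != 0]).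
    by apply: closed_openC; exact: closed_closure.
  have := open_nbhs_nbhs (conj co cx); apply: filterS => t tc.
  by apply/eqP; apply: contraPT tc => tn; apply; exact: subset_closure.
suff : \forall t \near x, derive1n n phi t = 0 by exact: nbhs_singleton.
elim: n => [//|n IH]; rewrite derive1nS.
have := IH => /near_join; apply: filterS => t nt.
rewrite derive1E; apply: derive_val.
by apply: (@near_eq_is_derive _ _ _ (cst 0)); apply: filterS nt => y ->.
Qed.

Lemma test_function_derive phi (n : nat) (x : R) : test_function phi ->
  is_derive x (1 : R) (derive1n n phi) (derive1n n.+1 phi x).
Proof. by move=> [dphi _]; apply: DeriveDef; [exact: dphi | rewrite derive1nS derive1E]. Qed.

Lemma test_function_continuous phi (n : nat) : test_function phi ->
  continuous11 (derive1n n phi).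
Proof.
move=> tphi; apply: continuousT11 => x.
exact: is_derive_real_continuous (test_function_derive n x tphi).
Qed.

(** The difference of two translated steps is a test function whose derivative is the difference of
    two equal bumps centred at [s] and [t]. The averages of [f] near the two points therefore agree,
    and continuity passes to the values. *)
Lemma du_bois_reymond f : continuous11 f ->
  (forall phi, test_function phi -> primitive (fun x => f x * derive1n 1 phi x) 1 = 0) ->
  forall x, D x -> f x = f (-1).
Proof.
move=> cf h0.
suff h s t : -1 < s < 1 -> -1 < t < 1 -> f s = f t.
  apply: (@constant_off_finite11 R [::]) => // x x11 _.
  apply: (@near_eq_is_derive _ _ _ (cst (f x))).
  have : \forall y \near x, y \in `]-1, 1[ by apply: near_in_itvoo; rewrite in_itv.
  by apply: filterS => y; rewrite in_itv /= => y11; apply: h.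
move=> s11 t11; apply/eqP; rewrite -subr_eq0 -normr_le0; apply/ler_addgt0Pl => e e0.
rewrite addr0.
have e2 : 0 < e / 2 by rewrite divr_gt0.
have nb (u : R) : -1 < u < 1 -> exists2 d : R, 0 < d &
    forall y, `|y - u| < d -> `|f u - f y| <= e / 2.
  move=> u11; have /cvgrPdist_le/(_ _ e2) := continuous11_at cf u11.
  move=> /nbhs_ballP[d d0 hd]; exists d => // y yu; apply: hd.
  by rewrite /ball /= distrC.
have [ds ds0 hs] := nb s s11; have [dt dt0 ht] := nb t t11.
move: s11 t11 => /andP[s1 s2] /andP[t1 t2].
pose m1 := Num.min (Num.min (1 - s) (1 + s)) (Num.min (1 - t) (1 + t)).
have m10 : 0 < m1 by rewrite /m1 !lt_min; apply/andP; split; apply/andP; lra.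
have [ms ms' mt mt'] : [/\ m1 <= 1 - s, m1 <= 1 + s, m1 <= 1 - t & m1 <= 1 + t].
  by rewrite /m1 !ge_min !lexx ?orbT.
clearbody m1.
(* Small enough for the oscillation of [f] on both bumps, and for the supports to keep a margin
   [m1 / 2] from the ends. *)
pose del := Num.min (m1 / 2) (Num.min ds dt).
have [dm dds ddt] : [/\ del <= m1 / 2, del <= ds & del <= dt].
  by rewrite /del !ge_min !lexx ?orbT.
have d0 : 0 < del by rewrite /del !lt_min ds0 dt0 divr_gt0.
clearbody del.
have d01 : 0 < del < 1 by rewrite d0; lra.
pose E := bump_primitive del; pose I := E del.
pose b u x := bump (- del) del (x - u).
pose phi x := E (x - s) - E (x - t).
have dE u (x : R) : is_derive x (1 : R) (fun x : R => E (x - u)) (b u x).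
  have := @is_derive_affine R E 1 (- u) x (b u x); rewrite mul1r mul1r.
  move=> /(_ (bump_primitive_derive _ d01)) H.
  by apply: is_derive_ext H _ _ => // y; rewrite mul1r.
have sE u : smooth (fun x => E (x - u)).
  have := smooth_affine 1 (- u) (bump_primitive_smooth d01).
  by congr smooth; apply/funext => x; rewrite mul1r.
have tphi : test_function phi.
  apply: (@test_function_smooth phi (1 - m1 / 2)); first exact: smoothB.
    by apply/andP; lra.
  move=> x; rewrite negb_and -!leNgt /phi => /orP[xr|xr].
    by rewrite /E !bump_primitive_left ?subrr//; lra.
  by rewrite /E (@bump_primitive_right _ (x - s)) ?(@bump_primitive_right _ (x - t)) ?subrr//; lra.
have phi1 : derive1n 1 phi = (fun x => b s x - b t x).
  apply/funext => x /=; rewrite derive1E; exact: derive_val.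
have cb u : continuous11 (b u).
  apply: continuousT11 => x.
  apply: (@continuous_comp _ _ _ (fun x : R => x - u) (bump (- del) del)).
    by apply: cvgB; [exact: cvg_id | exact: cvg_cst].
  exact: bump_continuous.
have cE u : continuous11 (fun x => E (x - u)).
  by apply: continuousT11; exact: smooth_continuous (sE u).
have ib u := continuous_integrable11 (cb u).
have ifb u := continuous_integrable11 (continuous11M cf (cb u)).
have Ib u : m1 <= 1 - u -> m1 <= 1 + u -> primitive (b u) 1 = I.
  move=> m2 m3; have -> : I = E (1 - u) - E (-1 - u).
    by rewrite /E bump_primitive_right ?(@bump_primitive_left _ (-1 - u)) ?subr0//; lra.
  apply: (@primitiveE R [::] (fun x => E (x - u))) => //; last exact: D1.
  by move=> x x11 _; apply: continuous11_at x11.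
have b0 u x : 0 <= b u x.
  rewrite /b; have [H|H] := boolP (- del < x - u < del); first exact: ltW (bump_gt0 H).
  by rewrite bump_eq0.
have near_u u : m1 <= 1 - u -> m1 <= 1 + u ->
    (forall y, `|y - u| < del -> `|f u - f y| <= e / 2) ->
    `|f u * I - primitive (fun x => f x * b u x) 1| <= e / 2 * I.
  move=> m2 m3 hu; rewrite -(Ib u m2 m3) -!primitiveZ//; try exact: D1.
  rewrite -primitiveB//; [|exact: integrable11Z|exact: D1].
  have id : integrable11 (fun x => f u * b u x - f x * b u x).
    by apply: integrable11B => //; exact: integrable11Z.
  rewrite (le_trans (primitive_norm_le id D1))//; apply: primitive_mono.
  - exact: integrable11_norm.
  - exact: integrable11Z.
  - move=> x Dx; rewrite -mulrBl normrM (ger0_norm (b0 _ _)).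
    have [H|H] := boolP (- del < x - u < del).
      by rewrite ler_wpM2r//; apply: hu; rewrite ltr_norml.
    by rewrite /b bump_eq0// !mulr0.
have Fs := near_u s ms ms' (fun y H => hs y (lt_le_trans H dds)).
have Ft := near_u t mt mt' (fun y H => ht y (lt_le_trans H ddt)).
have := h0 phi tphi; rewrite phi1 => H.
have {}H : primitive (fun x => f x * b s x) 1 = primitive (fun x => f x * b t x) 1.
  apply/eqP; rewrite -subr_eq0 -primitiveB//; last exact: D1.
  by rewrite -H; apply/eqP; apply: primitive_ext; [exact: D1|move=> x _; ring].
have I0 : 0 < I by exact: bump_primitive_gt0.
rewrite -(ler_pM2r I0) -{1}(gtr0_norm I0) -normrM.
rewrite (_ : (f s - f t) * I = (f s * I - primitive (fun x => f x * b s x) 1)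
   - (f t * I - primitive (fun x => f x * b t x) 1)); last by rewrite H; ring.
apply: le_trans (ler_normB _ _) _; rewrite [e]splitr mulrDl.
exact: lerD Fs Ft.
Qed.

(** Integrating by parts on both sides reduces the distributional identity to [f1 - primitive g]
    being orthogonal to all derivatives of test functions, that is, to its being constant. *)
Lemma weak_derivative f f1 g : continuous11 f -> continuous11 f1 -> integrable11 g ->
  (forall x : R, -1 < x < 1 -> is_derive x 1 f (f1 x)) ->
  (forall phi, test_function phi ->
     primitive (fun x => f x * derive1n 2 phi x) 1 = primitive (fun x => g x * phi x) 1) <->
  (forall x, D x -> f1 x = f1 (-1) + primitive g x).
Proof.
move=> cf cf1 ig df.
have cJ := primitive_continuous ig.
have part phi : test_function phi ->
    primitive (fun x => f x * derive1n 2 phi x) 1 - primitive (fun x => g x * phi x) 1 =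
    - primitive (fun x => (f1 x - primitive g x) * derive1n 1 phi x) 1.
  move=> tphi; have cphi n : continuous11 (derive1n n phi) := test_function_continuous tphi.
  have e1 (n : nat) : derive1n n phi 1 = 0 /\ derive1n n phi (-1) = 0.
    by split; apply: test_function_end => //; rewrite /I11 /= ltxx ?andbF.
  have b0 : f 1 * derive1n 1 phi 1 - f (-1) * derive1n 1 phi (-1) = 0.
    by rewrite (e1 1%N).1 (e1 1%N).2 !mulr0 subrr.
  have AB := etrans (@primitive_parts R f f1 (derive1n 1 phi) (derive1n 2 phi) cf (cphi 1%N) cf1
    (cphi 2%N) df (fun x _ => test_function_derive 1 x tphi)) b0.
  have CJ : primitive (fun x => g x * phi x) 1
      = - primitive (fun x => primitive g x * derive1n 1 phi x) 1.
    apply: primitive_parts0 => //; [exact: cphi 0%N | | exact: (e1 0%N).1].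
    by move=> x _; exact: (test_function_derive 0 x tphi).
  have K : primitive (fun x => (f1 x - primitive g x) * derive1n 1 phi x) 1
      = primitive (fun x => f1 x * derive1n 1 phi x) 1
        - primitive (fun x => primitive g x * derive1n 1 phi x) 1.
    rewrite -primitiveB; last exact: D1.
    - by apply: primitive_ext; [exact: D1 | move=> x _; ring].
    - by apply: continuous_integrable11; exact: continuous11M.
    - by apply: continuous_integrable11; exact: continuous11M.
  have algebra (a b c j k : R) : a + b = 0 -> c = - j -> k = a - j -> b - c = - k.
    by move=> /eqP; rewrite addrC addr_eq0 => /eqP -> -> ->; rewrite opprB opprK addrC.
  exact: (algebra _ _ _ _ _ AB CJ K).
split=> [H x Dx|H phi tphi].
  suff E : f1 x - primitive g x = f1 (-1) - primitive g (-1).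
    by rewrite primitiveN1 subr0 in E; rewrite -E; ring.
  apply: (@du_bois_reymond (fun x => f1 x - primitive g x)) => //.
    exact: continuous11B.
  move=> phi tphi; apply/eqP; rewrite -oppr_eq0 -part//.
  by rewrite H// subrr.
apply/eqP; rewrite -subr_eq0 part// oppr_eq0; apply/eqP.
transitivity (primitive (fun x => f1 (-1) * derive1n 1 phi x) 1).
  by apply: primitive_ext; [exact: D1 | move=> x Dx; rewrite H// addrK].
rewrite primitiveZ; last exact: D1.
  suff -> : primitive (derive1n 1 phi) 1 = phi 1 - phi (-1).
    have -> : phi 1 = 0 by apply: (@test_function_end phi 0 1 tphi); rewrite /I11 /= ltxx andbF.
    have -> : phi (-1) = 0 by apply: (@test_function_end phi 0 (-1) tphi); rewrite /I11 /= ltxx.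
    by rewrite subrr mulr0.
  apply: (@primitiveE R [::] phi) => //; last exact: D1.
  - exact: (@test_function_continuous phi 0 tphi).
  - by apply: continuous_integrable11; exact: test_function_continuous.
  - by move=> x x11 _; apply: continuous11_at x11; exact: test_function_continuous.
  - by move=> x _ _; exact: (test_function_derive 0 x tphi).
by apply: continuous_integrable11; exact: test_function_continuous.
Qed.

End DuBoisReymond.

(** * Resolvent of the Dirichlet operator *)

Section ComplexPrimitive.
Context {R : realType}.
Local Notation mu := (@lebesgue_measure R).
Local Notation D := (`[(-1 : R), 1]%classic).
Local Notation Re := complex.Re.
Local Notation Im := complex.Im.
Implicit Types (f g k F G : R -> R[i]).

Definition cintegrable11 k : Prop :=
  integrable11 (fun x => Re (k x)) /\ integrable11 (fun x => Im (k x)).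

Definition ccontinuous_at k (x : R) : Prop :=
  {for x, continuous (fun y => Re (k y))} /\ {for x, continuous (fun y => Im (k y))}.

Definition cprimitive k (x : R) : R[i] :=
  primitive (fun y => Re (k y)) x +i* primitive (fun y => Im (k y)) x.

Lemma ReMr (z : R[i]) (x : R) : Re (z * x%:C) = Re z * x.
Proof. by rewrite mulrC ReMl mulrC. Qed.

Lemma ImMr (z : R[i]) (x : R) : Im (z * x%:C) = Im z * x.
Proof. by rewrite mulrC ImMl mulrC. Qed.

Lemma continuous11_ext (f g : R -> R) : f =1 g -> continuous11 f -> continuous11 g.
Proof. by move=> /funext ->. Qed.

Lemma ccontinuous_ext f g : f =1 g -> ccontinuous f -> ccontinuous g.
Proof. by move=> /funext ->. Qed.

Lemma ccontinuousD f g : ccontinuous f -> ccontinuous g -> ccontinuous (fun x => f x + g x).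
Proof.
move=> [f1 f2] [g1 g2]; split.
  by apply: continuous11_ext (continuous11D f1 g1) => x; rewrite ReD.
by apply: continuous11_ext (continuous11D f2 g2) => x; rewrite ImD.
Qed.

Lemma ccontinuousM f g : ccontinuous f -> ccontinuous g -> ccontinuous (fun x => f x * g x).
Proof.
move=> [f1 f2] [g1 g2]; split.
  by apply: continuous11_ext (continuous11B (continuous11M f1 g1) (continuous11M f2 g2)) => x;
    rewrite ReM.
by apply: continuous11_ext (continuous11D (continuous11M f1 g2) (continuous11M f2 g1)) => x;
  rewrite ImM.
Qed.

Lemma ccontinuous_cst (c : R[i]) : ccontinuous (fun=> c).
Proof. by split; exact: continuous11_cst. Qed.

Lemma ccontinuousB f g : ccontinuous f -> ccontinuous g -> ccontinuous (fun x => f x - g x).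
Proof.
move=> cf cg; apply: ccontinuous_ext (ccontinuousD cf (ccontinuousM (ccontinuous_cst (-1)) cg)).
by move=> x; rewrite mulN1r.
Qed.

Lemma ccontinuous_atM f g x : ccontinuous_at f x -> ccontinuous_at g x ->
  ccontinuous_at (fun x => f x * g x) x.
Proof.
move=> [f1 f2] [g1 g2]; split.
  rewrite (_ : (fun y => _) = fun y : R => Re (f y) * Re (g y) - Im (f y) * Im (g y)).
    by apply: cvgB; apply: cvgM.
  by apply/funext => y; rewrite ReM.
rewrite (_ : (fun y => _) = fun y : R => Re (f y) * Im (g y) + Im (f y) * Re (g y)).
  by apply: cvgD; apply: cvgM.
by apply/funext => y; rewrite ImM.
Qed.

Lemma ccontinuous_at11 f x : ccontinuous f -> -1 < x < 1 -> ccontinuous_at f x.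
Proof. by move=> [f1 f2] x11; split; [exact: continuous11_at f1 x11|exact: continuous11_at f2 x11]. Qed.

Lemma ccontinuous_bounded f : ccontinuous f ->
  exists2 B, 0 <= B & forall x, D x -> cmod (f x) <= B.
Proof.
move=> [/continuous11_bounded[B B0 h] /continuous11_bounded[C C0 h']].
exists (B + C); first exact: addr_ge0.
by move=> x Dx; rewrite (le_trans (cmod_le_ReIm _))// lerD// ?h ?h'.
Qed.

Lemma ccontinuous_integrable f : ccontinuous f -> cintegrable11 f.
Proof. by move=> [f1 f2]; split; exact: continuous_integrable11. Qed.

Lemma cintegrable11M k g : cintegrable11 k -> ccontinuous g ->
  cintegrable11 (fun x => k x * g x).
Proof.
move=> [k1 k2] [g1 g2]; split; under eq_fun do rewrite ?ReM ?ImM.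
  by apply: integrable11B; exact: integrable11Mc.
by apply: integrable11D; exact: integrable11Mc.
Qed.

Lemma measurable_cmod (A : set R) k : measurable_fun A (fun x => Re (k x)) ->
  measurable_fun A (fun x => Im (k x)) -> measurable_fun A (fun x => cmod (k x)).
Proof.
move=> m1 m2; under eq_fun do rewrite cmod_sqrt.
apply: (measurableT_comp (f := fun x : R => Num.sqrt x)); first by apply: continuous_measurable_fun; exact: sqrt_continuous.
by apply: measurable_funD; exact: measurable_funX.
Qed.

Lemma integrable11_measurable (k : R -> R) : integrable11 k -> measurable_fun D k.
Proof. by case/integrableP => /measurable_EFinP. Qed.

Lemma integrable11_le (k g : R -> R) : measurable_fun D k -> integrable11 g ->
  (forall x, D x -> `|k x| <= g x) -> integrable11 k.
Proof.
move=> mk ig kg; apply: (@le_integrable _ _ _ mu D (@mD R) (EFin \o k) (EFin \o g)) => //.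
  exact/measurable_EFinP.
by move=> x Dx; rewrite /= lee_fin (le_trans (kg x Dx))// ler_norm.
Qed.

Lemma cintegrable11_cmod k : cintegrable11 k -> integrable11 (fun x => cmod (k x)).
Proof.
move=> [k1 k2]; apply: (@integrable11_le _ (fun x => `|Re (k x)| + `|Im (k x)|)).
- by apply: measurable_cmod; exact: integrable11_measurable.
- by apply: integrable11D; exact: integrable11_norm.
- by move=> x _; rewrite ger0_norm ?cmod_ge0// cmod_le_ReIm.
Qed.

Lemma cprimitiveN1 k : cprimitive k (-1) = 0.
Proof. by rewrite /cprimitive !primitiveN1. Qed.

Lemma cprimitive_continuous k : cintegrable11 k -> ccontinuous (cprimitive k).
Proof. by move=> [k1 k2]; split; exact: primitive_continuous. Qed.

Lemma cprimitive_cder k x : cintegrable11 k -> -1 < x < 1 -> ccontinuous_at k x ->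
  cder (cprimitive k) x (k x).
Proof. by move=> [k1 k2] x11 [c1 c2]; split; exact: primitive_derive. Qed.

Lemma cprimitive_lin k g (c : R) x : cintegrable11 k -> cintegrable11 g -> D x ->
  cprimitive (fun t => k t + c%:C * g t) x = cprimitive k x + c%:C * cprimitive g x.
Proof.
move=> [k1 k2] [g1 g2] Dx; apply: eqC; rewrite ?(ReD, ImD, ReMl, ImMl) /cprimitive /=.
  by under eq_fun do rewrite ReD ReMl; rewrite primitiveD ?primitiveZ//; exact: integrable11Z.
by under eq_fun do rewrite ImD ImMl; rewrite primitiveD ?primitiveZ//; exact: integrable11Z.
Qed.

Lemma cprimitive_ae k g x : cintegrable11 k -> cintegrable11 g -> eqae k g -> D x ->
  cprimitive k x = cprimitive g x.
Proof.
move=> [k1 k2] [g1 g2] kg Dx; rewrite /cprimitive.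
congr (_ +i* _); apply: primitive_ae => //; move: kg;
  (apply: filterS; first exact: (ae_filter_ringOfSetsType mu)) => t /[apply] ->//.
Qed.

Lemma cprimitive_le k x : cintegrable11 k -> D x ->
  cmod (cprimitive k x) <= 2 * primitive (fun t => cmod (k t)) 1.
Proof.
move=> ik Dx; have ic := cintegrable11_cmod ik; have [k1 k2] := ik.
rewrite (le_trans (cmod_le_ReIm _))// mulrDl mul1r lerD//.
  rewrite (le_trans (primitive_norm_le k1 Dx))//; apply: primitive_mono => //.
    exact: integrable11_norm.
  by move=> t _; exact: normr_Re_le.
rewrite (le_trans (primitive_norm_le k2 Dx))//; apply: primitive_mono => //.
  exact: integrable11_norm.
by move=> t _; exact: normr_Im_le.
Qed.

Lemma primitive_le_bound (k : R -> R) (B : R) : integrable11 k -> (forall x, D x -> k x <= B) ->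
  primitive k 1 <= B * fine (mu D).
Proof.
move=> ik kB; rewrite -primitive_cst1; apply: primitive_mono => //.
by apply: continuous_integrable11; exact: continuous11_cst.
Qed.

Lemma cprimitive_le_bound k (B x : R) : cintegrable11 k -> (forall x, D x -> cmod (k x) <= B) ->
  D x -> cmod (cprimitive k x) <= 2 * fine (mu D) * B.
Proof.
move=> ik kB Dx; rewrite (le_trans (cprimitive_le ik Dx))// -mulrA ler_wpM2l// mulrC.
by apply: primitive_le_bound => //; exact: cintegrable11_cmod.
Qed.

Lemma cprimitiveE (E : seq R) F f : ccontinuous F -> cintegrable11 f ->
  (forall x, -1 < x < 1 -> x \notin E -> ccontinuous_at f x) ->
  (forall x, -1 < x < 1 -> x \notin E -> cder F x (f x)) ->
  forall x, D x -> F x = F (-1) + cprimitive f x.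
Proof.
move=> [c1 c2] [f1 f2] cf dF x Dx; apply: eqC; rewrite ?ReD ?ImD /=;
  apply/eqP; rewrite addrC -subr_eq; apply/eqP/esym.
  apply: (@primitiveE R E (fun x => Re (F x))) => // y y11 yE.
    by case: (cf y y11 yE).
  by case: (dF y y11 yE).
apply: (@primitiveE R E (fun x => Im (F x))) => // y y11 yE.
  by case: (cf y y11 yE).
by case: (dF y y11 yE).
Qed.

Lemma cconstant_off_finite (E : seq R) F : ccontinuous F ->
  (forall x, -1 < x < 1 -> x \notin E -> cder F x 0) -> forall x, D x -> F x = F (-1).
Proof.
move=> [c1 c2] dF x Dx; apply: eqC.
  apply: (@constant_off_finite11 R E (fun x => Re (F x))) => // y y11 yE.
  by case: (dF y y11 yE).
apply: (@constant_off_finite11 R E (fun x => Im (F x))) => // y y11 yE.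
by case: (dF y y11 yE).
Qed.

Lemma measurableI11 (k : R -> R) : measurable_fun D k -> measurable_fun (@I11 R) k.
Proof.
apply: measurable_funS; first exact: mD.
by move=> x /=; rewrite in_itv /= /I11 => /andP[? ?]; rewrite !ltW.
Qed.

Lemma cintegral_real k (rho : R -> R) : measurable_fun (@I11 R) (fun x => Re (k x)) ->
  measurable_fun (@I11 R) (fun x => Im (k x)) -> continuous11 rho ->
  cintegral (fun x => k x * (rho x)%:C) =
  primitive (fun x => Re (k x) * rho x) 1 +i* primitive (fun x => Im (k x) * rho x) 1.
Proof.
move=> m1 m2 crho.
have mrho : measurable_fun (@I11 R) rho.
  by apply: measurableI11; exact: continuous11_measurable.
rewrite /cintegral; congr (_ +i* _).
  under eq_Rintegral do rewrite ReMr.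
  by rewrite RintegralI11//; exact: measurable_funM.
under eq_Rintegral do rewrite ImMr.
by rewrite RintegralI11//; exact: measurable_funM.
Qed.

Lemma ccontinuous_measurable f : ccontinuous f ->
  measurable_fun (@I11 R) (fun x => Re (f x)) /\ measurable_fun (@I11 R) (fun x => Im (f x)).
Proof.
by move=> [f1 f2]; split; apply: measurableI11; exact: continuous11_measurable.
Qed.

Lemma cweak_derivative f f1 g : ccontinuous f -> ccontinuous f1 -> cintegrable11 g ->
  measurable_fun (@I11 R) (fun x => Re (g x)) -> measurable_fun (@I11 R) (fun x => Im (g x)) ->
  (forall x : R, -1 < x < 1 -> cder f x (f1 x)) ->
  distr_deriv2 f g <-> (forall x, D x -> f1 x = f1 (-1) + cprimitive g x).
Proof.
move=> cf cf1 [g1 g2] m1 m2 df; have [mf1 mf2] := ccontinuous_measurable cf.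
have [[cfr cfi] [cf1r cf1i]] := (cf, cf1).
have wr := weak_derivative cfr cf1r g1 (fun x H => (df x H).1).
have wi := weak_derivative cfi cf1i g2 (fun x H => (df x H).2).
split=> [H x Dx|H phi tphi].
  apply: eqC; rewrite ?ReD ?ImD.
    apply: wr.1 => // phi tphi; have := H phi tphi.
    rewrite !cintegral_real//; first by case.
      exact: (@test_function_continuous R phi 0 tphi).
    exact: (@test_function_continuous R phi 2 tphi).
  apply: wi.1 => // phi tphi; have := H phi tphi.
  rewrite !cintegral_real//; first by case.
    exact: (@test_function_continuous R phi 0 tphi).
  exact: (@test_function_continuous R phi 2 tphi).
rewrite !cintegral_real//; first last.
- exact: (@test_function_continuous R phi 2 tphi).
- exact: (@test_function_continuous R phi 0 tphi).
congr (_ +i* _).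
  by apply: wr.2 => // x Dx; rewrite H// ReD.
by apply: wi.2 => // x Dx; rewrite H// ImD.
Qed.

(** On a bounded interval [y <= 1 + y ^ 2] gives integrability. *)
Lemma L2_cintegrable g : L2 g -> cintegrable11 g /\ integrable11 (fun x => cmod (g x) ^+ 2).
Proof.
move=> [m1 m2 fin].
have mD1 := measurable_I11_closed m1; have mD2 := measurable_I11_closed m2.
have mc := measurable_cmod m1 m2.
have i2 : integrable11 (fun x => cmod (g x) ^+ 2).
  apply: integrable_I11_closed; apply/integrableP; split.
    by apply/measurable_EFinP; exact: measurable_funX.
  by under eq_integral do rewrite /= ger0_norm ?sqr_ge0//.
have ib : integrable11 (fun x => 1 + cmod (g x) ^+ 2).
  by apply: integrable11D => //; apply: continuous_integrable11; exact: continuous11_cst.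
have le1 (y : R) : 0 <= y -> y <= 1 + y ^+ 2 by nra.
split=> //; split; apply: integrable11_le ib _ => // x _.
  exact: le_trans (normr_Re_le _) (le1 _ (cmod_ge0 _)).
exact: le_trans (normr_Im_le _) (le1 _ (cmod_ge0 _)).
Qed.

Lemma L2normE g : L2 g -> L2norm g ^+ 2 = primitive (fun x => cmod (g x) ^+ 2) 1.
Proof.
move=> [m1 m2 _]; rewrite /L2norm sqr_sqrtr.
  by rewrite RintegralI11//; apply: measurable_funX; exact: measurable_cmod.
by apply: Rintegral_ge0 => x _; rewrite sqr_ge0.
Qed.

Lemma L2_lin (b v : R -> R[i]) (c : R) (B : R) :
  measurable_fun (@I11 R) (fun x => Re (b x)) -> measurable_fun (@I11 R) (fun x => Im (b x)) ->
  (forall x, I11 x -> cmod (b x) <= B) -> L2 v -> L2 (fun x => b x + c%:C * v x).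
Proof.
move=> m1 m2 bB L2v; have [m3 m4 _] := L2v; have [_ iv] := L2_cintegrable L2v.
have mr : measurable_fun (@I11 R) (fun x => Re (b x + c%:C * v x)).
  under eq_fun do rewrite ReD ReMl; apply: measurable_funD => //; exact: measurable_funM.
have mi : measurable_fun (@I11 R) (fun x => Im (b x + c%:C * v x)).
  under eq_fun do rewrite ImD ImMl; apply: measurable_funD => //; exact: measurable_funM.
split => //.
have mc := measurable_funX 2 (measurable_cmod mr mi).
have id : mu.-integrable (@I11 R) (EFin \o (fun x => 2 * B ^+ 2 + 2 * c ^+ 2 * cmod (v x) ^+ 2)).
  apply: (@integrableS _ _ _ mu D); [exact: mD | by rewrite I11E | | ].
    by rewrite I11E; exact: subset_itv_oo_cc.
  apply: integrable11D; last exact: integrable11Z.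
  by apply: continuous_integrable11; exact: continuous11_cst.
have mI : measurable (@I11 R) by rewrite I11E.
suff : mu.-integrable (@I11 R) (EFin \o (fun x => cmod (b x + c%:C * v x) ^+ 2)).
  move=> /integrableP[_]; under eq_integral do rewrite /= ger0_norm ?sqr_ge0//.
  by [].
apply: le_integrable id => //; first exact/measurable_EFinP.
move=> x x11; rewrite /= lee_fin [leRHS]ger0_norm; last first.
  by apply: addr_ge0; repeat first [exact: sqr_ge0 | exact: ler0n | apply: mulr_ge0].
rewrite ger0_norm ?sqr_ge0//.
have := le_cmodD (b x) (c%:C * v x); rewrite cmodM cmod_real.
have := bB x x11; have := cmod_ge0 (b x); have := cmod_ge0 (b x + c%:C * v x).
rewrite -[c ^+ 2]real_normK ?num_real// -mulrA -exprMn.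
have : 0 <= `|c| * cmod (v x) by rewrite mulr_ge0 ?cmod_ge0.
move: (`|c| * cmod (v x)) (cmod (b x)) (cmod (b x + _)) => p q r p0 r0 q0 qB rq.
have : r ^+ 2 <= (B + p) ^+ 2 by rewrite lerXn2r ?nnegrE//; lra.
by have := sqr_ge0 (B - p); nra.
Qed.

Lemma L2_ccontinuous f : ccontinuous f -> L2 f.
Proof.
move=> cf; have [m1 m2] := ccontinuous_measurable cf.
have [B B0 fB] := ccontinuous_bounded cf.
have L0 : L2 (fun _ : R => 0 : R[i]).
  split; [exact: measurable_cst | exact: measurable_cst | ].
  by rewrite integral0_eq// => x _; rewrite cmod0 expr0n.
have := @L2_lin f (fun=> 0) 0 B m1 m2.
under [X in _ -> _ -> L2 X]eq_fun do rewrite mulr0 addr0.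
apply=> // x; rewrite I11E => x11; apply: fB; exact: subset_itv_oo_cc.
Qed.

(** From [y <= s + y ^ 2 / s] for every [s] above the norm; letting [s] tend to the norm also covers
    norm 0. *)
Lemma L1_le_L2norm g : L2 g -> primitive (fun x => cmod (g x)) 1 <= (fine (mu D) + 1) * L2norm g.
Proof.
move=> L2g; have [ig ig2] := L2_cintegrable L2g; have N2 := L2normE L2g.
have N0 : 0 <= L2norm g by exact: sqrtr_ge0.
set N := L2norm g in N2 N0 *; set m := fine (mu D); have m0 : 0 <= m by exact: fine_ge0.
have h (s : R) : N < s -> primitive (fun x => cmod (g x)) 1 <= (m + 1) * s.
  move=> Ns; have s0 : 0 < s by exact: le_lt_trans Ns.
  have ic : integrable11 (fun=> s) by apply: continuous_integrable11; exact: continuous11_cst.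
  apply: (@le_trans _ _ (primitive (fun x => s + s^-1 * cmod (g x) ^+ 2) 1)).
    apply: primitive_mono; first exact: cintegrable11_cmod.
      by apply: integrable11D => //; exact: integrable11Z.
    move=> x _; have := cmod_ge0 (g x); move: (cmod _) => y y0.
    rewrite -(ler_pM2l s0) mulrDr mulrA divff ?gt_eqF// mul1r.
    by nra.
  rewrite primitiveD//; [ |exact: integrable11Z|exact: D1].
  rewrite primitive_cst1 primitiveZ//; last exact: D1.
  rewrite -N2 mulrDl mul1r mulrC lerD2l mulrC ler_pdivrMr// -expr2.
  by rewrite lerXn2r ?nnegrE// ltW.
apply/ler_addgt0Pl => e e0.
have m1 : 0 < m + 1 by lra.
have := h (N + e / (m + 1)); rewrite ltrDl divr_gt0// => /(_ isT).
by rewrite mulrDr [X in _ + X]mulrC divfK ?gt_eqF// addrC.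
Qed.

End ComplexPrimitive.

(** * Green-type construction from a fundamental system *)

Section Resolvent.
Context {R : realType}.
Local Notation mu := (@lebesgue_measure R).
Local Notation D := (`[(-1 : R), 1]%classic).
Local Notation Re := complex.Re.
Local Notation Im := complex.Im.

Lemma measurable_off_finite (k : R -> R) (E : seq R) :
  (forall x : R, -1 < x < 1 -> x \notin E -> {for x, continuous k}) -> measurable_fun D k.
Proof.
move=> ck; pose F : set R := [set` (-1 :: 1 :: E)].
have fF : finite_set F by exact: finite_seq.
have mF (A : set R) : finite_set A -> measurable A.
  move=> fA; apply: countable_measurable; last exact: finite_set_countable.
  by move=> t; exact: measurable_set1.
have cF : closed F.
  by apply: accessible_finite_set_closed.1 fF; exact: hausdorff_accessible (@Rhausdorff R).
have oU : open (`]-1, 1[%classic `&` ~` F).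
  by apply: openI; [exact: interval_open | exact: closed_openC].
have mk : measurable_fun ((`]-1, 1[%classic `&` ~` F) `|` F) k.
  apply/measurable_funU; [exact: open_measurable | exact: mF | split].
    apply: open_continuous_measurable_fun => // x; rewrite inE => -[/=].
    rewrite in_itv /= => x11 xF; apply: ck => //.
    by apply/negP => xE; apply: xF; rewrite /F /= !inE xE !orbT.
  by move=> _ Y mY; apply: mF; exact: finite_setIl.
apply: measurable_funS mk.
  by apply: measurableU; [exact: open_measurable | exact: mF].
move=> x; rewrite /= in_itv /= => /andP[x0 x1].
have [xF|xF] := pselect (F x); [by right|left; split => //].
rewrite in_itv /= !lt_neqAle x0 x1 !andbT; apply/andP; split; apply/eqP => xe; apply: xF;
  by rewrite /F /= !inE -?xe ?xe eqxx ?orbT.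
Qed.

Variables (V : R -> R[i]) (E : seq R) (h B : R) (z : R[i]).
Hypotheses (h0 : 0 < h) (VB : forall x : R, D x -> cmod (V x) <= B).
Hypothesis V_cont : forall x : R, -1 < x < 1 -> x \notin E -> ccontinuous_at V x.

Definition potential (x : R) : R[i] := (V x - z) / h%:C ^+ 2.
Local Notation q := potential.

Let hC0 : h%:C ^+ 2 != 0 :> R[i].
Proof. by rewrite expf_neq0// -cmod_gt0 cmod_real normr_gt0 gt_eqF. Qed.

Lemma ccontinuous_at_cst (c : R[i]) (x : R) : ccontinuous_at (fun=> c) x.
Proof. by split; exact: cvg_cst. Qed.

Lemma potential_at (x : R) : -1 < x < 1 -> x \notin E -> ccontinuous_at q x.
Proof.
move=> x11 xE; have cV := V_cont x11 xE.
rewrite /potential.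
apply: (@ccontinuous_atM R (fun x => V x - z) (fun=> (h%:C ^+ 2)^-1)); last exact: ccontinuous_at_cst.
case: cV => [c1 c2]; split.
  rewrite (_ : (fun y => _) = fun y : R => Re (V y) - Re z).
    by apply: cvgB => //; exact: cvg_cst.
  by apply/funext => y; rewrite ReD ReN.
rewrite (_ : (fun y => _) = fun y : R => Im (V y) - Im z).
  by apply: cvgB => //; exact: cvg_cst.
by apply/funext => y; rewrite ImD ImN.
Qed.

Lemma potential_bounded : exists2 K, 0 <= K & forall x, D x -> cmod (q x) <= K.
Proof.
have B0 : 0 <= B by exact: le_trans (cmod_ge0 _) (VB (@D1 R)).
exists ((B + cmod z) * cmod ((h%:C ^+ 2)^-1)).
  by rewrite mulr_ge0 ?addr_ge0 ?cmod_ge0.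
move=> x Dx; rewrite /potential cmodM ler_wpM2r ?cmod_ge0//.
by rewrite (le_trans (le_cmodB _ _))// lerD2r VB.
Qed.

Lemma potential_integrable : cintegrable11 q.
Proof.
have [K K0 qK] := potential_bounded; split.
  apply: (@bounded_integrable11 _ _ K).
    by apply: (@measurable_off_finite _ E) => x x11 xE; case: (potential_at x11 xE).
  by move=> x Dx; exact: le_trans (normr_Re_le _) (qK x Dx).
apply: (@bounded_integrable11 _ _ K).
  by apply: (@measurable_off_finite _ E) => x x11 xE; case: (potential_at x11 xE).
by move=> x Dx; exact: le_trans (normr_Im_le _) (qK x Dx).
Qed.

Lemma potentialM_integrable (w : R -> R[i]) : ccontinuous w -> cintegrable11 (fun x => q x * w x).
Proof. by move=> cw; apply: cintegrable11M => //; exact: potential_integrable. Qed.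

Lemma potentialM_at (w : R -> R[i]) (x : R) : ccontinuous w -> -1 < x < 1 -> x \notin E ->
  ccontinuous_at (fun x => q x * w x) x.
Proof.
by move=> cw x11 xE; apply: ccontinuous_atM; [exact: potential_at|exact: ccontinuous_at11].
Qed.

Variables phi phi1 psi psi1 : R -> R[i].
Hypotheses (cphi : ccontinuous phi) (cphi1 : ccontinuous phi1)
  (cpsi : ccontinuous psi) (cpsi1 : ccontinuous psi1).
Hypotheses (dphi : forall x : R, -1 < x < 1 -> x \notin E -> cder phi x (phi1 x))
  (dphi1 : forall x : R, -1 < x < 1 -> x \notin E -> cder phi1 x (q x * phi x))
  (dpsi : forall x : R, -1 < x < 1 -> x \notin E -> cder psi x (psi1 x))
  (dpsi1 : forall x : R, -1 < x < 1 -> x \notin E -> cder psi1 x (q x * psi x)).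
Hypotheses (phiN : phi (-1) = 0) (phi1N : phi1 (-1) = 1)
  (psiN : psi (-1) = 1).
Hypothesis phi_1 : phi 1 != 0.

Lemma wronskian (x : R) : D x -> phi1 x * psi x - phi x * psi1 x = 1.
Proof.
move=> Dx; transitivity (phi1 (-1) * psi (-1) - phi (-1) * psi1 (-1)); last first.
  by rewrite phiN phi1N psiN mul0r subr0 mulr1.
apply: (@cconstant_off_finite _ E (fun x => phi1 x * psi x - phi x * psi1 x)) => //.
  by apply: ccontinuousB; exact: ccontinuousM.
move=> t t11 tE.
apply: cder_eq (cderB (cderM (dphi1 t11 tE) (dpsi t11 tE)) (cderM (dphi t11 tE) (dpsi1 t11 tE))) _.
by ring.
Qed.

(* Substituting [F = f + W] with [W'' = v / h ^ 2] turns [H_h f - z f = v] into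
   [F'' = q * (F - W)], whose right-hand side is continuous off [E]. *)
Lemma source_bound : exists2 C : R, 0 <= C & forall (F F1 W : R -> R[i]) (S : R),
  ccontinuous F -> ccontinuous F1 -> ccontinuous W ->
  (forall x : R, -1 < x < 1 -> x \notin E -> cder F x (F1 x)) ->
  (forall x : R, -1 < x < 1 -> x \notin E -> cder F1 x (q x * (F x - W x))) ->
  F (-1) = 0 -> F 1 = W 1 -> (forall x, D x -> cmod (W x) <= S) ->
  forall x, D x -> cmod (F x) <= C * S.
Proof.
have [K K0 qK] := potential_bounded.
have [P P0 phiP] := ccontinuous_bounded cphi.
have [Q Q0 psiQ] := ccontinuous_bounded cpsi.
pose L := 2 * fine (mu D) * K; have L0 : 0 <= L by rewrite !mulr_ge0// fine_ge0.
pose M := (cmod (phi 1))^-1 * (Q * (L * P) + 1) + 2 * (L * Q).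
have M0 : 0 <= M.
  have i0 : 0 <= (cmod (phi 1))^-1 by rewrite invr_ge0 cmod_ge0.
  by rewrite /M; repeat first [done | apply: addr_ge0 | apply: mulr_ge0].
exists (Q * (L * P) + P * M).
  by repeat first [done | apply: addr_ge0 | apply: mulr_ge0].
move=> F F1 W S cF cF1 cW dF dF1 FN F1W WS.
have S0 : 0 <= S by exact: le_trans (cmod_ge0 _) (WS _ (@D1 R)).
have J_le (y : R -> R[i]) (Y : R) : ccontinuous y -> (forall x, D x -> cmod (y x) <= Y) ->
    forall x, D x -> cmod (cprimitive (fun x => q x * (W x * y x)) x) <= L * Y * S.
  move=> cy yY x Dx.
  have Y0 : 0 <= Y by exact: le_trans (cmod_ge0 _) (yY _ (@D1 R)).
  rewrite (_ : L * Y * S = 2 * fine (mu D) * (K * (S * Y))); last by rewrite /L; ring.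
  apply: cprimitive_le_bound => //.
    by apply: potentialM_integrable; exact: ccontinuousM.
  move=> t Dt; rewrite cmodM (cmodM (W t)).
  apply: ler_pM; [exact: cmod_ge0|by rewrite mulr_ge0 ?cmod_ge0|exact: qK|].
  by apply: ler_pM; rewrite ?cmod_ge0 ?WS ?yY.
(* Lagrange's identity: [F y1 - F1 y] has derivative [q W y], the source being the only term that
   does not cancel. *)
have parts (y y1 : R -> R[i]) : ccontinuous y -> ccontinuous y1 ->
    (forall x : R, -1 < x < 1 -> x \notin E -> cder y x (y1 x)) ->
    (forall x : R, -1 < x < 1 -> x \notin E -> cder y1 x (q x * y x)) ->
    forall x, D x -> F x * y1 x - F1 x * y x =
      - F1 (-1) * y (-1) + cprimitive (fun x => q x * (W x * y x)) x.
  move=> cy cy1 dy dy1 x Dx.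
  rewrite (@cprimitiveE _ E (fun x => F x * y1 x - F1 x * y x) (fun x => q x * (W x * y x)))//.
  - by rewrite FN mul0r sub0r mulNr.
  - by apply: ccontinuousB; exact: ccontinuousM.
  - by apply: potentialM_integrable; exact: ccontinuousM.
  - by move=> t t11 tE; apply: potentialM_at => //; exact: ccontinuousM.
  - move=> t t11 tE.
    apply: cder_eq (cderB (cderM (dF t t11 tE) (dy1 t t11 tE)) (cderM (dF1 t t11 tE) (dy t t11 tE))) _.
    by ring.
have G := parts _ _ cphi cphi1 dphi dphi1; have H := parts _ _ cpsi cpsi1 dpsi dpsi1.
have Gl := J_le _ _ cphi phiP; have Hl := J_le _ _ cpsi psiQ.
set JG := cprimitive _ in G Gl; set JH := cprimitive _ in H Hl.
clearbody JG JH.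
(* Multiplying by the Wronskian, which is 1, and inserting both identities eliminates [F1 x]. *)
have FE x : D x -> F x = psi x * JG x - phi x * (- F1 (-1) + JH x).
  move=> Dx; rewrite -[LHS]mulr1 -(wronskian Dx).
  have g := G x Dx; have hh := H x Dx.
  rewrite phiN mulr0 add0r in g; rewrite psiN mulr1 in hh.
  by rewrite -g -hh; ring.
(* The right boundary condition determines the remaining unknown [F1 (-1)]; this is where [phi 1] is
   divided by. *)
have c0 : cmod (F1 (-1)) <= ((cmod (phi 1))^-1 * (Q * (L * P) + 1) + L * Q) * S.
  have e1 := FE 1 (@D1 R); rewrite F1W in e1.
  have -> : F1 (-1) = (W 1 - psi 1 * JG 1) / phi 1 + JH 1.
    by rewrite e1; field; exact: phi_1.
  rewrite (le_trans (le_cmodD _ _))// [leRHS]mulrDl; apply: lerD; last exact/Hl/D1.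
  rewrite cmodM cmodV mulrC -mulrA ler_wpM2l ?invr_ge0 ?cmod_ge0//.
  rewrite (le_trans (le_cmodB _ _))// [leRHS]mulrDl mul1r addrC.
  apply: lerD; last exact/WS/D1.
  rewrite cmodM -mulrA; apply: ler_pM; rewrite ?cmod_ge0 ?psiQ ?Gl//; exact: D1.
move=> x Dx; rewrite FE// (le_trans (le_cmodB _ _))// [leRHS]mulrDl; apply: lerD.
  by rewrite cmodM -mulrA; apply: ler_pM; rewrite ?cmod_ge0 ?psiQ ?Gl.
rewrite cmodM -mulrA; apply: ler_pM; rewrite ?cmod_ge0 ?phiP//.
rewrite (le_trans (le_cmodD _ _))// cmodN.
have := Hl x Dx; rewrite /M => h1.
rewrite (_ : 2 * (L * Q) = L * Q + L * Q); last by ring.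
by rewrite addrA mulrDl; apply: lerD.
Qed.

(** Variation of constants; the multiple [c] of [phi] leaves the left boundary condition intact and
    adjusts the right one. *)
Lemma source_exists (W : R -> R[i]) : ccontinuous W -> exists F F1 : R -> R[i],
  [/\ ccontinuous F, ccontinuous F1, F (-1) = 0 /\ F 1 = W 1,
    forall x : R, -1 < x < 1 -> x \notin E -> cder F x (F1 x) &
    forall x : R, -1 < x < 1 -> x \notin E -> cder F1 x (q x * (F x - W x))].
Proof.
move=> cW.
pose A x := cprimitive (fun x => q x * (W x * phi x)) x.
pose C x := cprimitive (fun x => q x * (W x * psi x)) x.
have iA : cintegrable11 (fun x => q x * (W x * phi x)).
  by apply: potentialM_integrable; exact: ccontinuousM.
have iC : cintegrable11 (fun x => q x * (W x * psi x)).
  by apply: potentialM_integrable; exact: ccontinuousM.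
have cA : ccontinuous A by exact: cprimitive_continuous.
have cC : ccontinuous C by exact: cprimitive_continuous.
have dA x : -1 < x < 1 -> x \notin E -> cder A x (q x * (W x * phi x)).
  move=> x11 xE; apply: (@cprimitive_cder _ (fun x => q x * (W x * phi x))) => //.
  by apply: (@potentialM_at (fun x => W x * phi x)) => //; exact: ccontinuousM.
have dC x : -1 < x < 1 -> x \notin E -> cder C x (q x * (W x * psi x)).
  move=> x11 xE; apply: (@cprimitive_cder _ (fun x => q x * (W x * psi x))) => //.
  by apply: (@potentialM_at (fun x => W x * psi x)) => //; exact: ccontinuousM.
pose c := (W 1 - (psi 1 * A 1 - phi 1 * C 1)) / phi 1.
exists (fun x => psi x * A x - phi x * C x + phi x * c).
exists (fun x => psi1 x * A x - phi1 x * C x + phi1 x * c).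
split.
- apply: ccontinuousD; first by apply: ccontinuousB; exact: ccontinuousM.
  by apply: ccontinuousM => //; exact: ccontinuous_cst.
- apply: ccontinuousD; first by apply: ccontinuousB; exact: ccontinuousM.
  by apply: ccontinuousM => //; exact: ccontinuous_cst.
- split; first by rewrite /A /C !cprimitiveN1 phiN !(mul0r, mulr0) subrr add0r.
  by rewrite /c; field; exact: phi_1.
- move=> x x11 xE.
  apply: cder_eq (cderD (cderB (cderM (dpsi x11 xE) (dA x x11 xE))
    (cderM (dphi x11 xE) (dC x x11 xE))) (cderM (dphi x11 xE) (cder_cst c x))) _.
  by ring.
- move=> x x11 xE.
  apply: cder_eq (cderD (cderB (cderM (dpsi1 x11 xE) (dA x x11 xE))
    (cderM (dphi1 x11 xE) (dC x x11 xE))) (cderM (dphi1 x11 xE) (cder_cst c x))) _.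
  have Dx : D x by move: x11 => /andP[? ?]; rewrite /= in_itv /= !ltW.
  apply/eqP; rewrite -subr_eq0; apply/eqP.
  transitivity (q x * W x * (1 - (phi1 x * psi x - phi x * psi1 x))); first by ring.
  by rewrite wronskian// subrr mulr0.
Qed.


Lemma cder_near (f g : R -> R[i]) (x : R) d : (\forall y \near x, g y = f y) ->
  cder g x d -> cder f x d.
Proof.
move=> nx [d1 d2].
by split; [apply: near_eq_is_derive d1|apply: near_eq_is_derive d2]; apply: filterS nx => y ->.
Qed.

Lemma cder_eq11 (f g : R -> R[i]) (x : R) d : -1 < x < 1 -> (forall y, D y -> f y = g y) ->
  cder g x d -> cder f x d.
Proof.
move=> x11 fg; apply: cder_near.
have : \forall y \near x, y \in `](-1 : R), 1[ by apply: near_in_itvoo; rewrite in_itv.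
apply: filterS => y; rewrite in_itv /= => /andP[y1 y2].
by rewrite fg//= in_itv /= !ltW.
Qed.

Lemma L2_potential (f v : R -> R[i]) : ccontinuous f -> L2 v ->
  L2 (fun x => q x * f x + (- (h ^+ 2)^-1)%:C * v x).
Proof.
move=> cf L2v; have [K K0 qK] := potential_bounded.
have [P P0 fP] := ccontinuous_bounded cf.
have [i1 i2] := potentialM_integrable cf.
apply: (@L2_lin _ (fun x => q x * f x) v _ (K * P)) => //.
- by apply: measurableI11; exact: integrable11_measurable.
- by apply: measurableI11; exact: integrable11_measurable.
- move=> x; rewrite I11E => /subset_itv_oo_cc Dx.
  by rewrite cmodM; apply: ler_pM; rewrite ?cmod_ge0 ?qK ?fP.
Qed.

Lemma L2_shift (f v : R -> R[i]) (c : R[i]) : ccontinuous f -> L2 v ->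
  L2 (fun x => v x + c * f x).
Proof.
move=> cf L2v; have ccf := ccontinuousM (ccontinuous_cst c) cf.
have [P P0 fP] := ccontinuous_bounded ccf; have [m1 m2] := ccontinuous_measurable ccf.
suff : L2 (fun x => c * f x + 1%:C * v x).
  by congr L2; apply/funext => x; rewrite (_ : 1%:C = 1 :> R[i])// mul1r addrC.
apply: (@L2_lin _ (fun x => c * f x) v 1 P m1 m2 _ L2v) => x.
by rewrite I11E => /subset_itv_oo_cc Dx; exact: fP.
Qed.

(** A bound of the supremum by the L^1 norm yields both uniqueness and the boundedness of the
    inverse in L^2. *)
Lemma apriori_bound : exists2 C : R, 0 <= C & forall f u, schrodinger h V f u ->
  forall x, D x -> cmod (f x) <= C * primitive (fun x => cmod (u x - z * f x)) 1.
Proof.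
have [C C0 HC] := source_bound.
set m := fine (mu D); have m0 : 0 <= m by exact: fine_ge0.
have hi0 : 0 <= (h ^+ 2)^-1 by rewrite invr_ge0 sqr_ge0.
exists ((C + 1) * (2 * m * ((h ^+ 2)^-1 * 2))).
  by repeat first [done | apply: addr_ge0 | apply: mulr_ge0].
move=> f u [[cf [fN f1] [df cdf ddf] _] L2u [g [L2g fg uE]]] x Dx.
pose v x := u x - z * f x; pose I := primitive (fun x => cmod (v x)) 1.
have L2v : L2 v.
  have := L2_shift (- z) cf L2u; congr L2; apply/funext => y.
  by rewrite mulNr.
have [iv _] := L2_cintegrable L2v.
pose W1 x := ((h ^+ 2)^-1)%:C * cprimitive v x; pose W := cprimitive W1.
have cJv := cprimitive_continuous iv.
have cW1 : ccontinuous W1 by apply: ccontinuousM => //; exact: ccontinuous_cst.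
have cW : ccontinuous W by apply: cprimitive_continuous; exact: ccontinuous_integrable.
have dW y : -1 < y < 1 -> cder W y (W1 y).
  move=> y11; apply: (@cprimitive_cder _ W1) => //; first exact: ccontinuous_integrable.
  exact: ccontinuous_at11.
have W1S y : D y -> cmod (W1 y) <= (h ^+ 2)^-1 * 2 * I.
  move=> Dy; rewrite cmodM cmod_real ger0_norm// -mulrA ler_wpM2l//.
  exact: cprimitive_le.
have WS y : D y -> cmod (W y) <= 2 * m * ((h ^+ 2)^-1 * 2) * I.
  move=> Dy; rewrite -[leRHS]mulrA; apply: cprimitive_le_bound => //.
  exact: ccontinuous_integrable.
have iqf := potentialM_integrable cf.
(* The distributional equation in integrated form; the almost everywhere identity for [u] suffices
   under the integral. *)
have dfE y : D y -> df y = df (-1) + (cprimitive (fun x => q x * f x) y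
    + (- (h ^+ 2)^-1)%:C * cprimitive v y).
  move=> Dy; have [ig _] := L2_cintegrable L2g; have [mg1 mg2 _] := L2g.
  rewrite ((cweak_derivative cf cdf ig mg1 mg2 (fun x H => ddf x H)).1 fg y Dy).
  rewrite -cprimitive_lin//; congr (_ + _); apply: cprimitive_ae => //.
    exact: (L2_cintegrable (L2_potential cf L2v)).1.
  move: uE; apply: filterS; first exact: (ae_filter_ringOfSetsType mu).
  move=> t tE t11; rewrite rmorphN /= fmorphV rmorphXn /= /v (tE t11) /potential.
  by rewrite rmorphXn /=; field; have := hC0; rewrite expf_eq0.
have := HC (fun x => f x + W x) (fun x => df x + W1 x) W _ (ccontinuousD cf cW)
  (ccontinuousD cdf cW1) cW _ _ _ _ WS x Dx.
move=> hb; rewrite (_ : f x = f x + W x - W x); last by rewrite addrK.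
rewrite (le_trans (le_cmodB _ _))// -[leRHS]mulrA mulrDl mul1r.
apply: lerD; last exact: WS.
apply: hb.
- by move=> t t11 _; apply: cderD; [exact: ddf|exact: dW].
- move=> t t11 tE; rewrite addrK.
  apply: (@cder_eq11 _ (fun y => df (-1) + cprimitive (fun x => q x * f x) y)) => //.
    move=> y Dy; rewrite dfE// /W1 rmorphN /= mulNr; ring.
  rewrite -[q t * f t]add0r; apply: cderD; first exact: cder_cst.
  by apply: (@cprimitive_cder _ (fun x => q x * f x)) => //; exact: potentialM_at.
- by rewrite fN /W cprimitiveN1 addr0.
- by rewrite f1 add0r.
Qed.

Lemma schrodinger_exists (v : R -> R[i]) : L2 v ->
  exists f u, schrodinger h V f u /\ eqae (fun x => u x - z * f x) v.
Proof.
move=> L2v; have [iv _] := L2_cintegrable L2v.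
pose W1 x := ((h ^+ 2)^-1)%:C * cprimitive v x; pose W := cprimitive W1.
have cJv := cprimitive_continuous iv.
have cW1 : ccontinuous W1 by apply: ccontinuousM => //; exact: ccontinuous_cst.
have cW : ccontinuous W by apply: cprimitive_continuous; exact: ccontinuous_integrable.
have dW y : -1 < y < 1 -> cder W y (W1 y).
  move=> y11; apply: (@cprimitive_cder _ W1) => //; first exact: ccontinuous_integrable.
  exact: ccontinuous_at11.
have [F [F1 [cF cF1 [FN FW] dF dF1]]] := source_exists cW.
(* The derivative extends across the points of [E], because [F] is a primitive of the continuous
   function [F1]. *)
have dF' y : -1 < y < 1 -> cder F y (F1 y).
  move=> y11; apply: (@cder_eq11 _ (fun y => F (-1) + cprimitive F1 y)) => //.
    apply: (@cprimitiveE _ E) => //; first exact: ccontinuous_integrable.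
    by move=> t t11 _; exact: ccontinuous_at11.
  rewrite -[F1 y]add0r; apply: cderD; first exact: cder_cst.
  by apply: cprimitive_cder => //; [exact: ccontinuous_integrable|exact: ccontinuous_at11].
pose f x := F x - W x; pose f1 x := F1 x - W1 x.
pose g x := q x * f x + (- (h ^+ 2)^-1)%:C * v x.
have cf : ccontinuous f by exact: ccontinuousB.
have cf1 : ccontinuous f1 by exact: ccontinuousB.
have L2g : L2 g by exact: L2_potential.
have df x : -1 < x < 1 -> cder f x (f1 x).
  by move=> x11; apply: cderB; [exact: dF'|exact: dW].
have fg : distr_deriv2 f g.
  have [ig _] := L2_cintegrable L2g; have [mg1 mg2 _] := L2g.
  apply: (cweak_derivative cf cf1 ig mg1 mg2 df).2 => x Dx.
  have iqf := potentialM_integrable cf.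
  rewrite /g cprimitive_lin// /f1.
  rewrite (@cprimitiveE _ E F1 (fun x => q x * f x) cF1 iqf _ dF1 x Dx); last first.
    by move=> t t11 tE; exact: potentialM_at.
  by rewrite /W1 cprimitiveN1 mulr0 subr0 rmorphN /= mulNr; ring.
exists f, (fun x => v x + z * f x); split.
  split.
  - split; [exact: cf| |exists f1 => //|by exists g].
    by rewrite /f FN FW /W cprimitiveN1 !subrr.
  - exact: L2_shift.
  - exists g; split => //; apply: aeW => x _.
    rewrite /g /potential rmorphN /= fmorphV rmorphXn /=.
    by field; have := hC0; rewrite expf_eq0.
by apply: aeW => x _; rewrite addrK.
Qed.

Lemma resolvent_of_nonzero : resolvent_set (schrodinger h V) z.
Proof.
have [C C0 HC] := apriori_bound.
have L2v f u : schrodinger h V f u -> L2 (fun x => u x - z * f x).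
  move=> [[cf _ _ _] L2u _]; have := L2_shift (- z) cf L2u; congr L2; apply/funext => y.
  by rewrite mulNr.
split.
- move=> f u Hf v0; have [iv _] := L2_cintegrable (L2v f u Hf).
  apply: aeW => x; rewrite I11E => /subset_itv_oo_cc Dx.
  have := HC f u Hf x Dx.
  rewrite (@primitive_ae _ _ (fun=> 0) 1 (cintegrable11_cmod iv)).
  + by rewrite primitive_cst1 mul0r mulr0 => fx; apply/eqP; rewrite -cmod_eq0 eq_le fx cmod_ge0.
  + by apply: continuous_integrable11; exact: continuous11_cst.
  + move: v0; apply: filterS; first exact: (ae_filter_ringOfSetsType mu).
    by move=> t tE t11; rewrite (tE t11) cmod0.
  + exact: D1.
- exact: schrodinger_exists.
set m := fine (mu D); have m0 : 0 <= m by exact: fine_ge0.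
exists (C * (m + 1) * (m + 1)) => f u Hf.
have N0 g : 0 <= L2norm g :> R by exact: sqrtr_ge0.
have := L1_le_L2norm (L2v f u Hf); have := HC f u Hf; set I := primitive _ 1.
have := N0 (fun x => u x - z * f x).
move: (L2norm (fun x => u x - z * f x)) => N Np fI IN.
have [[cf _ _ _] _ _] := Hf.
have [_ if2] := L2_cintegrable (L2_ccontinuous cf).
rewrite -(@ler_pXn2r _ 2)// ?nnegrE ?N0//; last first.
  by repeat first [done | apply: addr_ge0 | apply: mulr_ge0].
rewrite L2normE; last exact: L2_ccontinuous.
have CI x : D x -> cmod (f x) <= C * (m + 1) * N.
  by move=> Dx; rewrite (le_trans (fI x Dx))// -mulrA ler_wpM2l.
apply: (@le_trans _ _ ((C * (m + 1) * N) ^+ 2 * m)).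
  apply: primitive_le_bound => // x Dx; rewrite lerXn2r ?nnegrE ?cmod_ge0 ?CI//.
  by repeat first [done | apply: addr_ge0 | apply: mulr_ge0].
rewrite (_ : C * (m + 1) * (m + 1) * N = (C * (m + 1) * N) * (m + 1)); last by ring.
rewrite [leRHS]exprMn ler_wpM2l ?sqr_ge0//; nra.
Qed.

End Resolvent.

(** * Gluing of Airy solutions and spectrum *)

Section Gluing.
Context {R : realType}.

Lemma glue_continuous (f g : R -> R) (a : R) : f a = g a -> continuous f -> continuous g ->
  continuous (fun y => if y <= a then f y else g y).
Proof.
move=> fg cf cg t.
(* Written without a case distinction, the glued function is visibly a combination of continuous
   ones. *)
rewrite (_ : (fun y => _) = fun y : R => f (Num.min y a) + g (Num.max y a) - f a); last first.
  by apply/funext => y; case: leP => ya; [rewrite fg|]; ring.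
apply: cvgB; last exact: cvg_cst.
apply: cvgD.
  apply: (@continuous_comp _ _ _ (fun y : R => Num.min y a) f); last exact: cf.
  by apply: (@min_fun_continuous _ _ R id (cst a)) => y; [exact: cvg_id|exact: cvg_cst].
apply: (@continuous_comp _ _ _ (fun y : R => Num.max y a) g); last exact: cg.
by apply: (@max_fun_continuous _ _ R id (cst a)) => y; [exact: cvg_id|exact: cvg_cst].
Qed.

Lemma glue_ccontinuous (f g : R -> R[i]) (a : R) : f a = g a ->
  (forall t, ccontinuous_at f t) -> (forall t, ccontinuous_at g t) ->
  forall t, ccontinuous_at (fun y => if y <= a then f y else g y) t.
Proof.
move=> fg cf cg t; split.
  rewrite (_ : (fun y => _) =
      fun y : R => if y <= a then complex.Re (f y) else complex.Re (g y)).
    by apply: glue_continuous; [rewrite fg|move=> y; case: (cf y)|move=> y; case: (cg y)].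
  by apply/funext => y; case: ifP.
rewrite (_ : (fun y => _) =
    fun y : R => if y <= a then complex.Im (f y) else complex.Im (g y)).
  by apply: glue_continuous; [rewrite fg|move=> y; case: (cf y)|move=> y; case: (cg y)].
by apply/funext => y; case: ifP.
Qed.

Lemma cder_glue_left (f g : R -> R[i]) (a x : R) d : x < a -> cder f x d ->
  cder (fun y => if y <= a then f y else g y) x d.
Proof.
move=> xa; apply: cder_near; near=> y.
by have -> : y <= a by apply: ltW; near: y; exact: lt_nbhsl.
Unshelve. all: by end_near.
Qed.

Lemma cder_glue_right (f g : R -> R[i]) (a x : R) d : a < x -> cder g x d ->
  cder (fun y => if y <= a then f y else g y) x d.
Proof.
move=> ax; apply: cder_near; near=> y.
have ay : a < y by near: y; exact: lt_nbhsr.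
by rewrite leNgt ay.
Unshelve. all: by end_near.
Qed.

Lemma cdiff_cder (A : R[i] -> R[i]) (t : R) d : cdiff A t%:C d -> cder (fun t => A t%:C) t d.
Proof. by move=> dA; apply: cder_eq (cder_comp dA (cder_id t)) _; rewrite mulr1. Qed.

Lemma cder_ccontinuous (f : R -> R[i]) (t : R) d : cder f t d -> ccontinuous_at f t.
Proof. by move=> /cder_continuous. Qed.

(** The same solution is needed in two forms: entire functions [Y i] for the complex paths, and one
    function [G] on the line for the resolvent. Both are built together and linked at [x n]. *)
Lemma glued_solution (n : nat) (x : nat -> R) (m l : nat -> R[i]) (z : R[i]) (h : R)
    (y0 y1 : R[i]) : (1 <= n)%N -> h != 0 ->
  (forall i, (1 <= i <= n)%N -> x i.-1 < x i) ->
  exists Y Y1 : nat -> R[i] -> R[i], exists G G1 : R -> R[i],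
  [/\ [/\ forall i, (1 <= i <= n)%N -> airy_solution h (m i) (l i - z) (Y i) (Y1 i),
      forall i, (1 <= i < n)%N -> Y i (x i)%:C = Y i.+1 (x i)%:C /\
                                  Y1 i (x i)%:C = Y1 i.+1 (x i)%:C,
      Y 1%N (x 0%N)%:C = y0 & Y1 1%N (x 0%N)%:C = y1],
    [/\ G (x 0%N) = y0, G1 (x 0%N) = y1 & G (x n) = Y n (x n)%:C],
    forall t, ccontinuous_at G t /\ ccontinuous_at G1 t &
    forall i t, (1 <= i <= n)%N -> x i.-1 < t < x i ->
      cder G t (G1 t) /\ cder G1 t ((m i * t%:C + l i - z) / h%:C ^+ 2 * G t)].
Proof.
move=> n1 h0 x_incr.
have piece (i : nat) (t0 v0 v1 : R[i]) : exists p : (R[i] -> R[i]) * (R[i] -> R[i]),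
    [/\ p.1 t0 = v0, p.2 t0 = v1 & airy_solution h (m i) (l i - z) p.1 p.2].
  have [A [A1 [e0 e1 dA dA1]]] :=
    airy_exists (m i / h%:C ^+ 2) ((l i - z) / h%:C ^+ 2) t0 v0 v1.
  exists (A, A1); split=> //; split=> //= t.
  by have := dA1 t; congr cdiff; ring.
pose P i t0 v0 v1 := projT1 (cid (piece i t0 v0 v1)).
have PP i t0 v0 v1 := projT2 (cid (piece i t0 v0 v1)).
rewrite -/(P _ _ _ _) in PP.
(* Index shift: [S j] is the solution on the piece [j + 1], started at [x j] with the values left by
   its predecessor. *)
pose S := fix S j := if j is j'.+1 then
  P j.+1 (x j)%:C ((S j').1 (x j)%:C) ((S j').2 (x j)%:C) else P 1%N (x 0%N)%:C y0 y1.
pose Y i := (S i.-1).1; pose Y1 i := (S i.-1).2.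
have Ysol i : (1 <= i)%N -> airy_solution h (m i) (l i - z) (Y i) (Y1 i).
  case: i => // -[|j] _; rewrite /Y /Y1 /=; first by case: (PP 1%N (x 0%N)%:C y0 y1).
  by case: (PP j.+2 (x j.+1)%:C ((S j).1 (x j.+1)%:C) ((S j).2 (x j.+1)%:C)).
have Ymatch i : (1 <= i)%N -> Y i (x i)%:C = Y i.+1 (x i)%:C /\ Y1 i (x i)%:C = Y1 i.+1 (x i)%:C.
  case: i => // j _; rewrite /Y /Y1 /=.
  by have [-> -> _] := PP j.+2 (x j.+1)%:C ((S j).1 (x j.+1)%:C) ((S j).2 (x j.+1)%:C).
have [Y0 Y10] : Y 1%N (x 0%N)%:C = y0 /\ Y1 1%N (x 0%N)%:C = y1.
  by rewrite /Y /Y1 /=; have [] := PP 1%N (x 0%N)%:C y0 y1.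
clearbody Y Y1.
have Yd i t : (1 <= i)%N -> cder (fun t => Y i t%:C) t (Y1 i t%:C) /\
    cder (fun t => Y1 i t%:C) t ((m i * t%:C + l i - z) / h%:C ^+ 2 * Y i t%:C).
  move=> i1; have [d1 d2] := Ysol i i1; split; first exact/cdiff_cder/d1.
  by rewrite -(addrA (m i * _)); exact/cdiff_cder/d2.
have x0_le i : (i <= n)%N -> x 0%N <= x i.
  elim: i => // i IH ni; rewrite (le_trans (IH (ltnW ni)))// ltW//.
  exact: (x_incr i.+1).
have x_le i j : (i <= j)%N -> (j <= n)%N -> x i <= x j.
  elim: j => [|j IH]; first by rewrite leqn0 => /eqP ->.
  rewrite leq_eqVlt => /predU1P[->//|ij] jn.
  by rewrite (le_trans (IH ij (ltnW jn)))// ltW//; exact: (x_incr j.+1).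
suff H k : (1 <= k <= n)%N -> exists G G1 : R -> R[i],
    [/\ G (x 0%N) = y0 /\ G1 (x 0%N) = y1,
      forall t, x k.-1 <= t -> G t = Y k t%:C /\ G1 t = Y1 k t%:C,
      forall t, ccontinuous_at G t /\ ccontinuous_at G1 t &
      forall i t, (1 <= i <= k)%N -> x i.-1 < t < x i ->
        cder G t (G1 t) /\ cder G1 t ((m i * t%:C + l i - z) / h%:C ^+ 2 * G t)].
  have nn : (1 <= n <= n)%N by rewrite n1 leqnn.
  have [G [G1 [[G0 G10] GY cG dG]]] := H n nn.
  exists Y, Y1, G, G1; split=> //.
    split=> // i /andP[i1 _]; [exact: Ysol|exact: Ymatch].
  by split=> //; have [] := GY (x n) (ltW (x_incr n nn)).
elim: k => // -[|k] IH /andP[_ kn].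
  exists (fun t => Y 1%N t%:C), (fun t => Y1 1%N t%:C); split=> //.
    by move=> t; have [d1 d2] := Yd 1%N t isT; split; apply: cder_ccontinuous; eassumption.
  by move=> i t /andP[i0 i1] _; have -> : i = 1%N; [by lia|exact: Yd].
have [|G [G1 [[G0 G10] GY cG dG]]] := IH; first by rewrite /= ltnW.
have [eY eY1] := Ymatch k.+1 isT.
have xk : x k < x k.+1 by apply: (x_incr k.+1); rewrite /= ltnW.
have [gY gY1] := GY (x k.+1) (ltW xk).
exists (fun t => if t <= x k.+1 then G t else Y k.+2 t%:C).
exists (fun t => if t <= x k.+1 then G1 t else Y1 k.+2 t%:C).
have cY t := Yd k.+2 t isT.
split.
- by rewrite x0_le// ltnW.
- move=> t /=; rewrite le_eqVlt => /predU1P[<-|xt].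
    by rewrite lexx gY gY1 eY eY1.
  by rewrite leNgt xt.
- move=> t; split; apply: glue_ccontinuous => [|t'|t'].
  + by rewrite gY.
  + by case: (cG t').
  + by case: (cY t') => d _; exact: cder_ccontinuous d.
  + by rewrite gY1.
  + by case: (cG t').
  + by case: (cY t') => _ d; exact: cder_ccontinuous d.
- move=> i t /andP[i1]; rewrite leq_eqVlt => /predU1P[->|ik] /andP[ti it].
    have -> : (t <= x k.+1) = false by rewrite leNgt ti.
    by case: (cY t) => d d'; split; apply: cder_glue_right.
  have tk : t < x k.+1.
    by rewrite (lt_le_trans it)// x_le// ltnW.
  have [|d d'] := dG i t _ (introT andP (conj ti it)); first by rewrite i1.
  by rewrite (ltW tk); split; apply: cder_glue_left.
Qed.

End Gluing.

(** * From nonvanishing to the location of the spectrum *)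

Section Spectrum.
Context {R : realType}.
Local Notation D := (`[(-1 : R), 1]%classic).
Variables (n : nat) (x : nat -> R) (m l : nat -> R[i]) (V : R -> R[i]).
Hypotheses (n_ge1 : (1 <= n)%N) (x_first : x 0%N = -1) (x_last : x n = 1).
Hypothesis x_incr : forall i : nat, (1 <= i <= n)%N -> x i.-1 < x i.
Hypothesis m_neq0 : forall i : nat, (1 <= i <= n)%N -> m i != 0.
Hypothesis V_linear : forall (i : nat) (t : R), (1 <= i <= n)%N ->
  x i.-1 < t < x i -> V t = m i * t%:C + l i.
Hypothesis V_break : forall i : nat, (1 <= i < n)%N ->
  m i * (x i)%:C + l i = m i.+1 * (x i)%:C + l i.+1 -> m i <> m i.+1.

Let breaks := [seq x i | i <- iota 0 n.+1].

Let break_in i : (i <= n)%N -> x i \in breaks.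
Proof. by move=> ni; apply: map_f; rewrite mem_iota add0n ltnS. Qed.

Let locate (t : R) : -1 < t < 1 -> t \notin breaks ->
  exists2 i, (1 <= i <= n)%N & x i.-1 < t < x i.
Proof.
move=> /andP[t0 t1] tb; rewrite -x_first in t0; rewrite -x_last in t1.
suff H k : (k <= n)%N -> t < x k -> exists2 i, (1 <= i <= n)%N & x i.-1 < t < x i by exact: (H n).
elim: k => [|k IH] kn tk; first by have := lt_trans t0 tk; rewrite ltxx.
have [/(IH (ltnW kn))//|kt] := ltP t (x k).
exists k.+1 => //=; rewrite tk andbT lt_neqAle kt andbT.
by apply: contraNneq tb => <-; exact: break_in (ltnW kn).
Qed.

(** The values at the break points enter the sum separately from the linear formulas. *)
Let V_bounded : exists B : R, forall t, D t -> cmod (V t) <= B.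
Proof.
exists (\sum_(i < n.+1) (cmod (V (x i)) + (cmod (m i) + cmod (l i)))) => t Dt.
have term (i : nat) : (i <= n)%N -> cmod (V (x i)) + (cmod (m i) + cmod (l i)) <=
    \sum_(i < n.+1) (cmod (V (x i)) + (cmod (m i) + cmod (l i))).
  rewrite -ltnS => ni; rewrite (bigD1 (Ordinal ni))//= lerDl.
  by apply: sumr_ge0 => j _; rewrite !addr_ge0 ?cmod_ge0.
have [/mapP[i + ->]|tb] := boolP (t \in breaks).
  rewrite mem_iota add0n ltnS => /= ni; apply: le_trans (term i ni).
  by rewrite lerDl addr_ge0 ?cmod_ge0.
have t11 : -1 < t < 1.
  move: Dt; rewrite /= in_itv /= => /andP[t0 t1].
  rewrite !lt_neqAle t0 t1 !andbT; apply/andP; split; apply: contraNneq tb.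
    by move=> <-; rewrite -x_first break_in.
  by move=> ->; rewrite -x_last break_in.
have [i i1n it] := locate t11 tb.
have /andP[_ ni] := i1n; apply: le_trans (term i ni).
rewrite (V_linear i1n it) (le_trans (le_cmodD _ _))// cmodM cmod_real.
rewrite addrA lerD2r -[leLHS]add0r lerD ?cmod_ge0// ler_piMr ?cmod_ge0//.
by rewrite ler_norml; move: t11 => /andP[? ?]; rewrite !ltW.
Qed.

Let V_cont (t : R) : -1 < t < 1 -> t \notin breaks -> ccontinuous_at V t.
Proof.
move=> t11 tb; have [i i1n /andP[it ti]] := locate t11 tb.
apply: (@cder_ccontinuous _ _ _ (m i * 1 + 0)).
apply: (@cder_near _ _ (fun t => m i * t%:C + l i)).
  near=> y; rewrite (@V_linear i)//; apply/andP; split; near: y.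
    exact: lt_nbhsr.
  exact: lt_nbhsl.
by apply: cderD; [apply: cderZ; exact: cder_id|exact: cder_cst].
Unshelve. all: by end_near.
Qed.

(** [G] with data (0, 1) and [P] with data (1, 0) at -1 form the fundamental system, and [G 1] is
    the value of the chain at its right end. *)
Lemma chain_resolvent (z : R[i]) (h : R) : 0 < h ->
  (forall Y Y1, chain_solution n x m l z h Y Y1 -> Y n (x n)%:C != 0) ->
  resolvent_set (schrodinger h V) z.
Proof.
move=> h0 Yn; have [B VB] := V_bounded.
have hN : h != 0 by rewrite gt_eqF.
have [Y [Y1 [G [G1 [[Ysol Ym Y0 Y10] [G0 G10 Gn] cG dG]]]]] :=
  @glued_solution R n x m l z h 0 1 n_ge1 hN x_incr.
have [_ [_ [P [P1 [_ [P0 P10 _] cP dP]]]]] :=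
  @glued_solution R n x m l z h 1 0 n_ge1 hN x_incr.
rewrite x_first in G0 G10 P0 P10; rewrite x_last in Gn.
have cont (f : R -> R[i]) : (forall t, ccontinuous_at f t) -> ccontinuous f.
  by move=> cf; split; apply: continuousT11 => t; case: (cf t).
have der (f f1 : R -> R[i]) :
    (forall i t, (1 <= i <= n)%N -> x i.-1 < t < x i ->
      cder f t (f1 t) /\ cder f1 t ((m i * t%:C + l i - z) / h%:C ^+ 2 * f t)) ->
    forall t : R, -1 < t < 1 -> t \notin breaks ->
      cder f t (f1 t) /\ cder f1 t (potential V h z t * f t).
  move=> df t t11 tb; have [i i1n it] := locate t11 tb.
  by have := df i t i1n it; rewrite /potential (V_linear i1n it).
have G1_neq0 : G 1 != 0.
  rewrite Gn -x_last; apply: (Yn Y Y1); split=> //.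
  by rewrite Y10 oner_neq0.
apply: (@resolvent_of_nonzero R V breaks h B z h0 VB V_cont G G1 P P1) => //.
- by apply: cont => t; case: (cG t).
- by apply: cont => t; case: (cG t).
- by apply: cont => t; case: (cP t).
- by apply: cont => t; case: (cP t).
- by move=> t t11 tb; case: (der G G1 dG t t11 tb).
- by move=> t t11 tb; case: (der G G1 dG t t11 tb).
- by move=> t t11 tb; case: (der P P1 dP t t11 tb).
- by move=> t t11 tb; case: (der P P1 dP t t11 tb).
Qed.

Let T := \bigcup_(i in [set i : nat | (1 <= i <= n)%N])
  Yset (m i * (x i.-1)%:C + l i) (m i * (x i)%:C + l i).

Lemma local_resolvent (p : R[i]) : ~ T p -> exists del h1 : R, [/\ 0 < del, 0 < h1 &
  forall (z : R[i]) (h : R), cmod (z - p) < del -> 0 < h < h1 ->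
    resolvent_set (schrodinger h V) z].
Proof.
move=> Tp.
(* Outside the range of pieces the pair (0, 0) serves as a dummy, so that [choice] yields functions
   on all of [nat]. *)
have ex i : exists ab : R[i] * R[i], (1 <= i <= n)%N ->
    [/\ ab.1 ^+ 2 = m i * (x i.-1)%:C + l i - p, ab.2 ^+ 2 = m i * (x i)%:C + l i - p &
      good_path (m i) ab.1 ab.2].
  have [i1n|] := boolP (1 <= i <= n)%N; last by exists (0, 0).
  have xi := x_incr i1n; have dx : 0 < x i - x i.-1 by rewrite subr_gt0.
  have dxC : (x i - x i.-1)%:C != 0 :> R[i] by rewrite -cmod_gt0 cmod_real normr_gt0 gt_eqF.
  have dE : m i * (x i)%:C + l i - (m i * (x i.-1)%:C + l i) = m i * (x i - x i.-1)%:C.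
    by rewrite rmorphB /=; ring.
  have [||||a [b [aE bE ab]]] := @Yset_path R (m i * (x i.-1)%:C + l i) (m i * (x i)%:C + l i)
      p (m i) (x i - x i.-1)^-1.
  - by rewrite eq_sym -subr_eq0 dE mulf_neq0// m_neq0.
  - by rewrite invr_gt0.
  - by rewrite dE fmorphV mulrC mulfK.
  - by move=> Yp; apply: Tp; exists i.
  - by exists (a, b).
have [ab abE] := choice ex.
have [del [h1 [del0 h10 H]]] := @chain_nonvanishing R n x m l (fun i => (ab i).1)
  (fun i => (ab i).2) p n_ge1 m_neq0 (fun i H => let: And3 e _ _ := abE i H in e)
  (fun i H => let: And3 _ e _ := abE i H in e) (fun i H => let: And3 _ _ e := abE i H in e) V_break.
exists del, h1; split=> // z h zp hh; apply: chain_resolvent; first by case/andP: hh.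
by move=> Y Y1; exact: H.
Qed.

(** Each point of the closed square of half side [N] has a neighbourhood and a threshold for [h] on
    which one alternative of [P] holds; near a point of [T] it is membership in [nhd T eps].
    Compactness leaves a single threshold. *)
Lemma spectrum_near (eps : R) (N : nat) : 0 < eps -> exists2 h0 : R, 0 < h0 &
  forall h : R, 0 < h < h0 ->
    spectrum (schrodinger h V) `&` [set z : R[i] | `|z| <= N%:R] `<=` nhd T eps.
Proof.
move=> eps0.
pose K : set (R * R) := `[- N%:R, N%:R]%classic `*` `[- N%:R, N%:R]%classic.
have cK : compact K by apply: compact_setX; exact: segment_compact.
pose P (h : R) (w : R * R) := nhd T eps (w.1 +i* w.2) \/
  resolvent_set (schrodinger h V) (w.1 +i* w.2).
have close (p z : R[i]) (d : R) : `|complex.Re z - complex.Re p| < d / 2 ->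
    `|complex.Im z - complex.Im p| < d / 2 -> cmod (z - p) < d.
  move=> h1 h2; rewrite (le_lt_trans (cmod_le_ReIm _))// ReD ReN ImD ImN; lra.
have nb (w : R * R) (d : R) : 0 < d ->
    \forall u \near w, cmod ((u.1 +i* u.2) - (w.1 +i* w.2)) < d.
  move=> d0; have d2 : 0 < d / 2 by rewrite divr_gt0.
  apply/nbhs_ballP; exists (d / 2) => // u [/= u1 u2].
  by apply: close => /=; rewrite distrC.
have loc w : K w -> \forall u \near w & h \near 0^'+, P h u.
  move=> _; have [Tw|Tw] := pselect (T (w.1 +i* w.2)).
    exists ([set u : R * R | cmod ((u.1 +i* u.2) - (w.1 +i* w.2)) < eps], setT) => /=.
      by split; [exact: nb|exact: filterT].
    move=> [u h] [/= hu _]; left; exists (w.1 +i* w.2), ((u.1 +i* u.2) - (w.1 +i* w.2)).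
    by split; [by []|by rewrite normC_cmod ltcR|by rewrite addrC subrK].
  have [del [h1 [del0 h10 H]]] := local_resolvent Tw.
  exists ([set u : R * R | cmod ((u.1 +i* u.2) - (w.1 +i* w.2)) < del], [set h | 0 < h < h1]) => /=.
    split; first exact: nb.
    near=> h; apply/andP; split; near: h; [exact: nbhs_right_gt|exact: nbhs_right_lt].
  by move=> [u h] [/= hu hh]; right; exact: H hh.
have : \forall h \near 0^'+, K `<=` P h.
  by have /compact_near_coveringP cov := cK; exact: cov loc.
move=> /nbhs_ballP[e /= e0 He]; exists e => // h /andP[h0 he] z [sz /=].
rewrite normC_cmod (_ : (N%:R : R[i]) = (N%:R : R)%:C); last by rewrite rmorph_nat.
rewrite lecR => zN.
have : P h (complex.Re z, complex.Im z).
  apply: He => //=; first by rewrite /ball /= sub0r normrN gtr0_norm.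
  split; rewrite /= in_itv /= -ler_norml.
    exact: le_trans (normr_Re_le _) zN.
  exact: le_trans (normr_Im_le _) zN.
have -> : P h (complex.Re z, complex.Im z) = (nhd T eps z \/ resolvent_set (schrodinger h V) z).
  by rewrite /P; case: (z).
by case.
Unshelve. all: by end_near.
Qed.

End Spectrum.

Unset Implicit Arguments.

Theorem theorem2 (R : realType) (n : nat) (x : nat -> R)
    (m l : nat -> R[i]) (V : R -> R[i])
    (n_ge1 : (1 <= n)%N)
    (x_first : x 0%N = -1) (x_last : x n = 1)
    (x_incr : forall i : nat, (1 <= i <= n)%N -> x i.-1 < x i)
    (m_neq0 : forall i : nat, (1 <= i <= n)%N -> m i != 0)
    (V_linear : forall (i : nat) (t : R), (1 <= i <= n)%N ->
      x i.-1 < t < x i -> V t = m i * t%:C + l i)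
    (V_first : V (x 0%N) = m 1%N * (x 0%N)%:C + l 1%N)
    (V_last : V (x n) = m n * (x n)%:C + l n)
    (V_break : forall i : nat, (1 <= i < n)%N ->
      m i * (x i)%:C + l i = m i.+1 * (x i)%:C + l i.+1 -> m i <> m i.+1) :
  let T := \bigcup_(i in [set i : nat | (1 <= i <= n)%N])
             Yset (m i * (x i.-1)%:C + l i) (m i * (x i)%:C + l i) in
  forall (eps : R) (N : nat), 0 < eps -> (0 < N)%N ->
    exists2 h0 : R, 0 < h0 &
      forall h : R, 0 < h < h0 ->
        spectrum (schrodinger h V) `&` [set z : R[i] | `|z| <= N%:R]
          `<=` nhd T eps.
Proof.
move=> T eps N eps0 _.
exact: (spectrum_near n_ge1 x_first x_last x_incr m_neq0 V_linear V_break N eps0).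
Qed.
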